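(* Let $H$ be either $\mathrm{SL}_2(K)$ for a non-archimedean local field $K$, acting on its Bruhat-Tits tree $T$, or the isometry group $\mathrm{Isom}(T)$ of a locally finite simplicial tree $T$ (given along with a method of computing translation lengths). Let $G=\langle A,B\rangle$ be a two-generated subgroup of $H$ which is discrete and free of rank two, and let $C\in H$. Let $F$ be the free group of rank two generated by abstract elements $a,b$. Consider the following algorithm. (1) Run the reduction procedure (see context) on $(A,B)$ to obtain generators $X=X(A,B)$, $Y=Y(A,B)$ of $G$ which are hyperbolic and whose axes are either disjoint or intersect along a path of length $\Delta$ with $0\le\Delta<\min\{l(X),l(Y)\}$. (2) Replacing $T$ by an appropriate subtree, if necessary (see context), find a fundamental domain $D=T\setminus(U_+\cup U_-\cup V_+\cup V_-)$ for the action of $G$ on $T$, and choose a vertex $z'\in D$. (3) Set $w=1\in F$ and $z=Cz'$. (4) While $z\notin D$: (i) if $z\in U_{\pm}$, then replace $z$ by $X^{\mp1}z$ and $w$ by $wa^{\pm1}$; (ii) if $z\in V_{\pm}$, then replace $z$ by $Y^{\mp1}z$ and $w$ by $wb^{\pm1}$. (5) If $w(X(A,B),Y(A,B))=C$ and $z=z'$, then return true and the word $w(X(a,b),Y(a,b))\in F$; otherwise return false. Then this algorithm terminates after finitely many steps and produces the correct output: if $C\in G$, it returns true and outputs a word $w=w(a,b)\in F$ such that $w(A,B)=C$; otherwise it returns false.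
   Context: A non-archimedean local field $K$ is a field complete with respect to a discrete valuation $v$ with finite residue field; $\mathcal{O}$ is its ring of integers and $\pi$ a uniformiser. $\mathrm{SL}_2(K)$ has the topology induced from $K^4$. Its Bruhat-Tits tree has as vertices the equivalence classes of $\mathcal{O}$-lattices of rank two in $K^2$ under scaling by $K^\times$, two being adjacent if they have representatives $L_0\subseteq L$ with $L/L_0\cong\mathcal{O}/\pi\mathcal{O}$. $\mathrm{SL}_2(K)$ acts on it by isometries and without inversions (no element swaps two adjacent vertices). For a locally finite simplicial tree $T$, $\mathrm{Isom}(T)$ has the topology of pointwise convergence; by subdividing each edge of $T$ at its midpoint, if necessary, every element is assumed to act without inversions. Trees carry the path metric $d$ with edges of length one. Translation length: $l(g)=\min_{x\in V(T)}d(x,gx)$, where $V(T)$ is the vertex set. An element $g$ is hyperbolic if $l(g)>0$; its axis is then the line in $T$ with vertex set $\{x\in V(T): d(x,gx)=l(g)\}$, on which $g$ acts by translations of length $l(g)$. Reduction procedure on $(A,B)$: (a) set $X=A$, $Y=B$; if $l(X)=0$ or $l(Y)=0$ return false; (b) if $l(X)>l(Y)$ swap $X$ and $Y$; (c) compute $m=\min\{l(XY),l(X^{-1}Y)\}$; (d) if $m=0$ return false; (e) if $m\le l(Y)-l(X)$ replace $Y$ by an element of $\{XY,X^{-1}Y\}$ of translation length $m$ and return to (b); (f) otherwise return true and the generating pair $(X,Y)$. When $G$ is discrete and free of rank two, it terminates and returns a pair as in step (1). The sets $U_\pm,V_\pm$: choose vertices $p$ and $q$ on the axes of $X$ and $Y$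 respectively (subdividing each edge of $T$ at its midpoint if necessary) as follows. If the axes are disjoint, let $p'$ and $q'$ be the endpoints, on the axes of $X$ and $Y$ respectively, of the shortest path between the axes; $p,q$ are such that the interior of the path from $p$ to $Xp$ contains $p'$ and the interior of the path from $q$ to $Yq$ contains $q'$. If the axes intersect along a path $P$ (possibly a point), $p,q$ are such that the interiors of the paths from $p$ to $Xp$ and from $q$ to $Yq$ each contain $P$. $U_+$ (respectively $U_-$) is the maximal subtree of $T$ containing all vertices on the axis of $X$ from $Xp$ onwards (respectively up to and including $p$), with respect to the direction of translation, but no other vertices of that axis; $V_+$ and $V_-$ are defined likewise from $Y$ and $q$. Fundamental domain for $G$ acting on a topological space $S$: an open set $D\subseteq S$ with $\bigcup_{g\in G}g\overline{D}=S$ and $gD\cap hD=\varnothing$ for all distinct $g,h\in G$. The subtree in step (2): let $D_X$ and $D_Y$ be the interiors of the paths from $p$ to $Xp$ and from $q$ to $Yq$. Set $D=D_X\cup D_Y$ if the axes intersect, and let $D$ be the union of $D_X$, $D_Y$ and the path between $p'$ and $q'$ if they do not. The union of the images of $\overline{D}$ under $G$ is a subtree $S\subseteq T$, and $D$ is a fundamental domain for the action of $G$ on $S$. If the role of $T$ is replaced by $S$, then $D=T\setminus(U_+\cup U_-\cup V_+\cup V_-)$, and $D$ contains at least one vertex.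
   Formalization: For arbitrary choices in step (2), termination is claimed only if C is in G or Cz' lies in a translate gD with g in G (if Cz'=p the loop runs forever); for all C in H, termination is claimed for some choice of p, q, z', after subdividing T. Outputs are correct whenever the loop stops. *)

(* Defs.v *)
From HB Require Import structures.
From Stdlib Require Import Relation_Operators.
From mathcomp Require Import all_boot all_order all_algebra.
From mathcomp Require Import all_classical all_reals.
From mathcomp Require Import topology normedtype.
Set Implicit Arguments.
Unset Strict Implicit.
Unset Printing Implicit Defensive.
Import Order.TTheory GRing.Theory Num.Theory.
Import numFieldNormedType.Exports.
Local Open Scope classical_set_scope.

Definition reaches (S : Type) (step : S -> S -> Prop) : S -> S -> Prop :=
  clos_refl_trans S step.

(* Every run from s is finite: steps may be nondeterministic. *)
Definition terminates (S : Type) (step : S -> S -> Prop) (s : S) : Prop :=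
  Acc (fun t u => step u t) s.

Definition final (S : Type) (step : S -> S -> Prop) (s : S) : Prop :=
  forall t, ~ step s t.

(* The letter (i, e) is a (i = false) or b (i = true), inverted iff e = true. *)
Definition letter : Type := (bool * bool)%type.
Definition letterV (l : letter) : letter := (l.1, ~~ l.2).

Definition cancel_free (s : seq letter) : bool :=
  sorted (fun l l' : letter => l' != letterV l) s.

Definition push (l : letter) (s : seq letter) : seq letter :=
  if s is l' :: s' then if l' == letterV l then s' else l :: s else [:: l].
Definition reduce (s : seq letter) : seq letter := foldr push [::] s.

Lemma letterVK : involutive letterV.
Proof. by case=> i e; rewrite /letterV /= negbK. Qed.

Lemma push_free l s : cancel_free s -> cancel_free (push l s).
Proof.
case: s => [|l' s] //= fs; case: eqP => [_|/eqP ne]; first exact: path_sorted fs.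
by rewrite /cancel_free /= ne.
Qed.

Lemma foldr_push_free s t : cancel_free t -> cancel_free (foldr push t s).
Proof. by move=> ft; elim: s => //= l s; apply: push_free. Qed.

Lemma reduce_free s : cancel_free (reduce s).
Proof. exact: foldr_push_free. Qed.

Lemma reduce_id s : cancel_free s -> reduce s = s.
Proof.
elim: s => //= l s IHs fs; rewrite /reduce /= -/(reduce s).
rewrite IHs; last exact: path_sorted fs.
case: s fs {IHs} => //= l' s; rewrite /cancel_free /= => /andP[ne _].
by rewrite (negbTE ne).
Qed.

Lemma pushK l s : cancel_free s -> push l (push (letterV l) s) = s.
Proof.
case: s => [|l' s] /=; first by rewrite eqxx.
move=> fs; rewrite letterVK.
case: eqP => [e|ne] /=; last by rewrite eqxx.
subst l'; case: s fs => [|l'' s] //=.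
by rewrite /cancel_free /= => /andP[ne _]; rewrite (negbTE ne).
Qed.

Lemma foldr_push_reduce s t : cancel_free t ->
  foldr push t (reduce s) = foldr push t s.
Proof.
move=> ft; elim: s => //= l s IHs; rewrite -IHs /reduce /= -/(reduce s).
case: (reduce s) => [|l' r] //=; case: eqP => // ->.
by rewrite pushK // foldr_push_free.
Qed.

Lemma reduce_cat s t : reduce (s ++ t) = foldr push (reduce t) s.
Proof. by rewrite /reduce foldr_cat. Qed.

Record free2 : Type := Free2 {
  free2_word : seq letter;
  _ : cancel_free free2_word
}.
HB.instance Definition _ := [isSub for free2_word].
HB.instance Definition _ := [Choice of free2 by <:].

Definition free2_of (s : seq letter) : free2 := Free2 (reduce_free s).
Definition free2_one : free2 := free2_of [::].
Definition free2_mul (u v : free2) : free2 :=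
  free2_of (free2_word u ++ free2_word v).
Definition free2_inv (u : free2) : free2 :=
  free2_of (rev (map letterV (free2_word u))).

Lemma free2_mulA : associative free2_mul.
Proof.
move=> [u fu] [v fv] [w fw]; apply: val_inj => /=.
rewrite [LHS]reduce_cat (reduce_id (reduce_free _)) [RHS]reduce_cat.
by rewrite foldr_push_reduce ?reduce_free // reduce_cat foldr_cat.
Qed.

Lemma free2_mul1g : left_id free2_one free2_mul.
Proof. by move=> [u fu]; apply: val_inj => /=; rewrite reduce_id. Qed.

Lemma free2_mulg1 : right_id free2_one free2_mul.
Proof. by move=> [u fu]; apply: val_inj => /=; rewrite cats0 reduce_id. Qed.

Lemma free2_mulgV : right_inverse free2_one free2_inv free2_mul.
Proof.
move=> [u fu]; apply: val_inj => /=; rewrite reduce_cat reduce_id ?reduce_free //.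
elim/last_ind: u {fu} => // s l IHs.
rewrite map_rcons rev_rcons foldr_rcons /reduce /= -/(reduce _).
by rewrite pushK ?reduce_free.
Qed.

Lemma free2_mulVg : left_inverse free2_one free2_inv free2_mul.
Proof.
move=> u; rewrite -[LHS]free2_mulg1 -[in LHS](free2_mulgV (free2_inv u)).
rewrite free2_mulA -(free2_mulA _ u) free2_mulgV free2_mulg1.
exact: free2_mulgV.
Qed.

HB.instance Definition _ := isGroup.Build free2
  free2_mulA free2_mul1g free2_mulg1 free2_mulVg free2_mulgV.

Definition free2_a : free2 := free2_of [:: (false, false)].
Definition free2_b : free2 := free2_of [:: (true, false)].

(* w(x, y): the image of w under the homomorphism a |-> x, b |-> y. *)
Definition word_eval (H : groupType) (x y : H) (w : free2) : H :=
  (\prod_(l <- free2_word w)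
     let g := if l.1 then y else x in if l.2 then g^-1 else g)%g.

Definition is_subgroup (H : groupType) (S : set H) : Prop :=
  S 1%g /\ forall x y, S x -> S y -> S (x * y^-1)%g.

Definition gen2 (H : groupType) (x y : H) : set H :=
  [set g | forall S, is_subgroup S -> S x -> S y -> S g].

Definition free_of_rank2 (H : groupType) (G : set H) : Prop :=
  exists x y, injective (word_eval x y) /\ G = range (word_eval x y).

(* The subspace topology on G is discrete; op is the family of open sets. *)
Definition is_discrete (H : groupType) (op : set (set H)) (G : set H) : Prop :=
  forall g, G g -> exists U, op U /\ U `&` G = [set g].

Record graph := Graph { gvert :> Type; gadj : gvert -> gvert -> Prop }.

Fixpoint walk (V : Type) (e : V -> V -> Prop) (n : nat) (x y : V) : Prop :=
  if n is n'.+1 then exists2 z, e x z & walk e n' z y else x = y.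

(* The minimum of a nonempty set of natural numbers. *)
Definition least (P : set nat) : nat :=
  xget 0 [set n | P n /\ forall m, P m -> n <= m].

Definition dist (T : graph) (x y : T) : nat :=
  least [set n | walk (@gadj T) n x y].

Record is_tree (T : graph) : Prop := IsTree {
  tree_sym : forall x y : T, gadj x y -> gadj y x;
  tree_irr : forall x : T, ~ gadj x x;
  tree_conn : forall x y : T, exists n, walk (@gadj T) n x y;
  tree_acyclic : ~ exists n (c : nat -> T), [/\ 2 < n, c n = c 0,
    (forall i, i < n -> gadj (c i) (c i.+1)) &
    (forall i j, i < n -> j < n -> c i = c j -> i = j)]
}.

Record lf_tree := LFTree {
  lft :> graph;
  lft_tree : is_tree lft;
  lft_fin : forall x : lft, finite_set [set y | gadj x y]
}.

(* The vertices of the path from x to y in a tree. *)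
Definition geod (T : graph) (x y : T) : set T :=
  [set z | dist x z + dist z y = dist x y].

Definition is_subtree (T : graph) (A : set T) : Prop :=
  A !=set0 /\ forall x y, A x -> A y ->
    exists n, walk (fun u v => [/\ A u, A v & gadj u v]) n x y.

Record gtree (H : groupType) := GTree {
  gt :> graph;
  act : H -> gt -> gt;
  act_one : forall x, act 1%g x = x;
  act_mul : forall g h x, act (g * h)%g x = act g (act h x);
  act_adj : forall g x y, gadj x y -> gadj (act g x) (act g y)
}.

Section Subdivision.
Variables (H : groupType) (T : gtree H).

(* The barycentric subdivision: its vertices are the simplices of T, so x is  *)
(* [set x] and the midpoint of the edge xy is [set x; y].                     *)
Definition simplex (s : set T) : Prop :=
  exists x y, (x = y \/ gadj x y) /\ s = [set x; y].

Definition subdiv_graph : graph :=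
  @Graph {s : set T | simplex s}
    (fun s t => sval s `<` sval t \/ sval t `<` sval s).

Lemma simplex_act g s : simplex s -> simplex (act g @` s).
Proof.
move=> [x [y [xy ->]]]; exists (act g x), (act g y); split.
  by case: xy => [->|/(act_adj g)]; [left|right].
by rewrite image_setU !image_set1.
Qed.

Definition subdiv_act (g : H) (s : subdiv_graph) : subdiv_graph :=
  exist _ (act g @` sval s) (simplex_act g (svalP s)).

Lemma subdiv_act_one s : subdiv_act 1%g s = s.
Proof.
case: s => s hs; apply: eq_exist => /=; rewrite (_ : act 1%g = id) ?image_id //.
by apply/funext => x; rewrite act_one.
Qed.

Lemma subdiv_act_mul g h s :
  subdiv_act (g * h)%g s = subdiv_act g (subdiv_act h s).
Proof.
apply: eq_exist => /=; rewrite image_comp; congr image.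
by apply/funext => x; rewrite act_mul.
Qed.

Lemma act_inj g : injective (@act H T g).
Proof.
by move=> x y e; rewrite -(act_one x) -(act_one y) -(mulVg g) !act_mul e.
Qed.

Lemma subdiv_act_adj g (s t : subdiv_graph) :
  gadj s t -> gadj (subdiv_act g s) (subdiv_act g t).
Proof.
have P (u v : set T) : u `<` v -> act g @` u `<` act g @` v.
  move=> [uv nvu]; split=> [_ [x ux <-]|vu]; first by exists x => //; apply: uv.
  apply: nvu => x vx; have [y uy /act_inj e] : (act g @` u) (act g x).
    by apply: vu; exists x.
  by rewrite -e.
by case=> /P; [left|right].
Qed.

Definition subdiv : gtree H :=
  GTree subdiv_act_one subdiv_act_mul subdiv_act_adj.

End Subdivision.

Record isom (T : lf_tree) := Isom {
  ifun :> T -> T;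
  iinv : T -> T;
  ifunK : cancel ifun iinv;
  iinvK : cancel iinv ifun;
  idist : forall x y, dist (ifun x) (ifun y) = dist x y
}.

Section IsomGroup.
Variable T : lf_tree.
Implicit Types f g : isom T.

Lemma isom_eq f g : ifun f =1 ifun g -> f = g.
Proof.
move=> /funext e.
have e' : iinv f = iinv g.
  by apply/funext => x; apply: (can_inj (ifunK f)); rewrite iinvK e iinvK.
case: f g e e' => [f f' a b c] [g g' a' b' c'] /= e e'; subst g g'.
by congr Isom; apply: Prop_irrelevance.
Qed.

HB.instance Definition _ := gen_eqMixin (isom T).
HB.instance Definition _ := gen_choiceMixin (isom T).

Definition isom_one : isom T :=
  @Isom T id id (fun=> erefl) (fun=> erefl) (fun _ _ => erefl).

Definition isom_mul f g : isom T.
Proof.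
apply: (@Isom T (f \o g) (iinv g \o iinv f)).
- by move=> x /=; rewrite !ifunK.
- by move=> x /=; rewrite !iinvK.
- by move=> x y /=; rewrite !idist.
Defined.

Definition isom_inv f : isom T.
Proof.
apply: (@Isom T (iinv f) f (@iinvK T f) (@ifunK T f)).
by move=> x y; rewrite -(idist f) !iinvK.
Defined.

Lemma isom_mulA : associative isom_mul.
Proof. by move=> f g h; apply: isom_eq. Qed.
Lemma isom_mul1g : left_id isom_one isom_mul.
Proof. by move=> f; apply: isom_eq. Qed.
Lemma isom_mulg1 : right_id isom_one isom_mul.
Proof. by move=> f; apply: isom_eq. Qed.
Lemma isom_mulVg : left_inverse isom_one isom_inv isom_mul.
Proof. by move=> f; apply: isom_eq => x /=; rewrite ifunK. Qed.
Lemma isom_mulgV : right_inverse isom_one isom_inv isom_mul.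
Proof. by move=> f; apply: isom_eq => x /=; rewrite iinvK. Qed.

HB.instance Definition _ := isGroup.Build (isom T)
  isom_mulA isom_mul1g isom_mulg1 isom_mulVg isom_mulgV.

Lemma least_eq (P : set nat) n : P n -> (forall m, P m -> n <= m) -> least P = n.
Proof.
move=> Pn n_min; rewrite /least; case: xgetP => [k _ [Pk k_min]|/(_ n) []//].
by apply/eqP; rewrite eqn_leq k_min // n_min.
Qed.

Lemma leastP (P : set nat) n : P n -> P (least P).
Proof.
move=> Pn; rewrite /least; case: xgetP => [k _ []//|nP].
have exP : exists m, `[< P m >] by exists n; apply/asboolP.
case: (ex_minnP exP) => m /asboolP Pm m_min; case: (nP m); split=> // k Pk.
by apply: m_min; apply/asboolP.
Qed.

Lemma dist1P (x y : T) : gadj x y <-> dist x y = 1.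
Proof.
split=> [xy|d1].
  apply: least_eq => [|[|m] //]; first by exists y.
  by move=> /= e; case: (@tree_irr _ (lft_tree T) x); rewrite {2}e.
have [n xy] := tree_conn (lft_tree T) x y.
have : walk (@gadj T) (dist x y) x y := @leastP [set m | walk _ m x y] n xy.
by rewrite d1 => -[z xz <-].
Qed.

Lemma isom_adj (f : isom T) (x y : T) : gadj x y -> gadj (f x) (f y).
Proof. by move=> /dist1P d1; apply/dist1P; rewrite idist. Qed.

Definition isom_gtree : gtree (isom T) :=
  @GTree (isom T) T (fun f x => f x) (fun=> erefl) (fun _ _ _ => erefl) isom_adj.

(* The topology of pointwise convergence (the vertex set being discrete). *)
Definition isom_open : set (set (isom T)) :=
  [set U | forall f, U f -> exists2 s : set T, finite_set s &
    forall h : isom T, (forall x, s x -> h x = f x) -> U h].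

End IsomGroup.

Definition without_inversions (H : groupType) (T : gtree H) : Prop :=
  forall g (x y : T), gadj x y -> ~ (act g x = y /\ act g y = x).

Local Open Scope ring_scope.

(* v x >= n, with v 0 = +oo (so the value of v at 0 is irrelevant). *)
Definition vge (K : fieldType) (v : K -> int) (n : int) (x : K) : Prop :=
  x = 0 \/ n <= v x.

(* v is a normalised discrete valuation, K is complete and the residue field  *)
(* is finite: s contains a representative of each residue class.              *)
Record is_local_field (K : fieldType) (v : K -> int) : Prop := IsLocalField {
  lf_mul : forall x y, x != 0 -> y != 0 -> v (x * y) = v x + v y;
  lf_add : forall x y, x != 0 -> y != 0 -> x + y != 0 ->
    Num.min (v x) (v y) <= v (x + y);
  lf_unif : exists2 p, p != 0 & v p = 1;
  lf_complete : forall u : nat -> K,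
    (forall N : int, exists M : nat, forall m n : nat, (M <= m)%N -> (M <= n)%N ->
       vge v N (u m - u n)) ->
    exists l, forall N : int, exists M : nat, forall n : nat, (M <= n)%N ->
       vge v N (u n - l);
  lf_residue : exists s : seq K, forall x, vge v 0 x ->
    exists y, [/\ y \in s, vge v 0 y & vge v 1 (x - y)]
}.

Record SL2 (K : fieldType) : Type := MkSL2 {
  sl2_mx :> 'M[K]_2;
  _ : \det sl2_mx == 1
}.

Section SL2.
Variable K : fieldType.
HB.instance Definition _ := [isSub for @sl2_mx K].
HB.instance Definition _ := [Choice of SL2 K by <:].

Lemma sl2_det (g : SL2 K) : \det (sl2_mx g) = 1.
Proof. by case: g => g /= /eqP. Qed.

Lemma sl2_unit (g : SL2 K) : sl2_mx g \in unitmx.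
Proof. by rewrite unitmxE sl2_det unitr1. Qed.

Lemma sl2_one_subproof : \det (1%:M : 'M[K]_2) == 1.
Proof. by rewrite det1. Qed.
Lemma sl2_mul_subproof (g h : SL2 K) : \det (sl2_mx g *m sl2_mx h) == 1.
Proof. by rewrite det_mulmx !sl2_det mulr1. Qed.
Lemma sl2_inv_subproof (g : SL2 K) : \det (invmx (sl2_mx g)) == 1.
Proof. by rewrite det_inv sl2_det invr1. Qed.

Definition sl2_one : SL2 K := MkSL2 sl2_one_subproof.
Definition sl2_mul (g h : SL2 K) : SL2 K := MkSL2 (sl2_mul_subproof g h).
Definition sl2_inv (g : SL2 K) : SL2 K := MkSL2 (sl2_inv_subproof g).

Lemma sl2_mulA : associative sl2_mul.
Proof. by move=> f g h; apply: val_inj; rewrite /= mulmxA. Qed.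
Lemma sl2_mul1g : left_id sl2_one sl2_mul.
Proof. by move=> f; apply: val_inj; rewrite /= mul1mx. Qed.
Lemma sl2_mulg1 : right_id sl2_one sl2_mul.
Proof. by move=> f; apply: val_inj; rewrite /= mulmx1. Qed.
Lemma sl2_mulVg : left_inverse sl2_one sl2_inv sl2_mul.
Proof. by move=> f; apply: val_inj; rewrite /= mulVmx // sl2_unit. Qed.
Lemma sl2_mulgV : right_inverse sl2_one sl2_inv sl2_mul.
Proof. by move=> f; apply: val_inj; rewrite /= mulmxV // sl2_unit. Qed.

HB.instance Definition _ := isGroup.Build (SL2 K)
  sl2_mulA sl2_mul1g sl2_mulg1 sl2_mulVg sl2_mulgV.

Variable v : K -> int.

Definition sl2_open : set (set (SL2 K)) :=
  [set U | forall g, U g -> exists N : int, forall h : SL2 K,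
    (forall i j, vge v N (sl2_mx h i j - sl2_mx g i j)) -> U h].

(* The O-span of the columns of an invertible matrix. *)
Definition is_lattice (L : set 'cV[K]_2) : Prop :=
  exists2 M : 'M[K]_2, M \in unitmx &
    L = [set M *m x | x in [set x : 'cV[K]_2 | forall i, vge v 0 (x i ord0)]].

Definition homothety_class (L : set 'cV[K]_2) : set (set 'cV[K]_2) :=
  [set L' | exists2 c : K, c != 0 & L' = [set c *: x | x in L]].

Definition bt_vertex : Type :=
  {C : set (set 'cV[K]_2) | exists2 L, is_lattice L & C = homothety_class L}.

(* L0 is contained in L and O/(pi) ~ L/L0: the quotient is generated by the   *)
(* class of e, whose annihilator is (pi), the set of elements of valuation    *)
(* at least 1.                                                                *)
Definition lattice_step (L0 L : set 'cV[K]_2) : Prop :=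
  L0 `<=` L /\ exists e, [/\ L e,
    (forall x, L x -> exists a y, [/\ vge v 0 a, L0 y & x = a *: e + y]) &
    (forall a, vge v 0 a -> (L0 (a *: e) <-> vge v 1 a))].

Definition bt_adj (x y : bt_vertex) : Prop :=
  exists L0 L, lattice_step L0 L /\
    ((sval x L0 /\ sval y L) \/ (sval x L /\ sval y L0)).

Definition bt_graph : graph := Graph bt_adj.

Definition mx_image (g : 'M[K]_2) (L : set 'cV[K]_2) : set 'cV[K]_2 :=
  [set g *m x | x in L].

Lemma bt_act_subproof (g : SL2 K) (x : bt_vertex) :
  exists2 L, is_lattice L & mx_image g @` sval x = homothety_class L.
Proof.
case: x => C /= [L [M uM LM] ->]; exists (mx_image g L).
  exists (g *m M); first by rewrite unitmx_mul sl2_unit.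
  by rewrite LM /mx_image image_comp; apply: eq_imagel => x _ /=; rewrite mulmxA.
have E c : mx_image g [set c *: x | x in L] = [set c *: x | x in mx_image g L].
  rewrite /mx_image !image_comp; apply: eq_imagel => x _ /=.
  by rewrite -scalemxAr.
apply/seteqP; split=> [_ [_ [c c0 ->] <-]|_ [c c0 ->]]; first by exists c.
by exists [set c *: x | x in L]; [exists c|].
Qed.

Definition bt_act (g : SL2 K) (x : bt_graph) : bt_graph :=
  exist _ (mx_image g @` sval x) (bt_act_subproof g x).

Lemma bt_act_one x : bt_act 1%g x = x.
Proof.
case: x => C hC; apply: eq_exist => /=; rewrite (_ : mx_image _ = id) ?image_id //.
apply/funext => L; rewrite /mx_image -[RHS]image_id.
by apply: eq_imagel => x _ /=; rewrite mul1mx.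
Qed.

Lemma bt_act_mul g h x : bt_act (g * h)%g x = bt_act g (bt_act h x).
Proof.
apply: eq_exist => /=; rewrite image_comp; apply: eq_imagel => L _ /=.
by rewrite /mx_image image_comp; apply: eq_imagel => y _ /=; rewrite mulmxA.
Qed.

Lemma bt_act_adj g x y : bt_adj x y -> bt_adj (bt_act g x) (bt_act g y).
Proof.
move=> [L0 [L [[sL [e [Le gen ann]]] xy]]].
exists (mx_image g L0), (mx_image g L); split; last first.
  by case: xy => -[? ?]; [left|right]; split=> /=; [exists L0|exists L|exists L|exists L0].
split; first by move=> _ [z L0z <-]; exists z => //; apply: sL.
exists (sl2_mx g *m e); split; first by exists e.
  move=> _ [z /gen [a [w [a0 L0w ->]]] <-].
  exists a, (sl2_mx g *m w); split=> //; first by exists w.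
  by rewrite mulmxDr -scalemxAr.
move=> a /ann <-; split=> [[z L0z]|La].
  rewrite scalemxAr => /(can_inj (mulKmx (sl2_unit g))) <-; exact: L0z.
by exists (a *: e) => //; rewrite -scalemxAr.
Qed.

Definition bt_gtree : gtree (SL2 K) :=
  GTree bt_act_one bt_act_mul bt_act_adj.

End SL2.

(* In the last case T has been subdivided at the midpoints of its edges, so   *)
(* that Isom(T) acts without inversions.                                      *)
Inductive ambient : forall H : groupType, set (set H) -> gtree H -> Prop :=
| ambient_SL2 (K : fieldType) (v : K -> int) :
    is_local_field v -> ambient (sl2_open v) (bt_gtree v)
| ambient_Isom (T : lf_tree) :
    without_inversions (isom_gtree T) ->
    ambient (@isom_open T) (isom_gtree T)
| ambient_Isom_subdiv (T : lf_tree) :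
    ambient (@isom_open T) (subdiv (isom_gtree T)).

Local Close Scope ring_scope.
Local Open Scope nat_scope.

Section Translation.
Variables (H : groupType) (T : gtree H).

Definition tlen (g : H) : nat :=
  least [set n | exists x : T, n = dist x (act g x)].

Definition hyperbolic (g : H) : Prop := 0 < tlen g.

Definition axis (g : H) : set T := [set x | dist x (act g x) = tlen g].

End Translation.

Arguments axis {H} T g.

(* The pair (X, Y) is stored as a pair of words in A and B. *)
Inductive red_state :=
| RedStart of free2 & free2
| RedLoop of free2 & free2
| RedReturn of option (free2 * free2).

Section Reduction.
Variables (H : groupType) (T : gtree H) (A B : H).
Let l (w : free2) : nat := tlen T (word_eval A B w).

Inductive red_step : red_state -> red_state -> Prop :=
| red_a_false x y : l x = 0 \/ l y = 0 ->
    red_step (RedStart x y) (RedReturn None)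
| red_a x y : l x <> 0 -> l y <> 0 -> red_step (RedStart x y) (RedLoop x y)
| red_loop x0 y0 x y m t :
    (x, y) = (if l y0 < l x0 then (y0, x0) else (x0, y0)) ->
    m = minn (l (x * y)%g) (l (x^-1 * y)%g) ->
    red_body x y m t -> red_step (RedLoop x0 y0) t
with red_body : free2 -> free2 -> nat -> red_state -> Prop :=
| red_d x y m : m = 0 -> red_body x y m (RedReturn None)
| red_e x y m z : m <> 0 -> m <= l y - l x ->
    (z = (x * y)%g \/ z = (x^-1 * y)%g) -> l z = m ->
    red_body x y m (RedLoop x z)
| red_f x y m : m <> 0 -> ~ (m <= l y - l x) ->
    red_body x y m (RedReturn (Some (x, y))).

End Reduction.

Definition reduced_pair (H : groupType) (T : gtree H) (X Y : H) : Prop :=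
  hyperbolic T X /\ hyperbolic T Y /\
  (axis T X `&` axis T Y = set0 \/
   exists u v : T, axis T X `&` axis T Y = geod u v /\
     dist u v < minn (tlen T X) (tlen T Y)).

Local Close Scope nat_scope.
Local Open Scope ring_scope.

Section Realisation.
Variables (R : realType) (H : groupType) (T : gtree H).

(* Points of |T| are given by barycentric coordinates. On |T| the topology of *)
(* pointwise convergence of these coordinates is that of the path metric.     *)
Notation pts := {ptws T -> R}.

Definition vpt (x : T) : pts := fun y => `[< x = y >]%:R.

Definition realise (A : set T) : set pts :=
  [set f | exists x y (t : R), [/\ A x, A y, x = y \/ gadj x y, 0 <= t <= 1 &
    f = fun z => (1 - t) * vpt x z + t * vpt y z]].

Definition pact (g : H) (f : pts) : pts := fun x => f (act g^-1%g x).

Definition is_fundamental_domain (G : set H) (S D : set pts) : Prop :=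
  [/\ (exists2 O, open O & D = O `&` S),
      \bigcup_(g in G) (pact g @` (closure D `&` S)) = S &
      forall g h, G g -> G h -> g <> h ->
        (pact g @` D) `&` (pact h @` D) = set0].

Definition open_path (x y : T) : set pts :=
  realise (geod x y) `\` [set vpt x; vpt y].

Definition in_open_path (x y z : T) : Prop := [/\ geod x y z, z <> x & z <> y].

(* p' and q' are the endpoints of the shortest path between the axes. *)
Definition is_bridge (X Y : H) (p' q' : T) : Prop :=
  [/\ axis T X p', axis T Y q' &
     forall x y, axis T X x -> axis T Y y -> (dist p' q' <= dist x y)%N].

Definition good_basepoints (X Y : H) (p q : T) : Prop :=
  [/\ axis T X p, axis T Y q,
      (axis T X `&` axis T Y = set0 -> forall p' q', is_bridge X Y p' q' ->
         in_open_path p (act X p) p' /\ in_open_path q (act Y q) q') &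
      (forall x : T, axis T X x -> axis T Y x ->
         in_open_path p (act X p) x /\ in_open_path q (act Y q) x)].

(* The vertices from r onwards, in the direction of translation of g. *)
Definition ray (g : H) (r : T) : set T :=
  [set x | exists n, geod r (iter n (act g) r) x].

(* A is the maximal subtree of S containing all vertices of the axis of g     *)
(* from r onwards, but no other vertices of that axis.                        *)
Definition is_half_tree (S : set T) (g : H) (r : T) (A : set T) : Prop :=
  let P B := [/\ B `<=` S, is_subtree B & B `&` axis T g = ray g r] in
  P A /\ forall B, P B -> A `<=` B -> B = A.

Record domain_data := DomainData {
  dp : T; dq : T;
  dS : set T;
  dUp : set T; dUm : set T; dVp : set T; dVm : set T
}.

Definition domain (d : domain_data) : set pts :=
  realise (dS d) `\`
    (realise (dUp d) `|` realise (dUm d) `|` realise (dVp d) `|` realise (dVm d)).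

(* D_X, D_Y, and the path joining the axes if they are disjoint. *)
Definition path_domain (X Y : H) (p q : T) : set pts :=
  open_path p (act X p) `|` open_path q (act Y q) `|`
  [set f | axis T X `&` axis T Y = set0 /\
     exists p' q', is_bridge X Y p' q' /\ realise (geod p' q') f].

(* The subtree dS replacing T is T itself, provided that this gives a         *)
(* fundamental domain, or the union of the translates of the closure of       *)
(* path_domain.                                                               *)
Definition valid_domain (G : set H) (X Y : H) (d : domain_data) : Prop :=
  [/\ good_basepoints X Y (dp d) (dq d),
      is_half_tree (dS d) X (act X (dp d)) (dUp d) /\
        is_half_tree (dS d) X^-1%g (dp d) (dUm d),
      is_half_tree (dS d) Y (act Y (dq d)) (dVp d) /\
        is_half_tree (dS d) Y^-1%g (dq d) (dVm d) &
      (dS d = setT /\ is_fundamental_domain G (realise setT) (domain d)) \/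
      (is_subtree (dS d) /\
       realise (dS d) = \bigcup_(g in G)
         (pact g @` (closure (path_domain X Y (dp d) (dq d)) `&` realise setT)))].

Definition in_domain (d : domain_data) (z : T) : Prop := domain d (vpt z).

(* The body of the while loop. If z lies in none of D, U_+, U_-, V_+,   *)
(* V_- (which is possible when T was replaced by a subtree) the body does     *)
(* nothing, so that the loop runs forever.                                    *)
Inductive loop_step (X Y : H) (d : domain_data) :
    free2 * T -> free2 * T -> Prop :=
| loop_Up w z : ~ in_domain d z -> dUp d z ->
    loop_step X Y d (w, z) ((w * free2_a)%g, act X^-1%g z)
| loop_Um w z : ~ in_domain d z -> dUm d z ->
    loop_step X Y d (w, z) ((w * free2_a^-1)%g, act X z)
| loop_Vp w z : ~ in_domain d z -> dVp d z ->
    loop_step X Y d (w, z) ((w * free2_b)%g, act Y^-1%g z)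
| loop_Vm w z : ~ in_domain d z -> dVm d z ->
    loop_step X Y d (w, z) ((w * free2_b^-1)%g, act Y z)
| loop_idle w z : ~ in_domain d z -> ~ dUp d z -> ~ dUm d z ->
    ~ dVp d z -> ~ dVm d z -> loop_step X Y d (w, z) (w, z).

(* None stands for false, Some u for true and the word u. *)
Definition answer (A B : H) (wX wY : free2) (C : H) (z' : T) (s : free2 * T) :
    option free2 :=
  if `[< word_eval (word_eval A B wX) (word_eval A B wY) s.1 = C /\ s.2 = z' >]
  then Some (word_eval wX wY s.1) else None.

Definition correct_answer (A B C : H) (o : option free2) : Prop :=
  (gen2 A B C -> exists2 u, o = Some u & word_eval A B u = C) /\
  (~ gen2 A B C -> o = None).

End Realisation.

Arguments domain R {H T} d.

(* Main.v *)
(* All that is used of the ambient group is that G acts freely on the vertices of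
   the tree T.  For this, discreteness enters once: an element g of G fixing a
   vertex has powers g^n, n > 0, in any neighbourhood of 1 (by the pigeonhole
   principle, applied to orbits in finite balls or to matrices over the valuation
   ring modulo a power of the uniformiser), so g^n = 1 for some n > 0, and g = 1
   because free groups are torsion-free.  Hence every nontrivial element of G is
   hyperbolic, and all tree geometry reduces to the four-point inequality
     d(x,y) + d(z,w) <= max(d(x,z) + d(y,w), d(x,w) + d(y,z)).
   Each replacement in the reduction procedure decreases l(X) + l(Y), and an
   overlap of the axes of length at least min(l(X), l(Y)) would make X Y or
   X^-1 Y short enough for another replacement.  The four half trees behind the
   points p, Xp, q, Yq are disjoint and X maps the complement of the one behind p
   into the one behind Xp, so that by ping-pong a nonempty reduced word in X, Y
   moves D into the half tree of its first letter: the translates of D are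
   disjoint, and the loop strips letters off the word g for which z lies in g D.
   In the subdivided tree, p and q can be taken to be midpoints of edges; nothing
   but the axis branches off there, so the translates of the closure of D cover
   the tree, and a vertex of the original tree never lands on the boundary of a
   translate, whence the loop always terminates. *)
Require Import Defs.
From mathcomp Require Import all_boot all_order all_algebra.
From mathcomp Require Import all_classical all_reals.
From mathcomp Require Import topology normedtype.
From mathcomp Require Import zify ring.
Set Implicit Arguments.
Unset Strict Implicit.
Unset Printing Implicit Defensive.
Import Order.TTheory GRing.Theory Num.Theory.
Import numFieldNormedType.Exports.
Local Open Scope classical_set_scope.

(** * Trees as metric spaces *)

(** The obstacle is the boundary of D. A vertex that lands on p lies in [U_-], is sent to Xp in
    [U_+], then back to p, and so on forever; a vertex outside the subtree that replaces T is stuck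
    as well. Termination for all C therefore needs a choice in step (2) for which parity keeps the
    visited vertices away from the boundary. The reduction itself runs in T, and its conclusion
    carries over to the subdivision because all translation lengths in G double. Acyclicity is
    consumed at a single place, to show that no path rises from and returns to the same distance
    from a root. Conversely, a graph is recognised as a tree by a height function with unique
    descent; this serves for the subdivision and for the Bruhat-Tits graph, where the height is the
    exponent of an elementary divisor. Points of the realisation are handled through their supports:
    a point of the ambient subtree is in D when its support lies in no half tree, which turns
    topology into statements about vertices and edges. *)

Section GraphMetric.
Variable T : graph.
Hypothesis symT : forall x y : T, gadj x y -> gadj y x.
Hypothesis connT : forall x y : T, exists n, walk (@gadj T) n x y.
Implicit Types x y z : T.
Local Notation d := (@dist T).
Local Notation wk := (walk (@gadj T)).

Lemma walk_cat m n x y z : wk m x y -> wk n y z -> wk (m + n) x z.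
Proof.
elim: m x => [|m IH] x /=; first by move=> ->.
by move=> [u xu uy] yz; exists u => //; apply: IH.
Qed.

Lemma walk_sym n x y : wk n x y -> wk n y x.
Proof.
elim: n x => [|n IH] x /=; first by move=> ->.
move=> [u xu /IH yu]; suff: wk (n + 1) y x by rewrite addn1.
apply: walk_cat yu _.
by exists x => //; apply: symT.
Qed.

Lemma dist_walk x y : wk (d x y) x y.
Proof. by have [n xy] := connT x y; exact: (@leastP [set m | wk m x y] n xy). Qed.

Lemma dist_le_walk n x y : wk n x y -> d x y <= n.
Proof.
move=> xy; rewrite /dist /least; case: xgetP => [k _ [_ min]|]; first exact: min.
move=> _; exact: leq0n.
Qed.

Lemma distxx x : d x x = 0.
Proof. by apply/eqP; rewrite -leqn0; apply: (@dist_le_walk 0). Qed.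

Lemma dist0_eq x y : d x y = 0 -> x = y.
Proof. by move=> e; have := dist_walk x y; rewrite e. Qed.

Lemma dist_sym x y : d x y = d y x.
Proof.
by apply/eqP; rewrite eqn_leq !dist_le_walk //; apply/walk_sym/dist_walk.
Qed.

Lemma dist_triangle y x z : d x z <= d x y + d y z.
Proof. by apply/dist_le_walk/(walk_cat (y := y)); apply: dist_walk. Qed.

Lemma dist_interp n x y : n <= d x y ->
  exists z, d x z = n /\ d z y = d x y - n.
Proof.
move=> le.
have W : forall m k u v, wk (m + k) u v -> exists2 t, wk m u t & wk k t v.
  elim=> [|m IH] k u v /=; first by exists u.
  by move=> [s us /IH [t st tv]]; exists t => //; exists s.
have := dist_walk x y; rewrite -{1}(subnKC le) => /W [z xz zy]; exists z.
move: (dist_le_walk xz) (dist_le_walk zy) (dist_triangle z x y); lia.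
Qed.

Lemma dist_step n x y : d x y = n.+1 -> exists2 z, gadj x z & d z y = n.
Proof.
move=> e; have := dist_walk x y; rewrite e /= => -[z xz zy]; exists z => //.
have le : d z y <= n := dist_le_walk zy.
have : d x z <= 1 by apply: dist_le_walk; exists z.
move: (dist_triangle z x y); lia.
Qed.

Lemma geod_sym x y z : geod x y z -> geod y x z.
Proof. by rewrite /geod /= (dist_sym x y) (dist_sym x z) (dist_sym z y) addnC. Qed.

Lemma geod_left x y : geod x y x.
Proof. by rewrite /geod /= distxx. Qed.

Lemma geod_right x y : geod x y y.
Proof. by rewrite /geod /= distxx addn0. Qed.

End GraphMetric.

Section Tree.
Variable T : graph.
Hypothesis treeT : is_tree T.
Implicit Types r u v w x y z : T.
Local Notation d := (@dist T).

Let symT := tree_sym treeT.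
Let connT := tree_conn treeT.

Lemma dist_adj x y : gadj x y <-> d x y = 1.
Proof.
split=> [xy|/(dist_step connT) [z xz /(dist0_eq connT) <-] //].
have : d x y <= 1 by apply: dist_le_walk; exists y.
case E: (d x y) => [|[|n]] // _; move: (dist0_eq connT E) xy => ->.
by move/(tree_irr treeT).
Qed.

Lemma dist_adj_le x y r : gadj x y -> d r x <= d r y + 1.
Proof. by move=> /dist_adj e; have := dist_triangle connT y r x; rewrite (dist_sym symT connT y x) e. Qed.

(* A closed path all of whose interior vertices lie farther from r than its   *)
(* ends descends along the geodesics from both ends to r; where these merge,  *)
(* a simple cycle appears.                                                    *)
Lemma no_arch r n (s : seq T) u v :
  (forall i, i.+1 < size (u :: rcons s v) ->
     gadj (nth u (u :: rcons s v) i) (nth u (u :: rcons s v) i.+1)) ->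
  (forall i j, i < size (u :: rcons s v) -> j < size (u :: rcons s v) ->
     nth u (u :: rcons s v) i = nth u (u :: rcons s v) j -> i = j) ->
  (forall i, i < size s -> n < d r (nth u s i)) ->
  d r u = n -> d r v = n -> False.
Proof.
elim: n s u v => [|n IH] s u v adj inj int du dv.
  have := inj 0 (size s).+1; rewrite /= nth_rcons ltnn eqxx size_rcons.
  by rewrite -(dist0_eq connT du) -(dist0_eq connT dv) => /(_ isT (ltnSn _) erefl).
have parent w : d r w = n.+1 -> exists2 w', gadj w w' & d r w' = n.
  rewrite (dist_sym symT connT) => /(dist_step connT) [w' ww' e].
  by exists w' => //; rewrite (dist_sym symT connT).
have [u' uu' du'] := parent u du; have [v' vv' dv'] := parent v dv.
set p := u :: rcons s v in adj inj.
have szp : size p = (size s).+2 by rewrite /= size_rcons.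
have lvl i : i < size p -> n < d r (nth u p i).
  rewrite szp; case: i => [|i] /= lt; first by rewrite du.
  rewrite nth_rcons; case: (ltnP i (size s)) => [h|ge]; first by have := int i h; lia.
  by rewrite (_ : i == size s) ?dv //; apply/eqP; lia.
have lastp : nth u p (size s).+1 = v by rewrite /= nth_rcons ltnn eqxx.
have headp : nth u p 0 = u by [].
move: (size s).+1 szp lastp (ltn0Sn (size s)) => k szp lastp k0; clearbody p.
have N := set_nth_default u u'.
have [e|ne] := pselect (u' = v').
  apply: (tree_acyclic treeT).
  (* Past the end of the list [nth] returns its default [u'], so the cycle closes up without [u']
     being appended. *)
  exists (size p).+1, (fun i => nth u' (u' :: p) i); split=> /=.
  - by rewrite szp; lia.
  - by rewrite nth_default // szp.
  - move=> [|i] lt; rewrite /= N ?headp //; [exact: symT|by rewrite szp|].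
    case: (ltnP i.+1 (size p)) => h; first by rewrite N //; apply: adj.
    rewrite [nth _ _ i.+1]nth_default // (_ : i = k) ?lastp ?e //; lia.
  - move=> [|i] [|j] lti ltj //=.
    + by rewrite N // => h; have := lvl j ltj; rewrite -h du' ltnn.
    + by rewrite N // => h; have := lvl i lti; rewrite h du' ltnn.
    + by rewrite !N // => /inj ->.
apply: (IH p u' v') => //.
- move=> [|i]; rewrite /= size_rcons => lt.
    by rewrite nth_rcons szp N ?szp // headp; apply: symT.
  rewrite !nth_rcons N; last by lia.
  case: (ltnP i (size p)) => h'; last by lia.
  case: (ltnP i.+1 (size p)) => h; first by rewrite N //; apply: adj.
  by rewrite (_ : i = k) ?lastp 1?ifT //; [apply/eqP; lia|lia].
- have L i : i < (size p).+1 -> nth u' (rcons p v') i = v' /\ i = size p \/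
     nth u' (rcons p v') i = nth u p i /\ i < size p.
    rewrite nth_rcons => lt; case: (ltnP i (size p)) => h; first by right; rewrite N.
    by left; rewrite ifT; [split=> //; lia|apply/eqP; lia].
  move=> [|i] [|j] //=; rewrite size_rcons.
  + move=> _ lt; case: (L j lt) => -[-> h] // e'.
    by have := lvl j h; rewrite -e' du' ltnn.
  + move=> lt _; case: (L i lt) => -[-> h] // e'; first by case: ne.
    by have := lvl i h; rewrite e' du' ltnn.
  + move=> lti ltj; case: (L i lti) => -[-> hi]; case: (L j ltj) => -[-> hj] e'.
    * by lia.
    * by have := lvl j hj; rewrite -e' dv' ltnn.
    * by have := lvl i hi; rewrite e' dv' ltnn.
    * by rewrite (inj _ _ hi hj e').
- by move=> i lt; rewrite N // lvl.
Qed.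

(** An edge joining two vertices of one level would be an arch with empty interior. *)
Lemma dist_adj_neq r x y : gadj x y -> d r x <> d r y.
Proof.
move=> xy e; apply: (@no_arch r (d r x) [::] x y) => //=.
- by case.
- move=> [|[|i]] [|[|j]] //= _ _ h; subst; first by case: (tree_irr treeT xy).
  by case: (tree_irr treeT xy).
Qed.

(** Two different parents of x would be the ends of an arch whose interior is x alone. *)
Lemma descent_unique r x y z : gadj x y -> gadj x z ->
  d r y < d r x -> d r z < d r x -> y = z.
Proof.
move=> xy xz ly lz; case: (pselect (y = z)) => // ne.
have a := dist_adj_le r xy; have b := dist_adj_le r xz.
exfalso; apply: (@no_arch r (d r y) [:: x] y z) => //=; last by lia.
- by move=> [|[|]] //= _; apply: symT.
- move=> [|[|[|i]]] [|[|[|j]]] //= _ _ h; subst=> //;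
  by move: ly lz; rewrite ltnn.
- by case.
Qed.

Lemma dist_adj_cases r x y : gadj x y -> d r x = (d r y).+1 \/ d r y = (d r x).+1.
Proof.
move=> xy; have := dist_adj_neq (r := r) xy.
have := dist_adj_le r xy; have := dist_adj_le r (symT xy); lia.
Qed.

Lemma dist_parity r x y : odd (d r x + d r y) = odd (d x y).
Proof.
move E: (d x y) => n; elim: n x E => [|n IH] x.
  by move=> /(dist0_eq connT) ->; rewrite addnn odd_double.
move=> /(dist_step connT) [z xz /IH]; case: (dist_adj_cases r xz) => ->.
  by rewrite addSn /= => ->.
by rewrite addSn /= => <-; rewrite negbK.
Qed.

(** The edge between y and y' separates x from z. On the way from y to z each step leads away from
    x, because the only neighbour nearer to x is the vertex just left. *)
Lemma dist_edge_sep x y y' z : gadj y y' -> d x y = (d x y').+1 ->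
  d z y' = (d z y).+1 -> d x z = d x y' + 1 + d z y.
Proof.
move=> yy' exy; move E: (d z y) => n; elim: n y y' yy' exy z E => [|n IH] y y' yy' exy z.
  by move=> /(dist0_eq connT) -> _; lia.
move=> ey; move: (ey); rewrite (dist_sym symT connT) => /(dist_step connT) [z' yz' e] ez.
rewrite (dist_sym symT connT z') in e.
have xz' : d x z' = (d x y).+1.
  case: (dist_adj_cases x yz') => // h.
  have ee : y' = z' by apply: (descent_unique (r := x) yy' yz'); lia.
  by move: ez; rewrite ee; lia.
rewrite (IH z' y (symT yz') xz' z e) //; lia.
Qed.

(** Induction on [d x y], moving y to its neighbour [y'] towards x. A further point either comes
    nearer by one, or lies behind y, and then its distances to the points on the other side of the
    edge are exact sums by [dist_edge_sep]. *)
Lemma four_point x y z w :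
  d x y + d z w <= maxn (d x z + d y w) (d x w + d y z).
Proof.
have S := dist_sym symT connT; have tri := dist_triangle connT.
move E: (d x y) => n; elim: n y E => [|n IH] y E.
  by rewrite -(dist0_eq connT E); have := tri x z w; rewrite (S z x); lia.
move: (E); rewrite S => /(dist_step connT) [y' yy' e]; rewrite S in e.
have exy : d x y = (d x y').+1 by lia.
have K u : d u y = (d u y').+1 \/ d u y' = (d u y).+1 /\ d x u = d x y' + 1 + d u y.
  case: (dist_adj_cases u yy') => h; [by left|right; split=> //].
  exact: dist_edge_sep yy' exy h.
have M u t : d u y = (d u y').+1 -> d t y' = (d t y).+1 -> d u t = d u y' + 1 + d t y.
  exact: dist_edge_sep.
rewrite !(S y); have {IH} := IH y' e; rewrite !(S y').
case: (K z) (K w) => [hz|[hz xz]] [hw|[hw xw]].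
- lia.
- by have := M z w hz hw; move: (tri y' x z); rewrite !(S y') ; lia.
- by have := M w z hw hz; move: (tri y' x w); rewrite !(S y') (S w z); lia.
- by have := tri y z w; rewrite (S y w) ; lia.
Qed.

(** The Gromov product of y and z at x is an integer, since bipartiteness makes the perimeter of a
    triangle even. The point at that distance from x on the way to y is the median, by the
    four-point inequality. *)
Lemma median x y z : exists m, [/\ geod x y m, geod y z m & geod x z m].
Proof.
have S := dist_sym symT connT; have tri := dist_triangle connT.
have par := dist_parity x y z.
pose n := (d x y + d x z - d y z)./2.
have en : n.*2 = d x y + d x z - d y z.
  have := odd_double_half (d x y + d x z - d y z).
  rewrite oddB; last by have := tri x y z; rewrite (S y x); lia.
  by rewrite par addbb.
have [m [xm my]] : exists m, d x m = n /\ d m y = d x y - n.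
  by apply: (dist_interp connT); have := tri y x z; lia.
have := four_point m z x y; have := tri m x z; have := tri m y z; have := tri m x y.
move: (tri y x z) (tri x y z) (tri x z y).
exists m; rewrite /geod /=; move: (S m x) (S y m) (S z x) (S z y) (S y x) (S m z).
split; lia.
Qed.

Lemma geod_convex a b x y z :
  geod a b x -> geod a b y -> geod x y z -> geod a b z.
Proof.
have S := dist_sym symT connT; have tri := dist_triangle connT.
rewrite /geod /= => hx hy hz.
have := four_point x y a z; have := four_point x y z b; have := tri z a b.
have := tri y a x; have := tri x a y; move: (S x a) (S y a) (S y z) (S x y); lia.
Qed.

(** A walk inside A cannot avoid a vertex z of the geodesic: as long as its current vertex is not z,
    z is still on the geodesic from the next vertex to y. *)
Lemma subtree_convex (A : set T) : is_subtree A ->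
  forall x y z, A x -> A y -> geod x y z -> A z.
Proof.
have S := dist_sym symT connT; have tri := dist_triangle connT.
move=> [_ cA] x y z Ax Ay; have [n] := cA x y Ax Ay.
elim: n x Ax => [|n IH] x Ax /=.
  move=> -> ; rewrite /geod /= (distxx y) => h.
  by rewrite -(dist0_eq connT (_ : d y z = 0)) //; lia.
move=> [x1 [_ Ax1 xx1] x1y] hz.
have [ne|ne] := eqVneq (d x z) 0; first by rewrite -(dist0_eq connT ne).
apply: (IH x1) => //; move: hz; rewrite /geod /= => hz.
have := four_point x1 z x y; have := tri z x1 y; have := tri x x1 z.
have /dist_adj e := xx1; rewrite (S x1 x) e.
have := dist_adj_cases y xx1; rewrite !(S y) (S z x); lia.
Qed.

Lemma convex_subtree (A : set T) : A !=set0 ->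
  (forall x y z, A x -> A y -> geod x y z -> A z) -> is_subtree A.
Proof.
have S := dist_sym symT connT; have tri := dist_triangle connT.
move=> A0 cA; split=> // x y Ax Ay; exists (d x y); move E: (d x y) => n.
elim: n x Ax E => [|n IH] x Ax E /=; first exact: (dist0_eq connT).
have [z xz zy] := dist_step connT E.
have Az : A z by apply: (cA x y) => //; rewrite /geod /=; move/dist_adj: xz; lia.
by exists z => //; apply: IH.
Qed.

End Tree.

(** * Recognising trees by a height function *)

Section Rooted.
Variables (T : graph) (r : T) (h : T -> nat).
Hypothesis symT : forall x y : T, gadj x y -> gadj y x.
Hypothesis h_root : forall x, h x = 0 <-> x = r.
Hypothesis h_adj : forall x y, gadj x y -> h x = (h y).+1 \/ h y = (h x).+1.
Hypothesis h_down : forall x, 0 < h x -> exists2 y, gadj x y & h y < h x.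
Hypothesis h_uniq : forall x y z, gadj x y -> gadj x z -> h y < h x -> h z < h x -> y = z.

Lemma rooted_walk x : walk (@gadj T) (h x) x r.
Proof.
move E: (h x) => n; elim: n x E => [|n IH] x E /=; first exact/h_root.
have [|y xy lt] := @h_down x; first by rewrite E.
by exists y => //; apply: IH; case: (h_adj xy); lia.
Qed.

Lemma rooted_dist x : dist r x = h x.
Proof.
apply: least_eq; first exact: (walk_sym symT (rooted_walk x)).
have W : forall m y, walk (@gadj T) m y x -> h x <= h y + m.
  elim=> [|m IH] y /=; first by move=> ->; lia.
  by move=> [z yz /IH]; case: (h_adj yz); lia.
by move=> m /= /W; have [_ ->] := h_root r; rewrite ?add0n.
Qed.

(** Both neighbours of a highest vertex of a cycle lie below it, so they coincide by [h_uniq], which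
    is impossible in a simple cycle of length at least three. *)
Lemma rooted_tree : is_tree T.
Proof.
split=> //.
- by move=> x /h_adj; lia.
- move=> x y; exists (h x + h y); apply: walk_cat (rooted_walk x) _.
  exact/(walk_sym symT)/rooted_walk.
move=> [n [c [n2 cn cadj cinj]]].
have [i ltin imax] : exists2 i, i < n & forall j, j < n -> h (c j) <= h (c i).
  have n0 : 0 < n by lia.
  have [i _ m] := @arg_maxnP 'I_n (Ordinal n0) xpredT (fun i => h (c i)) isT.
  by exists i => // j ltj; apply: (m (Ordinal ltj)).
pose p := if i == 0 then n.-1 else i.-1.
pose s := if i.+1 == n then 0 else i.+1.
have cs : c s = c i.+1 by rewrite /s; case: eqP => // ->.
have aip : gadj (c i) (c p).
  apply: symT; rewrite /p; case: eqP => [->|ne].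
    by rewrite -cn -[in X in gadj _ X](ltn_predK n2); apply: cadj; lia.
  by have := cadj i.-1; rewrite prednK; [apply; lia|lia].
have ais : gadj (c i) (c s) by rewrite cs; apply: cadj.
have ltp : p < n by rewrite /p; case: eqP; lia.
have lts : s < n by rewrite /s; case: eqP; lia.
have lo j : j < n -> gadj (c i) (c j) -> h (c j) < h (c i).
  by move=> lt /h_adj; have := imax j lt; lia.
have := cinj _ _ ltp lts (h_uniq aip ais (lo _ ltp aip) (lo _ lts ais)).
by rewrite /p /s; do 2 case: eqP; lia.
Qed.

End Rooted.

(** * Words *)

Section Words.
Variable H : groupType.
Implicit Types (x y g : H) (l : letter) (s : seq letter) (w : free2).
Local Open Scope group_scope.

Definition letter_eval x y l : H :=
  let g := if l.1 then y else x in if l.2 then g^-1 else g.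

Definition seq_eval x y s : H := \prod_(l <- s) letter_eval x y l.

Lemma letter_evalV x y l : letter_eval x y (letterV l) = (letter_eval x y l)^-1.
Proof. by case: l => -[] [] /=; rewrite /letter_eval /= ?invgK. Qed.

Lemma seq_eval_nil x y : seq_eval x y [::] = 1.
Proof. by rewrite /seq_eval big_nil. Qed.

Lemma seq_eval_cons x y l s :
  seq_eval x y (l :: s) = letter_eval x y l * seq_eval x y s.
Proof. by rewrite /seq_eval big_cons. Qed.

Lemma seq_eval_cat x y s t : seq_eval x y (s ++ t) = seq_eval x y s * seq_eval x y t.
Proof. by rewrite /seq_eval big_cat. Qed.

Lemma seq_eval_push x y l s :
  seq_eval x y (push l s) = letter_eval x y l * seq_eval x y s.
Proof.
case: s => [|l' s] /=; first by rewrite seq_eval_cons.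
by case: eqP => [->|_]; rewrite !seq_eval_cons // letter_evalV mulgA mulgV mul1g.
Qed.

Lemma seq_eval_reduce x y s : seq_eval x y (reduce s) = seq_eval x y s.
Proof. by elim: s => //= l s IH; rewrite seq_eval_push IH seq_eval_cons. Qed.

Lemma word_evalE x y w : word_eval x y w = seq_eval x y (free2_word w).
Proof. by []. Qed.

Lemma word_eval_of x y s : word_eval x y (free2_of s) = seq_eval x y s.
Proof. exact: seq_eval_reduce. Qed.

Lemma word_evalM x y : {morph word_eval x y : u v / u * v}.
Proof. by move=> u v; rewrite word_eval_of seq_eval_cat. Qed.

Lemma word_eval1 x y : word_eval x y 1 = 1.
Proof. by rewrite word_eval_of seq_eval_nil. Qed.

Lemma word_evalV x y : {morph word_eval x y : u / u^-1}.
Proof.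
move=> u; apply: (mulgI (word_eval x y u)).
by rewrite -word_evalM !mulgV word_eval1.
Qed.

Lemma word_eval_a x y : word_eval x y free2_a = x.
Proof. by rewrite word_eval_of seq_eval_cons seq_eval_nil mulg1. Qed.

Lemma word_eval_b x y : word_eval x y free2_b = y.
Proof. by rewrite word_eval_of seq_eval_cons seq_eval_nil mulg1. Qed.

Lemma gen2_subgroup x y : is_subgroup (gen2 x y).
Proof.
split=> [S [S1 _] _ _|g h Gg Gh S sS Sx Sy] //.
by case: (sS) => _; apply; [apply: Gg|apply: Gh].
Qed.

Lemma subgroup1 (S : set H) : is_subgroup S -> S 1.
Proof. by case. Qed.

Lemma subgroupV (S : set H) x : is_subgroup S -> S x -> S x^-1.
Proof. by move=> [S1 SB] Sx; rewrite -(mul1g x^-1); apply: SB. Qed.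

Lemma subgroupM (S : set H) x y : is_subgroup S -> S x -> S y -> S (x * y).
Proof.
by move=> sS Sx Sy; rewrite -(invgK y); apply: (sS.2) => //; apply: subgroupV.
Qed.

Lemma gen2_l x y : gen2 x y x. Proof. by []. Qed.
Lemma gen2_r x y : gen2 x y y. Proof. by []. Qed.

Lemma word_eval_in (S : set H) x y w : is_subgroup S -> S x -> S y ->
  S (word_eval x y w).
Proof.
move=> sS Sx Sy; rewrite word_evalE; elim: (free2_word w) => [|l s IH].
  by rewrite seq_eval_nil; case: sS.
rewrite seq_eval_cons; apply: subgroupM => //.
by rewrite /letter_eval; case: l => -[] [] //=; apply: subgroupV.
Qed.

Lemma gen2P x y g : gen2 x y g <-> exists w, word_eval x y w = g.
Proof.
split=> [Gg|[w <-]]; last exact: (word_eval_in w (gen2_subgroup x y)).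
apply: (Gg [set g | exists w, word_eval x y w = g]); first split.
- by exists 1; rewrite word_eval1.
- by move=> _ _ [u <-] [v <-]; exists (u * v^-1); rewrite word_evalM word_evalV.
- by exists free2_a; rewrite word_eval_a.
- by exists free2_b; rewrite word_eval_b.
Qed.

Lemma gen2_eq x y x' y' : gen2 x y x' -> gen2 x y y' ->
  gen2 x' y' x -> gen2 x' y' y -> gen2 x' y' = gen2 x y.
Proof.
move=> a b c e; apply/seteqP; split=> g Gg; first exact: (Gg _ (gen2_subgroup x y)).
exact: (Gg _ (gen2_subgroup x' y')).
Qed.

Lemma centralizer_subgroup (A : set H) :
  is_subgroup [set g | forall h, A h -> g * h = h * g].
Proof.
split=> [h _|x y cx cy h Ah /=]; first by rewrite mul1g mulg1.
have e : y^-1 * h = h * y^-1 by apply: (mulgI y); rewrite !mulgA mulgV mul1g cy // -mulgA mulgV mulg1.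
by rewrite -mulgA e !mulgA cx.
Qed.

Lemma gen2_abelian x y : x * y = y * x ->
  forall g h, gen2 x y g -> gen2 x y h -> g * h = h * g.
Proof.
move=> xy g h Gg Gh; apply: (Gg _ (centralizer_subgroup (gen2 x y))) => // k Gk.
  suff: [set g | forall h, [set x] h -> g * h = h * g] k by move=> /(_ x erefl).
  by apply: (Gk _ (centralizer_subgroup _)) => _ ->.
suff: [set g | forall h, [set y] h -> g * h = h * g] k by move=> /(_ y erefl).
by apply: (Gk _ (centralizer_subgroup _)) => _ ->.
Qed.

End Words.

Section WordComposition.
Variable H : groupType.
Local Open Scope group_scope.

(** Connects the word collected by the loop, to be read in X and Y, with the word returned in step
    (5), to be read in A and B. *)
Lemma word_eval_comp (x y : H) (u v w : free2) :
  word_eval (word_eval x y u) (word_eval x y v) w = word_eval x y (word_eval u v w).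
Proof.
rewrite [LHS]word_evalE (word_evalE u v).
elim: (free2_word w) => [|l s IH]; first by rewrite !seq_eval_nil word_eval1.
rewrite !seq_eval_cons word_evalM -IH; congr (_ * _).
by case: l => -[] [] //=; rewrite /letter_eval /= word_evalV.
Qed.

End WordComposition.

Section TorsionFree.
Local Open Scope group_scope.

Lemma free2_ofM (s t : seq letter) : free2_of (s ++ t) = free2_of s * free2_of t.
Proof.
apply: val_inj => /=; rewrite !reduce_cat (reduce_id (reduce_free t)).
by rewrite foldr_push_reduce ?reduce_free.
Qed.

Lemma free2_ofV l : free2_of [:: letterV l] = (free2_of [:: l])^-1.
Proof.
apply: (mulgI (free2_of [:: l])); rewrite [RHS]mulgV -free2_ofM.
by apply: val_inj; rewrite /= /reduce /= eqxx.
Qed.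

Lemma free2_ofK (w : free2) : free2_of (free2_word w) = w.
Proof. by case: w => s fs; apply: val_inj; rewrite /= reduce_id. Qed.

Lemma free2_powE (s : seq letter) n :
  free2_of s ^+ n = free2_of (flatten (nseq n s)).
Proof. by elim: n => [|n IH]; rewrite ?expg0 // expgS IH -free2_ofM. Qed.

Lemma cancel_free_pow l (s : seq letter) n : cancel_free (l :: s) ->
  l != letterV (last l s) -> cancel_free (flatten (nseq n (l :: s))).
Proof.
move=> fs ne; case: n => [|n] //=; rewrite /cancel_free /= cat_path.
apply/andP; split; first exact: fs.
elim: n => [|n IH] //=; rewrite ne /= cat_path IH andbT.
exact: fs.
Qed.

(* A word which is not cyclically reduced is conjugate to a shorter one, and  *)
(* the powers of a cyclically reduced word are reduced as written.            *)
Lemma free2_torsion_free (w : free2) n : 0 < n -> w ^+ n = 1 -> w = 1.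
Proof.
move=> n0; move E: (size (free2_word w)) => k; elim/ltn_ind: k w E => k IH w E.
case: w E => s fs /= E; rewrite -(free2_ofK (Free2 fs)) /=.
case: s fs E => [|l s] fs E //.
case: (eqVneq l (letterV (last l s))) => [el|ne]; last first.
  rewrite free2_powE => /(congr1 free2_word) /=.
  by rewrite reduce_id ?cancel_free_pow //; case: (n) n0.
case/lastP: s fs E el => [|s l'] fs E el.
  by move: el; rewrite /=; case: (l) => i [].
rewrite last_rcons in el.
have fs' : cancel_free s.
  by move: fs; rewrite /cancel_free /= rcons_path => /andP[/path_sorted].
have -> : free2_of (l :: rcons s l') = free2_of s ^ (free2_of [:: l'])%g.
  by rewrite -cats1 -cat1s !free2_ofM el free2_ofV conjgE mulgA.
rewrite -conjXg => /(canRL (conjgK _)); rewrite conj1g => h.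
rewrite (IH (size s) _ (free2_of s)) ?conj1g //.
  by rewrite -E /= size_rcons; lia.
by rewrite /= reduce_id.
Qed.

Lemma free2_ab_ba : free2_a * free2_b <> free2_b * free2_a.
Proof. by move=> /(congr1 free2_word). Qed.

End TorsionFree.

Lemma free_of_rank2_nonabelian (H : groupType) (G : set H) : free_of_rank2 G ->
  ~ (forall g h, G g -> G h -> (g * h = h * g)%g).
Proof.
move=> [x [y [inj ->]]] ab; apply: free2_ab_ba; apply: inj; rewrite !word_evalM.
by apply: ab; [exists free2_a|exists free2_b].
Qed.

Lemma free_of_rank2_torsion_free (H : groupType) (G : set H) : free_of_rank2 G ->
  forall g n, 0 < n -> G g -> (g ^+ n = 1)%g -> (g = 1)%g.
Proof.
move=> [x [y [inj ->]]] g n n0 [w _ <-].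
have -> : (word_eval x y w ^+ n = word_eval x y (w ^+ n))%g.
  elim: n {n0} => [|n IH]; first by rewrite !expg0 word_eval1.
  by rewrite !expgS word_evalM IH.
rewrite -(word_eval1 x y) => /inj /(free2_torsion_free n0) ->.
by rewrite word_eval1.
Qed.

(** * Isometries of trees *)

Section Isometries.
Variables (H : groupType) (T : gtree H).
Hypothesis treeT : is_tree T.
Implicit Types (g h : H) (x y z r u v : T).
Local Notation d := (@dist T).
Local Notation l := (tlen T).

Let symT := tree_sym treeT.
Let connT := tree_conn treeT.
Let S := dist_sym symT connT.
Let tri := dist_triangle connT.
Let fourp := four_point treeT.

Lemma actK g x : act g^-1%g (act g x) = x.
Proof. by rewrite -act_mul mulVg act_one. Qed.

Lemma actVK g x : act g (act g^-1%g x) = x.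
Proof. by rewrite -act_mul mulgV act_one. Qed.

Lemma act_dist g x y : d (act g x) (act g y) = d x y.
Proof.
have W k n : forall u v, walk (@gadj T) n u v -> walk (@gadj T) n (act k u) (act k v).
  elim: n => [|n IH] u v /=; first by move=> ->.
  by move=> [z uz /IH zv]; exists (act k z) => //; apply: act_adj.
have le k u v : d (act k u) (act k v) <= d u v.
  by apply/dist_le_walk/W; apply: dist_walk.
apply/eqP; rewrite eqn_leq le /=.
by have := le g^-1%g (act g x) (act g y); rewrite !actK.
Qed.

Lemma tlen_le g x : l g <= d x (act g x).
Proof.
rewrite /tlen /least; case: xgetP => [k _ [_ min]|] //.
by apply: min; exists x.
Qed.

Lemma tlen_attained g x : exists y, axis T g y.
Proof.
have [y e] := @leastP [set n | exists x : T, n = dist x (act g x)] _ (ex_intro _ x erefl).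
by exists y; rewrite /axis /= -e.
Qed.

Lemma act_distV g x : d x (act g^-1%g x) = d x (act g x).
Proof. by rewrite -(act_dist g) actVK S. Qed.

Lemma tlenV g : l g^-1%g = l g.
Proof.
rewrite /tlen; congr least; apply/seteqP.
by split=> n [x ->]; exists x; rewrite act_distV.
Qed.

Lemma axisV g : axis T g^-1%g = axis T g.
Proof. by apply/seteqP; split=> x; rewrite /axis /= tlenV act_distV. Qed.

Lemma axis_act g x : axis T g x -> axis T g (act g x).
Proof. by rewrite /axis /= act_dist. Qed.

Lemma axis_actV g x : axis T g x -> axis T g (act g^-1%g x).
Proof. by rewrite -axisV; apply: axis_act. Qed.

(* For hyperbolic g, the second condition says that g inverts no edge. *)
Definition translates g :=
  0 < l g /\ forall x, axis T g x -> d x (act g (act g x)) = 2 * l g.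

(** If the path from x through gx to g^2 x turned back at gx, the neighbour y of x towards gx would
    have displacement l(g) - 2; a defect of one is excluded by parity. For l(g) = 1 there is no room
    for this argument, and turning back means g^2 x = x. *)
Lemma hyperbolic_translates g : hyperbolic T g ->
  (forall x, act g (act g x) <> x) -> translates g.
Proof.
move=> hg ninv; split=> // x ax; move: (ax); rewrite /axis /= => e.
have [y [xy yx]] : exists y, d x y = 1 /\ d y (act g x) = d x (act g x) - 1.
  by apply: (dist_interp connT); rewrite e.
have h1 := act_dist g x y; have h2 := act_dist g y (act g x).
have h3 := act_dist g x (act g x).
have ley := tlen_le g y.
have [l1|l2] := leqP (l g) 1.
  have ey : y = act g x by apply: (dist0_eq connT); lia.
  have par := dist_parity treeT x (act g x) (act g (act g x)).
  have n0 : d x (act g (act g x)) <> 0.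
    by move=> /(dist0_eq connT) /esym /ninv.
  have := tri (act g x) x (act g (act g x)).
  have : d (act g x) x = d x (act g x) by [].
  have el : l g = 1 by move: hg; rewrite /hyperbolic; lia.
  move: par; rewrite h3 e el; case: (d x _) n0 => [|[|[|n]]] //= ; lia.
have par := dist_parity treeT (act g x) x (act g (act g x)).
have : d x (act g (act g x)) <> (2 * l g).-1.
  move=> E; move: par; rewrite (S (act g x) x) h3 addnn odd_double E.
  by rewrite (_ : (2 * l g).-1 = (l g).-1.*2.+1) /= ?odd_double //; lia.
have := fourp (act g y) x (act g x) (act g (act g x)).
have := fourp y (act g y) x (act g x).
have := tri (act g x) x (act g (act g x)).
move: (S y x) (S (act g x) x) (S (act g y) (act g x)) (S (act g y) x); lia.
Qed.

Lemma actX n g x : act (g ^+ n)%g x = iter n (act g) x.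
Proof.
by elim: n => [|n IH]; rewrite ?expg0 ?act_one // expgS act_mul IH.
Qed.

Lemma actXSr n g x : act (g ^+ n.+1)%g x = act (g ^+ n)%g (act g x).
Proof. by rewrite expgSr act_mul. Qed.

Section Line.
Variables (g : H) (r : T).
Local Notation L := (d r (act g r)).
Hypothesis L0 : 0 < L.
Hypothesis L2 : d r (act g (act g r)) = 2 * L.

Lemma line_pow n : d r (act (g ^+ n)%g r) = n * L.
Proof.
(* Two consecutive distances are carried along: the next one comes from the overlap, of length L, of
   the path from r to g^(n+1) r with the path from g^n r to g^(n+2) r. *)
suff: d r (act (g ^+ n)%g r) = n * L /\ d r (act (g ^+ n.+1)%g r) = n.+1 * L by case.
elim: n => [|n [IH1 IH2]]; first by rewrite expg0 act_one distxx expg1 mul1n.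
split=> //; set a := act _ r in IH1 *.
have e1 : act (g ^+ n.+1)%g r = act (g ^+ n)%g (act g r) by rewrite actXSr.
have e2 : act (g ^+ n.+2)%g r = act (g ^+ n)%g (act g (act g r)) by rewrite !actXSr.
have := fourp r (act (g ^+ n.+1)%g r) (act (g ^+ n)%g r) (act (g ^+ n.+2)%g r).
have := fourp r (act (g ^+ n.+2)%g r) (act (g ^+ n)%g r) (act (g ^+ n.+1)%g r).
have h1 : d (act (g ^+ n)%g r) (act (g ^+ n.+1)%g r) = L by rewrite e1 act_dist.
have h2 : d (act (g ^+ n)%g r) (act (g ^+ n.+2)%g r) = 2 * L by rewrite e2 act_dist.
have h3 : d (act (g ^+ n.+1)%g r) (act (g ^+ n.+2)%g r) = L.
  by rewrite e1 e2 act_dist act_dist.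
rewrite (S (act (g ^+ n.+2)%g r) (act (g ^+ n.+1)%g r)).
rewrite (S (act (g ^+ n.+1)%g r) (act (g ^+ n)%g r)).
rewrite (S (act (g ^+ n.+2)%g r) (act (g ^+ n)%g r)).
rewrite h1 h2 h3 IH1 IH2 !mulSn; lia.
Qed.

(** The point of the line nearest to x is at most [d x r] away from r, hence before g^n r, which is
    at distance nL from r with L at least 1. *)
Lemma line_far x n : d x r < n ->
  d x (act (g ^+ n.+1)%g r) = d x (act (g ^+ n)%g r) + L.
Proof.
move=> lt; set a := act (g ^+ n)%g r; set b := act (g ^+ n.+1)%g r.
have ea : d r a = n * L := line_pow n.
have eb : d r b = L + n * L by rewrite line_pow mulSn.
have eab : d a b = L by rewrite /b actXSr act_dist.
have : n <= n * L by rewrite leq_pmulr.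
have := fourp x a r b; have := fourp x b r a; have := tri x r a.
have := tri a x b; move: (S r x) (S a r) (S b r) (S b a); lia.
Qed.

End Line.

Lemma line_inv g r : d r (act g (act g r)) = 2 * d r (act g r) ->
  d r (act g^-1%g (act g^-1%g r)) = 2 * d r (act g^-1%g r).
Proof.
move=> e; rewrite act_distV -e S -[RHS](act_dist g^-1%g) -[RHS](act_dist g^-1%g).
by rewrite !actK.
Qed.

(* For N large the four points x, g x, g^-N r, g^N r span a tree in which     *)
(* the displacement of x is read off.                                         *)
Lemma line_displacement g r x N : 0 < d r (act g r) ->
  d r (act g (act g r)) = 2 * d r (act g r) -> d x r + 2 <= N ->
  let a := act (g^-1 ^+ N)%g r in let b := act (g ^+ N)%g r in
  d x (act g x) + d a b = d x a + d x b + d r (act g r).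
Proof.
move=> L0 L2 leN a b.
have V0 : 0 < d r (act g^-1%g r) by rewrite act_distV.
have V2 := line_inv L2.
have eb : d (act g x) b = d x b - d r (act g r) /\ d r (act g r) <= d x b.
  have EN : N = N.-1.+1 by lia.
  have e : b = act g (act (g ^+ N.-1)%g r) by rewrite /b {1}EN expgS act_mul.
  have := @line_far g r L0 L2 x N.-1 ltac:(lia).
  by rewrite {1}e act_dist -EN -/b; lia.
have ea : d (act g x) a = d x a + d r (act g r).
  have := @line_far g^-1%g r V0 V2 x N ltac:(lia).
  rewrite act_distV => <-; rewrite -(act_dist g^-1%g) actK.
  by rewrite /a expgS act_mul.
have := fourp x (act g x) a b; have := fourp a b x (act g x).
have := fourp x a (act g x) b.
have := fourp x b (act g x) a.
move: (S a b) (S a x) (S b x) (S (act g x) a) (S (act g x) b); lia.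
Qed.

Lemma translatesV g : translates g -> translates g^-1%g.
Proof.
move=> [g0 g2]; rewrite /translates tlenV axisV; split=> // x ax.
by rewrite line_inv ?act_distV ?ax // g2 //; move: ax => ->.
Qed.

Section Axis.
Variable g : H.
Hypothesis tg : translates g.
Local Notation ax := (axis T g).
Local Notation L := (tlen T g).
Local Notation lo N r := (act (g^-1 ^+ N)%g r).
Local Notation hi N r := (act (g ^+ N)%g r).

Let L0 r : ax r -> 0 < d r (act g r). Proof. by move=> ->; case: tg. Qed.
Let L2 r : ax r -> d r (act g (act g r)) = 2 * d r (act g r).
Proof. by move=> ar; rewrite (tg.2 _ ar) ar. Qed.

(** By [line_displacement], the displacement of x exceeds L by twice the distance from x to the
    segment between g^-N r and g^N r. Within that range the axis is thus a geodesic, and questions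
    about it reduce to finite segments. *)
Lemma axis_geod r x N : ax r -> ax x -> d x r + 2 <= N -> geod (lo N r) (hi N r) x.
Proof.
move=> ar axx leN; have := line_displacement (L0 ar) (L2 ar) leN.
by rewrite /geod /= axx ar; move: (S x (lo N r)); lia.
Qed.

Lemma geod_axis r x N : ax r -> d x r + 2 <= N -> geod (lo N r) (hi N r) x -> ax x.
Proof.
move=> ar leN; have := line_displacement (L0 ar) (L2 ar) leN.
by rewrite /geod /= /axis /= ar; move: (S x (lo N r)); lia.
Qed.

Lemma axis_pow r n : ax r -> d r (hi n r) = n * L.
Proof. by move=> ar; rewrite (line_pow (L0 ar) (L2 ar)) ar. Qed.

Lemma axis_convex x y z : ax x -> ax y -> geod x y z -> ax z.
Proof.
move=> axx ay hz; pose N := d y x + d z x + 2.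
apply: (@geod_axis x z N) => //; first by rewrite /N; lia.
apply: (geod_convex treeT _ _ hz); apply: axis_geod => //; rewrite /N ?distxx; lia.
Qed.

Lemma axis_between x y z : ax x -> ax y -> ax z ->
  [\/ geod x y z, geod y z x | geod x z y].
Proof.
move=> axx ay az; pose N := d y x + d z x + 2.
have hx : geod (lo N x) (hi N x) x by apply: axis_geod => //; rewrite ?distxx /N; lia.
have hy : geod (lo N x) (hi N x) y by apply: axis_geod => //; rewrite /N; lia.
have hz : geod (lo N x) (hi N x) z by apply: axis_geod => //; rewrite /N; lia.
move: hx hy hz; set a := lo N x; set b := hi N x; rewrite /geod /= => hx hy hz.
have K u v : d a u + d u b = d a b -> d a v + d v b = d a b ->
   d a v = d a u + d u v \/ d a u = d a v + d u v.
  move=> hu hv; have := fourp u v a b; have := fourp a b u v.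
  have := tri u a v; have := tri v a u; have := tri u v b; have := tri v u b.
  move: (S u a) (S v a) (S u v); lia.
have := K x y hx hy; have := K y z hy hz; have := K x z hx hz.
move: (S y x) (S z x) (S z y) => e1 e2 e3 k1 k2 k3.
have [h|[h|h]] : d x z + d z y = d x y \/ d y x + d x z = d y z \/ d x y + d y z = d x z.
  by lia.
- by constructor 1.
- by constructor 2.
- by constructor 3.
Qed.

Lemma axis_side u v : ax u -> ax v -> d u v <= L ->
  geod u (act g u) v \/ geod u (act g^-1%g u) v.
Proof.
move=> au av le; have ag := axis_act au; have aV := axis_actV au.
have e : d u (act g u) = L := au.
have eV : d u (act g^-1%g u) = L by rewrite act_distV.
have e2 : d (act g^-1%g u) (act g u) = 2 * L.
  by have := tg.2 _ aV; rewrite actVK.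
have [||] := axis_between au ag av; rewrite /geod /=; [by left| |].
- move=> h1; have [||] := axis_between au aV av; rewrite /geod /=; [by right| |].
  + move=> h2; have [||] := axis_between ag aV av; rewrite /geod /=;
    move: (S (act g u) (act g^-1%g u)) (S u v) (S (act g u) v) (S (act g u) u) (S (act g^-1%g u) u) (S (act g^-1%g u) v); lia.
  + by move=> h2; right; rewrite -(dist0_eq connT (_ : d (act g^-1%g u) v = 0)) ?distxx ?addn0 //; move: (S (act g^-1%g u) v); lia.
- by move=> h2; left; rewrite -(dist0_eq connT (_ : d (act g u) v = 0)) ?distxx ?addn0 //; move: (S (act g u) v); lia.
Qed.

End Axis.

End Isometries.

(** * The exit test of the reduction procedure *)

Section ReducedPairs.
Variables (H : groupType) (T : gtree H).
Hypothesis treeT : is_tree T.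
Implicit Types (g h : H) (x y z r u v : T).
Local Notation d := (@dist T).
Local Notation l := (tlen T).

Let symT := tree_sym treeT.
Let connT := tree_conn treeT.
Let S := dist_sym symT connT.

(** If Y translates from u towards Xu, then X^-1 Y moves u by l(Y) - l(X). If it translates the
    other way, XY moves Y^-1 u to Xu, at the same distance. *)
Lemma overlap_shortens X Y u : translates T X -> translates T Y -> l X <= l Y ->
  axis T X u -> axis T Y u -> axis T Y (act X u) ->
  minn (l (X * Y)%g) (l (X^-1 * Y)%g) <= l Y - l X.
Proof.
move=> tX tY le Xu Yu YXu; have eX : d u (act X u) = l X := Xu.
have [] := axis_side treeT tY Yu YXu; first by rewrite eX.
- rewrite /geod /= Yu eX => h.
  have := tlen_le (X^-1 * Y)%g u; rewrite act_mul -(act_dist treeT X) actVK; lia.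
- rewrite /geod /= (act_distV treeT) Yu eX => h.
  have := tlen_le (X * Y)%g (act Y^-1%g u); rewrite act_mul actVK S; lia.
Qed.

Lemma reduced_criterion X Y : translates T X -> translates T Y -> l X <= l Y ->
  ~ (minn (l (X * Y)%g) (l (X^-1 * Y)%g) <= l Y - l X) -> reduced_pair T X Y.
Proof.
move=> tX tY le nred; split; first by case: tX.
split; first by case: tY.
(* A longer overlap contains u together with a point w at distance l(X) from it on the axis of X; X
   maps one of the two to the other, and [overlap_shortens] contradicts the exit test. *)
have small u v : axis T X u -> axis T X v -> axis T Y u -> axis T Y v -> d u v < l X.
  move=> Xu Xv Yu Yv; rewrite ltnNge; apply/negP => ge; apply: nred.
  have [w [uw wv]] := dist_interp connT ge.
  have hw : geod u v w by rewrite /geod /=; lia.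
  have Xw := axis_convex treeT tX Xu Xv hw; have Yw := axis_convex treeT tY Yu Yv hw.
  have [] := axis_side treeT tX Xu Xw; first by rewrite uw.
  - rewrite /geod /= Xu uw => h.
    by apply: (overlap_shortens tX tY le Xu Yu); rewrite -(dist0_eq connT (_ : d w (act X u) = 0)) //; lia.
  - rewrite /geod /= (act_distV treeT) Xu uw => h.
    have e : u = act X w.
      by rewrite (dist0_eq connT (_ : d w (act X^-1%g u) = 0)) ?actVK //; lia.
    by apply: (overlap_shortens tX tY le Xw Yw); rewrite -e.
have [[u [Xu Yu]]|none] := pselect (axis T X `&` axis T Y !=set0); last first.
  by left; apply/eqP/negPn/negP => /set0P /none.
right.
(* The ends of the overlap are two of its points at maximal distance, which exist because these
   distances are bounded by l(X). *)
pose D n := `[< exists x y, [/\ axis T X x, axis T X y, axis T Y x, axis T Y y & d x y = n] >].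
have exD : exists n, D n by exists (d u u); apply/asboolP; exists u, u.
have maxD n : D n -> n <= l X.
  by move=> /asboolP [x [y [? ? ? ? <-]]]; apply/ltnW/small.
case: (ex_maxnP exD maxD) => n /asboolP [a [b [Xa Xb Ya Yb ab]]] nmax.
exists a, b; split; last by rewrite ab leq_min -ab; have := small a b Xa Xb Ya Yb; lia.
apply/seteqP; split=> x; last first.
  by move=> hx; split; [apply: (axis_convex treeT tX Xa Xb hx)|apply: (axis_convex treeT tY Ya Yb hx)].
move=> [Xx Yx].
have ax : d a x <= n by apply: nmax; apply/asboolP; exists a, x.
have bx : d b x <= n by apply: nmax; apply/asboolP; exists b, x.
have [//|h|h] := axis_between treeT tX Xa Xb Xx; move: h; rewrite /geod /= => h.
- rewrite -(dist0_eq connT (_ : d a x = 0)) ?distxx //; move: (S b a) (S b x); lia.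
- rewrite -(dist0_eq connT (_ : d b x = 0)) ?distxx ?addn0 //; move: (S b a) (S b x); lia.
Qed.

End ReducedPairs.

(** * Half trees and rays *)

Section HalfTrees.
Variables (H : groupType) (T : gtree H).
Hypothesis treeT : is_tree T.
Implicit Types (g h : H) (x y z r u v : T).
Local Notation d := (@dist T).

Let symT := tree_sym treeT.
Let connT := tree_conn treeT.
Let S := dist_sym symT connT.
Let tri := dist_triangle connT.
Let fourp := four_point treeT.

(* For r on the axis of g, this is the half tree of [is_half_tree setT g r]. *)
Definition half g r : set T :=
  [set x | d x r + d r (act g^-1%g r) = d x (act g^-1%g r)].

Lemma half_root g r : half g r r.
Proof. by rewrite /half /= distxx. Qed.

Lemma half_convex g r x y z : half g r x -> half g r y -> geod x y z -> half g r z.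
Proof.
rewrite /half /geod /=; set s := act g^-1%g r => hx hy hz.
have := fourp x y z r; have := fourp x y z s; have := tri z x s; have := tri z y s.
have := tri z x r; have := tri z y r; have := tri r z s.
move: (S x z) (S y z); lia.
Qed.

(** A path can leave the half tree only through its root. The hypothesis on k also admits the root,
    as is needed for points on the boundary of the domain. *)
Lemma half_sep g r x k : half g r x -> (half g r k -> k = r) ->
  d x k = d x r + d r k.
Proof.
rewrite /half /=; set s := act g^-1%g r => hx hk.
have [e|ne] := eqVneq (d k r + d r s) (d k s).
  by rewrite (hk e) distxx addn0.
have := fourp x s k r; have := tri r k s; have := tri r x k; move: (S k r) (S s r) (S s k); lia.
Qed.

Lemma half_compl_convex g r x y z : ~ half g r x -> ~ half g r y ->
  geod x y z -> ~ half g r z.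
Proof.
move=> nx ny hz zh; have ex := half_sep zh (fun h : half g r x => False_ind _ (nx h)).
have ey := half_sep zh (fun h : half g r y => False_ind _ (ny h)); move: nx ny hz.
rewrite /half /geod /=; set s := act g^-1%g r => nx ny hz.
have := fourp x y r s; have := tri r x s; have := tri r y s.
by move: (S x z) (S x r) (S y r); lia.
Qed.

Lemma half_edge g r x y : gadj x y -> half g r x -> ~ half g r y -> x = r.
Proof.
move=> xy hx ny; have := half_sep hx (fun h : half g r y => False_ind _ (ny h)).
have /(dist_adj treeT) -> := xy; case E: (d x r) => [|n]; first by rewrite (dist0_eq connT E).
move=> e; case: ny; rewrite -(dist0_eq connT (_ : d r y = 0)); last by lia.
exact: half_root.
Qed.

Lemma half_act g p x : translates T g -> axis T g p ->
  (half g^-1%g p x -> x = p) -> half g (act g p) (act g x).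
Proof.
move=> tg ap; rewrite /half /= invgK actK !(act_dist treeT).
have -> : d (act g x) p = d x (act g^-1%g p) by rewrite -(act_dist treeT g^-1%g) actK.
move=> hx.
have e : d p (act g p) = tlen T g := ap.
have e1 : d p (act g^-1%g p) = tlen T g by rewrite (act_distV treeT).
have e2 : d (act g^-1%g p) (act g p) = 2 * tlen T g.
  by have := tg.2 _ (axis_actV treeT ap); rewrite actVK.
have [h|ne] := eqVneq (d x p + d p (act g p)) (d x (act g p)).
  by rewrite (hx h) distxx e1 (S (act g p)) e.
have := fourp x p (act g^-1%g p) (act g p); have := tri p x (act g p).
have := tri p x (act g^-1%g p).
move: (S (act g^-1%g p) p) (S (act g p) p); lia.
Qed.

Section Ray.
Variables (g : H) (r : T).
Hypotheses (tg : translates T g) (ar : axis T g r).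

Lemma ray_half x : ray g r x -> half g r x /\ axis T g x.
Proof.
move=> [n hx]; rewrite -(actX n) in hx.
have aX k : axis T g (act (g ^+ k)%g r).
  by rewrite actX; elim: k => //= k; apply: axis_act.
split; last by apply: (axis_convex treeT tg ar (aX n) hx).
move: hx; rewrite /half /geod /= => hx.
have e1 := axis_pow treeT tg n ar.
have e2 := axis_pow treeT tg n.+1 (axis_actV treeT ar).
move: e2; rewrite actXSr actVK mulSn => e2.
have e3 : d r (act g^-1%g r) = tlen T g by rewrite (act_distV treeT).
have := tri x (act g^-1%g r) (act (g ^+ n)%g r); have := tri r x (act g^-1%g r).
move: (S x (act g^-1%g r)) (S r x); lia.
Qed.

Lemma half_ray x : half g r x -> axis T g x -> ray g r x.
Proof.
(* Since l(g) is at least 1, g^N r is farther from r than x is. *)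
rewrite /half /=; set s := act g^-1%g r => hx ax; pose N := d x r + 2.
exists N; rewrite -(actX N).
have le : d x r + 2 <= N by [].
set b := act _ r.
have aX k : axis T g (act (g ^+ k)%g r).
  by rewrite actX; elim: k => //= k; apply: axis_act.
have ab : axis T g b := aX N.
have as' : axis T g s := axis_actV treeT ar.
have e1 : d r b = _ := axis_pow treeT tg N ar.
have geN : N <= N * tlen T g by rewrite leq_pmulr //; case: tg.
have := axis_pow treeT tg N.+1 as'; rewrite actXSr actVK mulSn -/b => e2.
have e3 : d r s = tlen T g by rewrite (act_distV treeT).
have [//|h|h] := axis_between treeT tg ar ab ax; move: h; rewrite /geod /= => h.
- have [h'|h'|h'] := axis_between treeT tg as' ab ax; move: h'; rewrite /geod /=;
  move: (S x s) (S r x) (S b r) (tg.1) (S b s) (S x b); lia.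
- by move: (S b x) (S x r) (tg.1); rewrite /N in geN e1 *; lia.
Qed.

Lemma rayE : ray g r = half g r `&` axis T g.
Proof.
apply/seteqP; split=> x; first by move=> /ray_half.
by move=> [h a]; apply: half_ray.
Qed.

End Ray.

(** The median of x, r and g^-1 r is in B by convexity and on the axis, hence on the ray from r.
    Being also between g^-1 r and r, it is r itself. *)
Lemma half_tree_sub g r (B : set T) : translates T g -> axis T g r ->
  is_subtree B -> B `&` axis T g = ray g r -> B `<=` half g r.
Proof.
move=> tg ar sB Br x Bx.
have rB : B r.
  suff: (B `&` axis T g) r by case.
  by rewrite Br rayE //; split=> //; apply: half_root.
rewrite /half /=; set s := act g^-1%g r.
have [m [m1 m2 m3]] := median treeT x r s.
have Bm : B m by apply: (subtree_convex treeT sB Bx rB).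
have am : axis T g m by apply: (axis_convex treeT tg ar (axis_actV treeT ar)).
have [hm _] : half g r m /\ axis T g m by apply: ray_half => //; rewrite -Br.
move: hm m1 m2 m3; rewrite /half /geod /= -/s => hm m1 m2 m3.
by move: (S m r); lia.
Qed.

Section HalfTreesOfSubtree.
Variables (A : set T) (g : H) (r : T).
Hypotheses (tg : translates T g) (ar : axis T g r).
Hypothesis cA : forall x y z, A x -> A y -> geod x y z -> A z.
Hypothesis axA : axis T g `<=` A.

Lemma half_is_half_tree : is_half_tree A g r (A `&` half g r).
Proof.
split.
  split; first by move=> x [].
    apply: (convex_subtree treeT).
      by exists r; split; [apply: axA|apply: half_root].
    move=> x y z [Ax hx] [Ay hy] hz; split; first exact: cA hz.
    exact: half_convex hz.
  rewrite rayE //; apply/seteqP; split=> x; first by move=> [[_ ?] ?].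
  by move=> [? ?]; split=> //; split=> //; apply: axA.
move=> B [BA sB Br] sub; apply/seteqP; split=> // x Bx; split; first exact: BA.
exact: (half_tree_sub tg ar sB Br).
Qed.

(** Every candidate is contained in the half tree, so the maximal one is unique; from here on the
    sets U and V of a valid choice are explicit. *)
Lemma half_treeE B : is_half_tree A g r B -> B = A `&` half g r.
Proof.
move=> [[BA sB Br] Bmax]; symmetry; apply: Bmax; first by case: half_is_half_tree.
by move=> x Bx; split; [apply: BA|apply: (half_tree_sub tg ar sB Br)].
Qed.

End HalfTreesOfSubtree.

End HalfTrees.

(** * Ping-pong *)

Section Bridge.
Variables (H : groupType) (T : gtree H).
Hypothesis treeT : is_tree T.
Variables (X Y : H) (x0 : T).
Hypotheses (tX : translates T X) (tY : translates T Y).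
Implicit Types (x y z u v : T).
Local Notation d := (@dist T).

Let symT := tree_sym treeT.
Let connT := tree_conn treeT.
Let S := dist_sym symT connT.
Let tri := dist_triangle connT.
Let fourp := four_point treeT.

Lemma bridge_exists : exists p' q' : T, is_bridge X Y p' q'.
Proof.
have [ap Xap] := tlen_attained X x0; have [aq Yaq] := tlen_attained Y x0.
pose D n := `[< exists x y, [/\ axis T X x, axis T Y y & d x y = n] >].
have exD : exists n, D n by exists (d ap aq); apply/asboolP; exists ap, aq.
case: (ex_minnP exD) => n /asboolP [x [y [Xx Yy e]]] nmin.
exists x, y; split=> // u v Xu Yv; rewrite e; apply: nmin.
by apply/asboolP; exists u, v.
Qed.

(** The median of p', q' and a point of one axis lies on that axis by convexity, and minimality of
    the bridge makes it the end of the bridge. *)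
Lemma bridge_dist (p' q' : T) : is_bridge X Y p' q' ->
  (forall x, axis T X x -> d x q' = d x p' + d p' q') /\
  (forall y, axis T Y y -> d y p' = d y q' + d p' q').
Proof.
move=> [Xp Yq m]; split=> x ax.
- have [w [w1 w2 w3]] := median treeT p' q' x.
  have aw : axis T X w by apply: (axis_convex treeT tX Xp ax).
  have := m _ _ aw Yq; move: w1 w2 w3; rewrite /geod /=; move: (S q' x) (S p' x) (S q' w) (S w x).
  by have := tri p' x q'; lia.
- have [w [w1 w2 w3]] := median treeT q' p' x.
  have aw : axis T Y w by apply: (axis_convex treeT tY Yq ax).
  have := m _ _ Xp aw; move: w1 w2 w3; rewrite /geod /=; move: (S q' x) (S p' x) (S p' w) (S w x) (S p' q').
  by have := tri q' x p'; lia.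
Qed.

Lemma bridge_unique (p' q' p1 q1 : T) : axis T X `&` axis T Y = set0 ->
  is_bridge X Y p' q' -> is_bridge X Y p1 q1 -> p1 = p' /\ q1 = q'.
Proof.
move=> dis br br1; have [bX bY] := bridge_dist br; have [bX1 bY1] := bridge_dist br1.
move: br br1 => [Xp Yq m] [Xp1 Yq1 m1].
have p0 : d p' q' <> 0.
  move=> /(dist0_eq connT) E; suff: (axis T X `&` axis T Y) p' by rewrite dis.
  by split=> //; rewrite E.
have := m _ _ Xp1 Yq1; have := m1 _ _ Xp Yq.
have := bX _ Xp1; have := bY _ Yq1; have := bX1 _ Xp; have := bY1 _ Yq.
have := fourp p' q1 p1 q'.
move: (S p' p1) (S q' q1) (S p1 q') (S p' q1) (S q1 p1) => *.
by split; apply: (dist0_eq connT); lia.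
Qed.

Lemma bridge_sym (p' q' : T) : is_bridge X Y p' q' -> is_bridge Y X q' p'.
Proof.
by move=> [a b m]; split=> // x y ax ay; rewrite S (S x); apply: m.
Qed.

End Bridge.

Section PingPong.
Variables (H : groupType) (T : gtree H).
Hypothesis treeT : is_tree T.
Variables (X Y : H) (p q : T).
Hypotheses (tX : translates T X) (tY : translates T Y).
Hypothesis gb : good_basepoints X Y p q.
Implicit Types (x y z u v : T) (l : letter) (s : seq letter).
Local Notation d := (@dist T).

Let symT := tree_sym treeT.
Let connT := tree_conn treeT.
Let S := dist_sym symT connT.
Let tri := dist_triangle connT.
Let fourp := four_point treeT.

(** The sets U_+, U_-, V_+, V_- belong to the letters a, a^-1, b, b^-1, and [tip] gives their roots.
    With this indexing a letter maps the root of the opposite letter to its own root, and a reduced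
    word leads into the half tree of its first letter. *)
Definition tip l : T :=
  if l.1 then (if l.2 then q else act Y q) else (if l.2 then p else act X p).

Local Notation ev := (letter_eval X Y).

Definition half_at l : set T := half (ev l) (tip l).

Lemma tip_act l : act (ev l) (tip (letterV l)) = tip l.
Proof. by case: l => -[] [] //=; rewrite /letter_eval /tip /= actK. Qed.

Lemma tip_actV l : act (ev l)^-1%g (tip l) = tip (letterV l).
Proof. by rewrite -[in LHS]tip_act actK. Qed.

Lemma tip_axis l : axis T (if l.1 then Y else X) (tip l).
Proof.
by case: gb => ap aq _ _; case: l => -[] [] //=; apply: axis_act.
Qed.

Lemma letter_translates l : translates T (ev l).
Proof. by case: l => -[] [] //=; apply: translatesV. Qed.

Lemma letter_axis l : axis T (ev l) = axis T (if l.1 then Y else X).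
Proof. by case: l => -[] [] //=; apply: axisV. Qed.

Lemma half_at_act l x :
  (half_at (letterV l) x -> x = tip (letterV l)) -> half_at l (act (ev l) x).
Proof.
move=> h; rewrite /half_at -(tip_act l); apply: half_act => //.
- exact: letter_translates.
- by rewrite letter_axis; apply: tip_axis.
- by rewrite -letter_evalV.
Qed.

Lemma half_atE l : half_at l = [set x | d x (tip l) + d (tip l) (tip (letterV l)) = d x (tip (letterV l))].
Proof. by rewrite /half_at /half tip_actV. Qed.

Lemma half_beyond l c x : geod (tip l) (tip (letterV l)) c -> half_at l x ->
  geod c x (tip l).
Proof.
rewrite half_atE /geod /=; have := tri (tip l) x c; have := tri c x (tip (letterV l)).
by move: (S c x) (S (tip l) c) (S x (tip l)); lia.
Qed.

Lemma tips_dist l : 0 < d (tip l) (tip (letterV l)).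
Proof.
have := letter_translates l => -[]; rewrite -tip_actV => h _.
by apply: leq_trans h _; rewrite (act_distV treeT); apply: tlen_le.
Qed.

(** If the axes meet in c, both tips are on the geodesic from c to x. The one nearer to c then lies
    on both axes, whereas the overlap avoids p, Xp, q and Yq. If the axes are disjoint, the tips
    differ from the ends of the bridge and x would have to be beyond both of its ends. *)
Lemma half_disjoint_cross e e' x : half_at (false, e) x -> half_at (true, e') x -> False.
Proof.
case: gb => ap aq disj meet hx hy.
have [[c [Xc Yc]]|none] := pselect (axis T X `&` axis T Y !=set0).
  have [[gX cp cXp] [gY cq cYq]] := meet c Xc Yc.
  have gX' : geod (tip (false, e)) (tip (false, ~~ e)) c.
    by case: (e); rewrite /tip //=; apply: geod_sym.
  have gY' : geod (tip (true, e')) (tip (true, ~~ e')) c.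
    by case: (e'); rewrite /tip //=; apply: geod_sym.
  have := half_beyond gX' hx; have := half_beyond gY' hy.
  have aX := tip_axis (false, e); have aY := tip_axis (true, e').
  move: aX aY => /=.
  have NX : axis T Y (tip (false, e)) -> axis T X (tip (false, e)) -> False.
    move=> a b; have [[_ n1 n2] _] := meet _ b a.
    by move: n1 n2; rewrite /tip /=; case: (e).
  have NY : axis T Y (tip (true, e')) -> axis T X (tip (true, e')) -> False.
    move=> a b; have [_ [_ n1 n2]] := meet _ b a.
    by move: n1 n2; rewrite /tip /=; case: (e').
  move: NX NY; set u := tip _; set v := tip _ => NX NY aX aY gu gv.
  have := fourp c x u v; move: gu gv; rewrite /geod /= => gu gv f.
  have [h|h] : d c u + d u v = d c v \/ d c v + d v u = d c u.
    by have := fourp u v c x; have := tri u c v; have := tri v c u; move: (S u v) (S u c) (S v c); lia.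
  - by apply: NX => //; apply: (axis_convex treeT tY Yc aY h).
  - by apply: NY => //; apply: (axis_convex treeT tX Xc aX h).
have dis : axis T X `&` axis T Y = set0.
  by apply/eqP/negPn/negP => /set0P /none.
have [p' [q' br]] := bridge_exists X Y p.
have [[gX cp cXp] [gY cq cYq]] := disj dis p' q' br.
have [bX bY] := bridge_dist treeT tX tY br.
have gX' : geod (tip (false, e)) (tip (false, ~~ e)) p'.
  by case: (e); rewrite /tip //=; apply: geod_sym.
have gY' : geod (tip (true, e')) (tip (true, ~~ e')) q'.
  by case: (e'); rewrite /tip //=; apply: geod_sym.
have hX := half_beyond gX' hx; have hY := half_beyond gY' hy.
have aX := bX _ (tip_axis (false, e)); have aY := bY _ (tip_axis (true, e')).
have p0 : d p' q' <> 0.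
  move=> /(dist0_eq connT) E; apply: none; exists p'.
  by case: br => a b _; split=> //; rewrite E.
have sX : d (tip (false, e)) p' <> 0.
  by move=> /(dist0_eq connT); rewrite /tip /=; case: (e) => E; [case: cp|case: cXp].
have sY : d (tip (true, e')) q' <> 0.
  by move=> /(dist0_eq connT); rewrite /tip /=; case: (e') => E; [case: cq|case: cYq].
move: hX hY aX aY sX sY; rewrite /geod /=; set u := tip _; set v := tip _ => hX hY aX aY sX sY.
have := fourp x p' u q'; have := fourp x q' u p'.
have := fourp x q' v p'; have := fourp x p' v q'.
move: (S x p') (S x q') (S x u) (S x v) (S u p') (S u q') (S v p') (S v q') (S p' q').
lia.
Qed.

Lemma half_at_disjoint l l' x : l <> l' -> half_at l x -> half_at l' x -> False.
Proof.
have K i e : half_at (i, e) x -> half_at (i, ~~ e) x -> False.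
  by rewrite !half_atE /letterV /= negbK; have := tips_dist (i, e); rewrite /letterV /=; move: (S (tip (i,e)) (tip (i, ~~ e))); lia.
move: l l' => [[] e] [[] e'] ne.
- have -> : e' = ~~ e by case: (e) (e') ne => -[].
  exact: K.
- by move=> a b; apply: half_disjoint_cross b a.
- exact: half_disjoint_cross.
- have -> : e' = ~~ e by case: (e) (e') ne => -[].
  exact: K.
Qed.

(* The closed fundamental domain, without the branches attached to its tips. *)
Definition core : set T := [set x | forall l, half_at l x -> x = tip l].

Lemma tip_half l : half_at l (tip l).
Proof. exact: half_root. Qed.

Lemma tip_core l : core (tip l).
Proof.
move=> l' hl'; have [->//|/eqP ne] := eqVneq l l'.
by case: (half_at_disjoint ne (tip_half l) hl').
Qed.

(** Stated for the core because a point of D inside an edge may have a tip in its support. *)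
Lemma ping_pong s l k : cancel_free (l :: s) -> core k ->
  half_at l (act (seq_eval X Y (l :: s)) k).
Proof.
elim: s l => [|l' s IH] l; rewrite seq_eval_cons act_mul => fs ck.
  by rewrite seq_eval_nil act_one; apply: half_at_act => /ck.
apply: half_at_act => h.
have [/andP[/eqP ne fs']] : (l' != letterV l) && cancel_free (l' :: s) by move: fs.
by case: (half_at_disjoint ne (IH _ fs' ck) h).
Qed.

Definition inner : set T := [set x | forall l, ~ half_at l x].

Lemma inner_core x : inner x -> core x.
Proof. by move=> h l /h. Qed.

Lemma inner_convex x y z : inner x -> inner y -> geod x y z -> inner z.
Proof. by move=> ix iy h l; apply: (half_compl_convex treeT (ix l) (iy l) h). Qed.

(** Between opposite tips, their own half trees are met only at the ends. For the other axis, both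
    tips are outside its half trees, whose complements are convex. *)
Lemma path_inner i x : geod (tip (i, false)) (tip (i, true)) x ->
  (forall e, x <> tip (i, e)) -> inner x.
Proof.
move=> gx nx [j e'] hx; have [ej|nj] := eqVneq i j.
  subst j; have g' : geod (tip (i, e')) (tip (i, ~~ e')) x.
    by case: (e') => //=; apply: geod_sym.
  have := half_beyond g' hx; rewrite /geod /= distxx => h.
  by apply: (nx e'); apply: (dist0_eq connT); lia.
have nh e : ~ half_at (j, e') (tip (i, e)).
  move=> h; apply: (half_at_disjoint _ (tip_half (i, e)) h).
  by move=> [E _]; rewrite E eqxx in nj.
exact: (half_compl_convex treeT (nh _) (nh _) gx hx).
Qed.

Lemma path_core i x : geod (tip (i, false)) (tip (i, true)) x -> core x.
Proof.
move=> gx; have [[e ->]|ne] := pselect (exists e, x = tip (i, e)); first exact: tip_core.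
by apply/inner_core/(path_inner gx) => e E; apply: ne; exists e.
Qed.

Lemma open_path_inner_l x : in_open_path p (act X p) x -> inner x.
Proof.
move=> [gx np nq]; apply: (@path_inner false); first exact: geod_sym.
by case.
Qed.

Lemma open_path_inner_r x : in_open_path q (act Y q) x -> inner x.
Proof.
move=> [gx np nq]; apply: (@path_inner true); first exact: geod_sym.
by case.
Qed.

Lemma bridge_inner p' q' x : axis T X `&` axis T Y = set0 -> is_bridge X Y p' q' ->
  geod p' q' x -> inner x.
Proof.
case: gb => _ _ dj _ e br; have [hp hq] := dj e _ _ br.
by apply: inner_convex; [apply: open_path_inner_l|apply: open_path_inner_r].
Qed.

Lemma centre_exists : exists2 c, in_open_path p (act X p) c &
  exists c', in_open_path q (act Y q) c' /\
    (c = c' \/ axis T X `&` axis T Y = set0 /\ is_bridge X Y c c').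
Proof.
case: gb => ap aq dj meet.
have [[c [Xc Yc]]|none] := pselect (axis T X `&` axis T Y !=set0).
  by have [? ?] := meet c Xc Yc; exists c => //; exists c; split=> //; left.
have dis : axis T X `&` axis T Y = set0.
  by apply/eqP/negPn/negP => /set0P /none.
have [p' [q' br]] := bridge_exists X Y p; have [? ?] := dj dis p' q' br.
by exists p' => //; exists q'; split=> //; right.
Qed.

Lemma core_sep l x k : half_at l x -> core k -> d x k = d x (tip l) + d (tip l) k.
Proof. by move=> hx ck; apply: (half_sep treeT hx) => /ck. Qed.

Lemma core_dichotomy x : core x -> inner x \/ exists l, x = tip l.
Proof.
move=> cx; have [[l hl]|none] := pselect (exists l, half_at l x).
  by right; exists l; apply: cx.
by left=> l hl; apply: none; exists l.
Qed.

(* Every cell is a translate of one in the core, if nothing but the axes      *)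
(* branches off at the tips: inn l is the neighbour of tip l in the core.     *)
Section Cover.
Variable inn : letter -> T.
Hypothesis inn_core : forall l, core (inn l).
Hypothesis no_branch : forall l x, half_at l x -> x <> tip l ->
  d x (tip l) = (d x (act (ev l) (inn (letterV l)))).+1.

(** An edge can leave the core only at some [tip l]. By [no_branch] its other end is the image under
    the letter l of [inn (letterV l)], so the whole edge is the image of an edge of the core. *)
Lemma cover_core x y : core x -> x = y \/ gadj x y -> exists s x' y',
  [/\ core x', core y', x = act (seq_eval X Y s) x' & y = act (seq_eval X Y s) y'].
Proof.
move=> cx xy; have [cy|ncy] := pselect (core y).
  by exists [::], x, y; rewrite seq_eval_nil !act_one.
have [l hy ny] : exists2 l, half_at l y & y <> tip l.
  by apply: contrapT => none; apply: ncy => l hl; apply: contrapT => ny; apply: none; exists l.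
have := core_sep hy cx; have := no_branch hy ny.
have [e|/(symT (y := y)) /(dist_adj treeT) ->] := xy; first by case: ncy; rewrite -e.
move=> e1 e2; have e : tip l = x by apply: (dist0_eq connT); lia.
exists [:: l], (tip (letterV l)), (inn (letterV l)); split=> //.
- exact: tip_core.
- by rewrite seq_eval_cons seq_eval_nil mulg1 tip_act.
- by rewrite seq_eval_cons seq_eval_nil mulg1; apply: (dist0_eq connT); lia.
Qed.

Lemma cover x y : x = y \/ gadj x y -> exists s x' y',
  [/\ core x', core y', x = act (seq_eval X Y s) x' & y = act (seq_eval X Y s) y'].
Proof.
(* The reference point k has to vary: undoing the letter l brings x to distance [d x (tip l) - 1]
   from [inn (letterV l)], which becomes the new k. *)
move=> xy; suff C : forall n k, core k -> d x k <= n -> exists s x' y',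
    [/\ core x', core y', x = act (seq_eval X Y s) x' & y = act (seq_eval X Y s) y'].
  by apply: (C (d x (tip (false, false))) (tip (false, false))) => //; apply: tip_core.
move=> n; elim: n x y xy => [|n IH] x y xy k ck le.
  have cx : core x by rewrite (dist0_eq connT (_ : d x k = 0)) //; lia.
  exact: cover_core.
have [cx|ncx] := pselect (core x); first exact: cover_core.
have [l hx nx] : exists2 l, half_at l x & x <> tip l.
  by apply: contrapT => none; apply: ncx => l hl; apply: contrapT => nx; apply: none; exists l.
have := core_sep hx ck; have := no_branch hx nx; set n0 := act _ _ => e1 e2.
have [||s [x' [y' [cx' cy' e e']]]] := IH (act (ev l)^-1%g x) (act (ev l)^-1%g y) _ (inn (letterV l)) (@inn_core (letterV l)).
- by case: xy => [->|h]; [left|right; apply: act_adj].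
- by rewrite -(act_dist treeT (ev l)) actVK -/n0; lia.
by exists (l :: s), x', y'; split=> //; rewrite seq_eval_cons act_mul -?e -?e' actVK.
Qed.

End Cover.

End PingPong.

(** * Geometric realisation *)

Section Pointwise.
Local Open Scope ring_scope.
Variables (R : realType) (T : Type).

Lemma ptws_eval_cvg (f : {ptws T -> R}) x : (fun g : {ptws T -> R} => g x) @ f --> f x.
Proof.
have /cvg_sup/(_ x)/cvg_image h : f --> f by apply: cvg_id.
apply: cvg_trans (h _) => {h}.
  by move=> Q /= [W nbdW <-]; apply: filterS nbdW; exact: preimage_image.
by rewrite eqEsubset; split=> y // _; exists (fun=> y).
Qed.

(** On the realisation this is the open star of x; unions and finite intersections of such stars are
    enough to cut out the domain. *)
Lemma open_eval_neq0 (x : T) : open [set f : {ptws T -> R} | f x != 0].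
Proof.
rewrite openE => f /= fx; apply: (@ptws_eval_cvg f x [set t | t != 0]).
by apply: open_nbhs_nbhs; split=> //; apply: open_neq.
Qed.

Lemma ptws_cvg (F : set_system {ptws T -> R}) (f : {ptws T -> R}) :
  Filter F -> (forall x, (fun g => g x) @ F --> f x) -> F --> f.
Proof.
move=> FF h; apply/cvg_sup => x.
rewrite cvg_image; last by rewrite eqEsubset; split=> v // _; exists (cst v).
move=> A Ax /=; rewrite ?nbhs_simpl; exists ((fun g => g x) @^-1` A); first exact: h.
by rewrite eqEsubset; split => [j [? ? <-]|j Wj] //; exists (fun _ => j).
Qed.

End Pointwise.

Section Realise.
Local Open Scope ring_scope.
Variables (R : realType) (H : groupType) (T : gtree H).
Local Notation pts := {ptws T -> R}.
Implicit Types (f : pts) (A : set T) (x y z : T).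

(** For a point of the realisation this is the vertex set of the open cell containing it. *)
Definition supp f : set T := [set x | f x != 0].

Definition seg x y (t : R) : pts := fun z => (1 - t) * vpt R x z + t * vpt R y z.

Lemma vptE x y : vpt R x y = (`[< x = y >])%:R. Proof. by []. Qed.

Lemma vptxx x : vpt R x x = 1.
Proof. by rewrite vptE asboolT. Qed.

Lemma vpt_neq x y : x <> y -> vpt R x y = 0.
Proof. by move=> ne; rewrite vptE asboolF. Qed.

Lemma supp_vpt x : supp (vpt R x) = [set x].
Proof.
apply/seteqP; split=> y; rewrite /supp /=; last by move=> ->; rewrite vptxx oner_neq0.
by case: (pselect (x = y)) => // ne; rewrite vpt_neq ?eqxx.
Qed.

Lemma seg0 x y : seg x y 0 = vpt R x.
Proof. by apply/funext => z; rewrite /seg subr0 mul1r mul0r addr0. Qed.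

Lemma seg1 x y : seg x y 1 = vpt R y.
Proof. by apply/funext => z; rewrite /seg subrr mul1r mul0r add0r. Qed.

Lemma segxx x t : seg x x t = vpt R x.
Proof. by apply/funext => z; rewrite /seg -mulrDl subrK mul1r. Qed.

Lemma supp_seg x y t : 0 < t < 1 -> supp (seg x y t) = [set x; y].
Proof.
move=> /andP[t0 t1]; have [e|ne] := pselect (x = y).
  by rewrite -e segxx supp_vpt setUid.
apply/seteqP; split=> z; rewrite /supp /seg /=.
  have [zx|nzx] := pselect (x = z); first by left.
  have [zy|nzy] := pselect (y = z); first by right.
  by rewrite !vpt_neq // !mulr0 addr0 eqxx.
move=> [->|->].
- by rewrite vptxx (vpt_neq (nesym ne)) mulr0 addr0 mulr1 subr_eq0 gt_eqF.
- by rewrite vptxx (vpt_neq ne) mulr0 add0r mulr1 gt_eqF.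
Qed.

Lemma realise_seg A x y t : A x -> A y -> x = y \/ gadj x y -> 0 <= t <= 1 ->
  realise A (seg x y t).
Proof. by move=> *; exists x, y, t. Qed.

Lemma realise_vpt A x : A x -> realise A (vpt R x).
Proof.
by move=> Ax; rewrite -(seg0 x x); apply: realise_seg => //; [left|rewrite lexx ler01].
Qed.

(** At t = 0 and t = 1 the edge is replaced by a degenerate one, so that the support is exactly the
    pair x, y in every case. *)
Lemma realise_cell A f : realise A f -> exists x y t,
  [/\ A x, A y, x = y \/ gadj x y & f = seg x y t /\
    (x = y /\ t = 0 \/ 0 < t < 1)].
Proof.
move=> [x [y [t [Ax Ay xy /andP[t0 t1] ->]]]].
have [e|n0] := eqVneq t 0.
  exists x, x, 0; split=> //; first by left.
  by split; [rewrite segxx e -/(seg x y 0) seg0|left].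
have [e|n1] := eqVneq t 1.
  exists y, y, 0; split=> //; first by left.
  by split; [rewrite segxx e -/(seg x y 1) seg1|left].
by exists x, y, t; split=> //; split=> //; right; rewrite !lt_def n0 t0 eq_sym n1 t1.
Qed.

Lemma realise_supp A f : realise A f -> exists x y,
  [/\ A x, A y, x = y \/ gadj x y & supp f = [set x; y]].
Proof.
move=> /realise_cell [x [y [t [Ax Ay xy [-> h]]]]]; exists x, y; split=> //.
by case: h => [[-> ->]|h]; [rewrite segxx supp_vpt setUid|rewrite supp_seg].
Qed.

Lemma realiseP A f : realise A f <-> realise setT f /\ supp f `<=` A.
Proof.
split=> [rf|[/realise_cell [x [y [t [_ _ xy [-> h]]]]]]].
  split; last by have [x [y [Ax Ay _ ->]]] := realise_supp rf; move=> z [->|->].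
  by have [x [y [t [_ _ xy t01 e]]]] := rf; exists x, y, t.
case: h => [[-> ->]|h].
  by rewrite segxx supp_vpt => Ay; apply: realise_vpt; apply: Ay.
rewrite supp_seg // => sA; apply: realise_seg => //; [by apply: sA; left|by apply: sA; right|].
by case/andP: h => h1 h2; rewrite !ltW.
Qed.

Lemma realise_vptP A x : realise A (vpt R x) <-> A x.
Proof.
split=> [/realiseP []|]; last exact: realise_vpt.
by rewrite supp_vpt => _; apply.
Qed.

Lemma supp_pact (g : H) f : supp (pact g f) = act g @` supp f.
Proof.
apply/seteqP; split=> x; rewrite /supp /pact /=.
  by move=> fx; exists (act g^-1%g x) => //; rewrite actVK.
by move=> [y fy <-]; rewrite actK.
Qed.

Lemma pact_mul (g h : H) f : pact (g * h)%g f = pact g (pact h f).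
Proof. by apply/funext => x; rewrite /pact -act_mul invgM. Qed.

Lemma pact1 f : pact 1%g f = f.
Proof. by apply/funext => x; rewrite /pact invg1 act_one. Qed.

Lemma pact_vpt (g : H) x : pact g (vpt R x) = vpt R (act g x).
Proof.
apply/funext => z; rewrite /pact !vptE; congr (nat_of_bool _)%:R.
by apply: asbool_equiv_eq; split=> [->|<-]; rewrite ?actVK ?actK.
Qed.

Lemma pact_seg (g : H) x y t : pact g (seg x y t) = seg (act g x) (act g y) t.
Proof. by apply/funext => z; rewrite /seg -!pact_vpt. Qed.

Lemma realise_pact (g : H) A f : realise A f -> realise (act g @` A) (pact g f).
Proof.
move=> /realise_cell [x [y [t [Ax Ay xy [-> h]]]]]; rewrite pact_seg.
apply: realise_seg; [by exists x|by exists y| |].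
  by case: xy => [->|/(act_adj g)]; [left|right].
by case: h => [[_ ->]|/andP[h1 h2]]; [rewrite lexx ler01|rewrite !ltW].
Qed.

Lemma realise_sub A B : A `<=` B -> realise A `<=` (realise B : set pts).
Proof. by move=> AB f /realiseP [rf sA]; apply/realiseP; split=> // x /sA /AB. Qed.

(** Let t tend to 0 from the right. This places the tips, which are not in the domain, in its
    closure. *)
Lemma closure_seg (D : set pts) x y : (forall t, 0 < t < 1 -> D (seg x y t)) ->
  closure D (vpt R x).
Proof.
move=> h; rewrite closureEcvg; exists ((fun t : R => seg x y t) @ 0^'+).
  exact: fmap_proper_filter.
split.
  apply: ptws_cvg => z; rewrite -(seg0 x y).
  apply: (@cvg_trans _ ((fun t : R => seg x y t z) @ 0^'+)); first by [].
  apply: cvg_at_right_filter; rewrite /seg.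
  apply: cvgD; apply: cvgM => //; [apply: cvgB => //; exact: cvg_cst|exact: cvg_cst|exact: cvg_cst].
move=> A DA; suff: \forall t \near (0 : R)^'+, A (seg x y t) by [].
near=> t; apply: DA; apply: h; apply/andP; split; near: t.
- exact: nbhs_right_gt.
- exact: nbhs_right_lt.
Unshelve. all: by end_near.
Qed.

End Realise.

(** * The fundamental domain and the loop *)

Lemma gen2_word (H : groupType) (X Y g : H) : gen2 X Y g ->
  exists2 s, cancel_free s & g = seq_eval X Y s.
Proof. by move=> /gen2P [[s fs] <-]; exists s. Qed.

Lemma seq_eval_gen2 (H : groupType) (X Y : H) s : gen2 X Y (seq_eval X Y s).
Proof. by apply/gen2P; exists (free2_of s); rewrite word_eval_of. Qed.

Section Domain.
Variables (R : realType) (H : groupType) (T : gtree H).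
Hypothesis treeT : is_tree T.
Variables (X Y : H) (dd : domain_data T).
Hypotheses (tX : translates T X) (tY : translates T Y).
Hypothesis gb : good_basepoints X Y (dp dd) (dq dd).
Implicit Types (x y z u v k : T) (l : letter) (s : seq letter) (f : {ptws T -> R}).
Local Notation A := (dS dd).
Local Notation G := (gen2 X Y).
Local Notation ev := (letter_eval X Y).
Local Notation tip := (tip X Y (dp dd) (dq dd)).
Local Notation half_at := (half_at X Y (dp dd) (dq dd)).
Local Notation core := (core X Y (dp dd) (dq dd)).
Local Notation inner := (inner X Y (dp dd) (dq dd)).
Local Notation dom := (domain R dd).

Definition dhalf l : set T :=
  if l.1 then (if l.2 then dVm dd else dVp dd)
  else (if l.2 then dUm dd else dUp dd).

Hypothesis dhalfE : forall l, dhalf l = A `&` half_at l.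

Lemma domainP f : dom f <-> realise A f /\ forall l, ~ supp f `<=` half_at l.
Proof.
have K l : realise A f -> realise (dhalf l) f <-> supp f `<=` half_at l.
  move=> /realiseP [rf sA]; rewrite realiseP dhalfE; split=> [[_ h] x /h []//|h].
  by split=> // x fx; split; [apply: sA|apply: h].
split=> [[rA n]|[rA n]]; split=> //.
  move=> l /(K l rA); case: l => -[] [] h; apply: n.
  - by right.
  - by left; right.
  - by left; left; right.
  - by left; left; left.
move=> [[[]|]|].
- by move/(K (false, false) rA); apply: n.
- by move/(K (false, true) rA); apply: n.
- by move/(K (true, false) rA); apply: n.
- by move/(K (true, true) rA); apply: n.
Qed.

Lemma in_domainP x : in_domain R dd x <-> A x /\ inner x.
Proof.
rewrite /in_domain domainP realise_vptP; split=> -[Ax h]; split=> // l.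
  by move=> hx; apply: (h l); rewrite supp_vpt => _ ->.
by rewrite supp_vpt => /(_ x erefl) /h.
Qed.

(** The cell of f is not contained in any half tree; if one of its ends is in a half tree, the edge
    leaves it there, so that end is the root. *)
Lemma domain_core f : dom f -> supp f `<=` core.
Proof.
move=> /domainP [/realise_supp [x [y [_ _ xy ->]]] n].
have K u v l : [set x; y] = [set u; v] -> u = v \/ gadj u v -> half_at l u -> u = tip l.
  move=> e [euv|uv] hu; first by case: (n l); rewrite e euv => _ [->|->]; rewrite -?euv.
  apply: (half_edge treeT uv hu) => hv; apply: (n l).
  by rewrite e => _ [->|->].
move=> _ [->|->] l; first exact: (K x y).
apply: (K y x); first by rewrite setUC.
by case: xy => [->|/(tree_sym treeT)]; [left|right].
Qed.

Lemma nontrivial_core g : G g -> g <> 1%g ->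
  exists l, forall x, core x -> half_at l (act g x).
Proof.
move=> /gen2_word [[|l s] fs ->]; first by rewrite seq_eval_nil.
by move=> _; exists l => x; apply: ping_pong.
Qed.

Lemma domain_disjoint g h : G g -> G h -> g <> h ->
  (pact g @` dom) `&` (pact h @` dom) = set0.
Proof.
move=> Gg Gh ne; apply/seteqP; split=> // f [[f1 D1 <-] [f2 D2 e]].
have [||l hl] := @nontrivial_core (g^-1 * h)%g.
- have sG := gen2_subgroup X Y.
  exact: (subgroupM sG (subgroupV sG Gg) Gh).
- by move=> E; apply: ne; rewrite -[h](mulKg g^-1%g) E invgK mulg1.
have e1 : f1 = pact (g^-1 * h)%g f2 by rewrite pact_mul e -pact_mul mulVg pact1.
have /domainP [_ /(_ l) nl] := D1; apply: nl => x; rewrite e1 supp_pact => -[y /(domain_core D2) cy <-].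
exact: hl.
Qed.

Lemma in_domain_unique g x : G g -> in_domain R dd x -> in_domain R dd (act g x) -> g = 1%g.
Proof.
move=> Gg Dx Dgx; apply: contrapT => ne.
have := domain_disjoint Gg (subgroup1 (gen2_subgroup X Y)) ne.
move/seteqP => [/(_ (vpt R (act g x))) h _]; apply: h; split.
  by exists (vpt R x); rewrite ?pact_vpt.
by exists (vpt R (act g x)); rewrite ?pact1.
Qed.

Lemma domain_open : exists2 O : set {ptws T -> R}, open O & dom = O `&` realise A.
Proof.
(* A support is not contained in a half tree exactly when some vertex outside it has a nonzero
   coordinate. *)
pose W l : set {ptws T -> R} := \bigcup_(x in ~` half_at l) [set f : {ptws T -> R} | f x != 0%R].
have oW l : open (W l) by apply: bigcup_open => x _; apply: open_eval_neq0.
have WP l f : W l f <-> ~ supp f `<=` half_at l.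
  split=> [[x nx fx] /(_ x fx)//|n]; apply: contrapT => none; apply: n => x fx.
  by apply: contrapT => nx; apply: none; exists x.
exists (W (false, false) `&` W (false, true) `&` W (true, false) `&` W (true, true)).
  by do !apply: openI.
apply/seteqP; split=> f.
  by move=> /domainP [rA n]; split=> //; do !split; apply/WP.
by move=> [[[[/WP ? /WP ?] /WP ?] /WP ?] rA]; apply/domainP; split=> // -[[] []].
Qed.

Lemma domain_fundamental : (forall g x, G g -> A x -> A (act g x)) ->
  (forall f, realise A f -> exists g f',
     [/\ G g, closure dom f', realise A f' & f = pact g f']) ->
  is_fundamental_domain G (realise A) dom.
Proof.
move=> inv cov; split; [exact: domain_open| |exact: domain_disjoint].
apply/seteqP; split=> f.
  move=> [g Gg [f' [_ rf'] <-]]; apply: realise_sub (realise_pact g rf').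
  by move=> _ [x Ax <-]; apply: inv.
by move=> /cov [g [f' [Gg cf' rf' ->]]]; exists g => //; exists f'.
Qed.

Section Loop.
Local Notation step := (loop_step R X Y dd).

Lemma loop_stepP w z t : step (w, z) t -> ~ in_domain R dd z /\
  ((exists l, dhalf l z /\ t = ((w * free2_of [:: l])%g, act (ev l)^-1%g z)) \/
   (t = (w, z) /\ forall l, ~ dhalf l z)).
Proof.
move E : (w, z) => u st; case: st E => {}u {}t nd.
- by move=> h [-> ->]; split=> //; left; exists (false, false).
- move=> h [-> ->]; split=> //; left; exists (false, true); split=> //.
  by rewrite -free2_ofV /letter_eval /= invgK.
- by move=> h [-> ->]; split=> //; left; exists (true, false).
- move=> h [-> ->]; split=> //; left; exists (true, true); split=> //.
  by rewrite -free2_ofV /letter_eval /= invgK.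
- by move=> ? ? ? ? [-> ->]; split=> //; right; split=> // -[[] []].
Qed.

Lemma loop_final w z : final step (w, z) -> in_domain R dd z.
Proof.
move=> fin; apply: contrapT => nd.
have [h|h1] := pselect (dUp dd z); first exact: (fin _ (loop_Up _ _ _ nd h)).
have [h|h2] := pselect (dUm dd z); first exact: (fin _ (loop_Um _ _ _ nd h)).
have [h|h3] := pselect (dVp dd z); first exact: (fin _ (loop_Vp _ _ _ nd h)).
have [h|h4] := pselect (dVm dd z); first exact: (fin _ (loop_Vm _ _ _ nd h)).
exact: (fin _ (loop_idle _ _ _ nd h1 h2 h3 h4)).
Qed.

Lemma loop_invariant w z t : reaches step (w, z) t ->
  act (word_eval X Y t.1) t.2 = act (word_eval X Y w) z.
Proof.
move E : (w, z) => u rt; elim: rt w z E => {u t} [[w z] t st w' z'|u w' z'|u t v _ IH1 _ IH2 w' z'].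
- move=> [-> ->]; have [_ [[l [_ ->]]|[-> _]]] := loop_stepP st => //=.
  by rewrite word_evalM word_eval_of seq_eval_cons seq_eval_nil mulg1 act_mul actVK.
- by move=> <-.
- by move=> e; rewrite -(IH1 _ _ e); case: t {IH1} IH2 => w z IH2; apply: IH2.
Qed.

Lemma loop_terminates k g w : (forall g x, G g -> A x -> A (act g x)) ->
  G g -> in_domain R dd k -> terminates step (w, act g k).
Proof.
move=> inv /gen2_word [s fs ->] Dk; have /in_domainP [Ak ik] := Dk.
elim: s w fs => [|l s IH] w fs; constructor=> t /loop_stepP [nd].
  by case: nd; rewrite seq_eval_nil act_one.
have hl := ping_pong treeT tX tY gb fs (inner_core ik).
have Al : A (act (seq_eval X Y (l :: s)) k) by apply: inv => //; apply: seq_eval_gen2.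
(* The idle step is excluded since the vertex is in A and in the half tree of l; disjointness then
   forces the step to undo l, the first letter of the remaining word. *)
case=> [[l' [h ->]]|[_ /(_ l)]]; last by rewrite dhalfE => -[].
have -> : l' = l.
  move: h; rewrite dhalfE => -[_ h]; apply: contrapT => ne.
  exact: (half_at_disjoint treeT tX tY gb ne h hl).
rewrite seq_eval_cons act_mul actK; apply: IH.
by move: fs => /path_sorted.
Qed.

End Loop.

End Domain.

Section ValidDomain.
Variables (R : realType) (H : groupType) (T : gtree H).
Hypothesis treeT : is_tree T.
Variables (X Y : H) (dd : domain_data T).
Hypotheses (tX : translates T X) (tY : translates T Y).
Hypothesis valid : valid_domain R (gen2 X Y) X Y dd.
Implicit Types (x y z u v k : T) (l : letter) (s : seq letter) (f : {ptws T -> R}).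
Local Notation A := (dS dd).
Local Notation G := (gen2 X Y).
Local Notation ev := (letter_eval X Y).
Local Notation p := (dp dd).
Local Notation q := (dq dd).
Local Notation tip := (tip X Y p q).
Local Notation half_at := (half_at X Y p q).
Local Notation core := (core X Y p q).
Local Notation inner := (inner X Y p q).
Local Notation dom := (domain R dd).
Local Notation d := (@dist T).
Local Notation pd := (@path_domain R H T X Y p q).

Lemma valid_basepoints : good_basepoints X Y p q.
Proof. by case: valid. Qed.
Local Notation gb := valid_basepoints.

Lemma realise_supp1 f x : realise setT f -> supp f `<=` [set x] -> f = vpt R x.
Proof.
move=> /realise_cell [u [v [t [_ _ _ [-> [[<- _]|h]]]]]].
  by rewrite segxx supp_vpt => /(_ u erefl) ->.
rewrite supp_seg // => sA; have -> : u = x by apply: sA; left.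
by have -> : v = x by [apply: sA; right]; rewrite segxx.
Qed.

(** Supports of points of the path are in the core, which a half tree meets only in its root. So f
    would be the vertex [tip l], and the only tips on the path are its excluded ends. *)
Lemma open_path_nonhalf i f l : realise (geod (tip (i, true)) (tip (i, false))) f ->
  (forall e, f <> vpt R (tip (i, e))) -> ~ supp f `<=` half_at l.
Proof.
move=> /realiseP [rf sg] ne sh.
have s1 : supp f `<=` [set tip l].
  move=> x fx; apply: (path_core treeT tX tY gb (i := i)); last exact: sh.
  exact/(geod_sym (tree_sym treeT) (tree_conn treeT))/sg.
have fE := realise_supp1 rf s1.
have tg : geod (tip (i, true)) (tip (i, false)) (tip l).
  by apply: sg; rewrite fE supp_vpt.
have [[e E]|ntip] := pselect (exists e, tip l = tip (i, e)).
  by apply: (ne e); rewrite fE E.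
apply: (path_inner treeT tX tY gb (i := i) (x := tip l) _ _ (tip_half _ _ _ _ l)).
  exact: (geod_sym (tree_sym treeT) (tree_conn treeT)).
by move=> e E; apply: ntip; exists e.
Qed.

Lemma path_domain_nonhalf f l : pd f -> ~ supp f `<=` half_at l.
Proof.
move=> [[[rf n]|[rf n]]|[dis [p' [q' [br rf]]]]].
- by apply: (open_path_nonhalf (i := false)) => // -[] e; apply: n; [left|right].
- by apply: (open_path_nonhalf (i := true)) => // -[] e; apply: n; [left|right].
have [x [y [gx _ _ ->]]] := realise_supp rf.
by move=> /(_ x (or_introl erefl)); apply: (bridge_inner treeT tX tY gb dis br gx).
Qed.

Lemma path_domain_realise f : pd f -> realise setT f.
Proof.
move=> [[[rf n]|[rf n]]|[dis [p' [q' [br rf]]]]]; exact: realise_sub rf.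
Qed.

Let translated : realise A = \bigcup_(g in G)
   (pact g @` (closure pd `&` realise setT)) -> forall g x, G g -> A x -> A (act g x).
Proof.
move=> e g x Gg Ax; apply/(realise_vptP R); rewrite -pact_vpt.
have : realise A (vpt R x) by apply: realise_vpt.
rewrite !e => -[h Gh [f cf <-]]; exists (g * h)%g.
  exact: subgroupM (gen2_subgroup X Y) Gg Gh.
by exists f => //; rewrite pact_mul.
Qed.

Lemma valid_invariant g x : G g -> A x -> A (act g x).
Proof. by case: valid => _ _ _ [[-> _]|[_ /translated]] //; apply. Qed.

Lemma valid_convex x y z : A x -> A y -> geod x y z -> A z.
Proof.
by case: valid => _ _ _ [[-> _]|[sA _]] //; apply: subtree_convex.
Qed.

Let contains_path_domain : realise A = \bigcup_(g in G)
   (pact g @` (closure pd `&` realise setT)) -> pd `<=` realise A.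
Proof.
move=> -> f pf; exists 1%g; first by case: (gen2_subgroup X Y).
by exists f; [split; [apply: subset_closure|apply: path_domain_realise]|rewrite pact1].
Qed.

Lemma open_path_vpt x y z : in_open_path x y z -> open_path x y (vpt R z).
Proof.
move=> [g n1 n2]; split; first exact: realise_vpt.
have K w : vpt R z = vpt R w -> z = w.
  by move=> e; suff: supp (vpt R w) z; [rewrite supp_vpt|rewrite -e supp_vpt].
by move=> [/K|/K].
Qed.

Lemma valid_centres : exists c c',
  [/\ A c, A c', in_open_path p (act X p) c & in_open_path q (act Y q) c'].
Proof.
have [c gc [c' [gc' _]]] := centre_exists gb.
exists c, c'; split=> //; case: valid => _ _ _ [[-> //]|[_ /contains_path_domain sub]].
  by apply/(realise_vptP R)/sub; left; left; apply: open_path_vpt.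
by apply/(realise_vptP R)/sub; left; right; apply: open_path_vpt.
Qed.

(** The translates of c by large powers of g and g^-1 are in A by invariance, and convexity supplies
    the axis between them. *)
Lemma invariant_axis g c : translates T g -> G g -> axis T g c -> A c -> axis T g `<=` A.
Proof.
move=> tg Gg gc Ac x gx.
have AX h n : G h -> A (act (h ^+ n)%g c).
  move=> Gh; elim: n => [|n IH]; first by rewrite expg0 act_one.
  by rewrite expgS act_mul; apply: valid_invariant.
have := axis_geod treeT tg gc gx (leqnn _); apply: valid_convex; last exact: AX.
by apply: AX; apply: (subgroupV (gen2_subgroup X Y)).
Qed.

Lemma valid_axes : axis T X `<=` A /\ axis T Y `<=` A.
Proof.
have [c [c' [Ac Ac' [gc _ _] [gc' _ _]]]] := valid_centres.
have [Xp Yq _ _] := gb; split.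
  apply: (invariant_axis tX (@gen2_l _ X Y) _ Ac).
  exact: (axis_convex treeT tX Xp (axis_act treeT Xp) gc).
apply: (invariant_axis tY (@gen2_r _ X Y) _ Ac').
exact: (axis_convex treeT tY Yq (axis_act treeT Yq) gc').
Qed.

Lemma valid_half l : dhalf dd l = A `&` half_at l.
Proof.
have [Xp Yq _ _] := gb; have [aX aY] := valid_axes.
case: valid => _ [hXp hXm] [hYp hYm] _; have cA := valid_convex.
case: l => -[] []; rewrite /dhalf /=.
- by apply: (half_treeE treeT (translatesV treeT tY) _ cA _ hYm); rewrite axisV.
- by apply: (half_treeE treeT tY _ cA aY hYp); apply: axis_act.
- by apply: (half_treeE treeT (translatesV treeT tX) _ cA _ hXm); rewrite axisV.
- by apply: (half_treeE treeT tX _ cA aX hXp); apply: axis_act.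
Qed.

(** For T itself this is part of validity. For a subtree, [path_domain] is contained in the domain,
    so the covering by translates of the closure of the former passes to the latter. *)
Lemma valid_fundamental : is_fundamental_domain G (realise A) dom.
Proof.
case: (valid) => _ _ _ [[-> //]|[_ e]].
apply: (domain_fundamental treeT tX tY gb valid_half valid_invariant).
move=> f; rewrite e => -[g Gg [f' [cf rf] <-]]; exists g, f'; split=> //.
  move: cf; apply: closureS => h ph; apply/(domainP valid_half).
  by split; [apply: contains_path_domain|move=> l; apply: path_domain_nonhalf].
exists 1%g; first by case: (gen2_subgroup X Y).
by exists f'; rewrite ?pact1.
Qed.

Lemma valid_domain_vertex : exists z, in_domain R dd z.
Proof.
have [c [_ [Ac _ gc _]]] := valid_centres; exists c.
apply/(in_domainP R valid_half); split=> //.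
exact: (open_path_inner_l treeT tX tY gb gc).
Qed.

End ValidDomain.

(** * Base points at midpoints of edges *)

(* In a bipartite tree whose vertices of one kind (the midpoints) all have    *)
(* at most two neighbours, the base points can be taken to be midpoints.      *)
Section Midpoints.
Variables (R : realType) (H : groupType) (T : gtree H).
Hypothesis treeT : is_tree T.
Variable mid : T -> bool.
Hypothesis mid_adj : forall x y : T, gadj x y -> mid y = ~~ mid x.
Hypothesis mid_act : forall g (x : T), mid (act g x) = mid x.
Hypothesis mid_deg : forall x a b c : T, mid x ->
  gadj x a -> gadj x b -> gadj x c -> [\/ a = b, b = c | a = c].
Implicit Types (x y z u v w : T) (l : letter) (g : H).
Local Notation d := (@dist T).
Let symT := tree_sym treeT.
Let connT := tree_conn treeT.
Let S := dist_sym symT connT.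
Let tri := dist_triangle connT.
Let fourp := four_point treeT.

Lemma mid_dist x y : mid y = mid x (+) odd (d x y).
Proof.
move E: (d x y) => n; elim: n x E => [|n IH] x; first by move=> /(dist0_eq connT) ->; rewrite addbF.
by move=> /(dist_step connT) [z /mid_adj xz /IH ->]; rewrite xz /=; case: (mid x); case: (odd n).
Qed.

Lemma tlen_even g : translates T g -> exists n, tlen T g = n.*2.
Proof.
move=> [g0 _]; have [x] : exists x, axis T g x.
  rewrite /tlen /least in g0; move: g0; case: xgetP => // n _ [[x _] _] _.
  exact: (tlen_attained g x).
rewrite /axis /= => e; have := mid_dist x (act g x); rewrite mid_act e.
case E : (odd _); first by case: (mid x).
by move=> _; exists (tlen T g)./2; rewrite -[LHS]odd_double_half E.
Qed.

Section OneIsometry.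
Variable g : H.
Hypothesis tg : translates T g.
Local Notation ax := (axis T g).
Local Notation L := (tlen T g).

Lemma tlen_ge2 : 2 <= L.
Proof. by have [n e] := tlen_even tg; move: (tg.1); lia. Qed.

Lemma axis_neighbours x : ax x -> exists a b, [/\ gadj x a, gadj x b, a <> b, ax a & ax b].
Proof.
move=> gx; have L2 := tlen_ge2; have eX : d x (act g x) = L := gx.
have eV : d x (act g^-1%g x) = L by rewrite (act_distV treeT).
have [n en] : exists n, L = n.+1 by exists L.-1; lia.
have [a xa da] := dist_step connT (etrans eX en).
have [b xb db] := dist_step connT (etrans eV en).
have /(dist_adj treeT) ea := xa; have /(dist_adj treeT) eb := xb.
exists a, b; split=> //.
- move=> e; subst b; have := tg.2 _ (axis_actV treeT gx); rewrite actVK.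
  by have := tri a (act g^-1%g x) (act g x); rewrite (S _ a); lia.
- apply: (axis_convex treeT tg gx (axis_act treeT gx)); rewrite /geod /=; lia.
- apply: (axis_convex treeT tg gx (axis_actV treeT gx)); rewrite /geod /=; lia.
Qed.

(** The axis already uses two neighbours of x, and a midpoint has no others. *)
Lemma mid_axis x y : mid x -> ax x -> gadj x y -> ax y.
Proof.
move=> mx gx xy; have [a [b [xa xb ab ga gb]]] := axis_neighbours gx.
by have [//|<-|<-] := mid_deg mx xa xb xy.
Qed.

(** After exchanging u and v if necessary, g translates from u towards v. Then p is the neighbour of
    u on the opposite side. *)
Lemma mid_basepoint u v : ax u -> ax v -> ~~ mid u -> ~~ mid v -> d u v < L ->
  exists p, [/\ ax p, mid p & forall x, geod u v x -> in_open_path p (act g p) x].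
Proof.
suff K u' v' : ax u' -> ax v' -> ~~ mid u' -> ~~ mid v' -> d u' v' < L ->
  geod u' (act g u') v' -> exists p, [/\ ax p, mid p &
     forall x, geod u' v' x -> in_open_path p (act g p) x].
  move=> gu gv mu mv lt; have [h|h] := axis_side treeT tg gu gv (ltnW lt).
    exact: K h.
  have [||p [gp mp hp]] := K v u gv gu mv mu; first by rewrite S.
    have h1 : d u (act g^-1%g u) = L by rewrite (act_distV treeT).
    have h2 : d v (act g v) = L := gv.
    have h3 := act_dist treeT g v (act g^-1%g u); rewrite actVK in h3.
    move: h; rewrite /geod /= h1 h2; move: (S u v) (S u (act g v)); lia.
  exists p; split=> // x hx; apply: hp; exact: (geod_sym symT connT).
move=> {u v} gu gv mu mv lt h.
have [k ek] := tlen_even tg.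
(* Both L and the distance between two non-midpoints are even, so the strict inequality leaves a gap
   of two: one edge before [u'], and at least one between [v'] and gp. *)
have par := mid_dist u' v'; have le : d u' v' + 2 <= L.
  move: par mu mv; case: (mid u'); case: (mid v') => //=.
  have := odd_double_half (d u' v'); case: (odd _) => //=; lia.
have eV : d u' (act g^-1%g u') = L by rewrite (act_distV treeT).
have [n en] : exists n, L = n.+1 by exists L.-1; lia.
have [p up dp] := dist_step connT (etrans eV en).
have /(dist_adj treeT) e1 := up.
have gp : ax p.
  by apply: (axis_convex treeT tg gu (axis_actV treeT gu)); rewrite /geod /=; lia.
exists p; split=> //; first by rewrite (mid_adj up) (negbTE mu).
have eX : d u' (act g u') = L := gu; have eP : d p (act g p) = L := gp.
have h1 : d (act g u') (act g p) = 1 by rewrite (act_dist treeT).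
have h2 : d u' (act g p) = n.
  by rewrite -[d _ _](act_dist treeT g^-1%g) actK S.
move=> x; rewrite /in_open_path /geod /= => hx.
move: h; rewrite /geod /= => h.
have := fourp v' (act g p) u' (act g u').
have := fourp u' (act g u') v' (act g p).
have := tri v' x (act g p); have := tri u' p x; have := tri x p (act g p).
have := tri x u' (act g p).
move: (S p u') (S u' x) (S (act g p) x) (S (act g p) (act g u')) (S v' u') (S (act g u') v') (S (act g p) u') (S (act g p) v').
move=> *; have [i1 i2 i3] : [/\ d p x = 1 + d u' x, d x (act g p) = n - d u' x & d u' x + 1 <= n] by split; lia.
split; first by lia.
- by move=> e; move: i1; rewrite e distxx; lia.
- by move=> e; move: i3; rewrite e; lia.
Qed.

End OneIsometry.

(** If p' were a midpoint, the next vertex of the bridge would still be on the axis of X, and the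
    bridge could be shortened. *)
Lemma bridge_end X Y (p' q' : T) : translates T X -> axis T X `&` axis T Y = set0 -> is_bridge X Y p' q' ->
  ~~ mid p'.
Proof.
move=> tX dis [Xp Yq m]; apply/negP => mp.
case E : (d p' q') => [|n].
  suff: (axis T X `&` axis T Y) p' by rewrite dis.
  by split=> //; rewrite (dist0_eq connT E).
have [w pw dw] := dist_step connT E.
by have := m _ _ (mid_axis tX mp Xp pw) Yq; rewrite E dw; lia.
Qed.

Section Pair.
Variables X Y : H.
Hypothesis red : reduced_pair T X Y.
Hypotheses (tX : translates T X) (tY : translates T Y).

(** At a midpoint both neighbours would belong to both axes, hence to the overlap, but only one
    neighbour of u leads towards v. *)
Lemma overlap_end u v : axis T X `&` axis T Y = geod u v -> ~~ mid u.
Proof.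
move=> e; apply/negP => mu.
have [Xu Yu] : (axis T X `&` axis T Y) u by rewrite e; apply: geod_left.
have [a [b [ua ub ab Xa Xb]]] := axis_neighbours tX Xu.
have Ya := mid_axis tY mu Yu ua; have Yb := mid_axis tY mu Yu ub.
have : (axis T X `&` axis T Y) a by []. have : (axis T X `&` axis T Y) b by [].
rewrite e /geod /= => hb ha; apply: ab.
move: (ua) (ub) => /(dist_adj treeT) e1 /(dist_adj treeT) e2.
by apply: (descent_unique treeT (r := v) ua ub); move: (S v a) (S v b) (S v u); lia.
Qed.

(** The additional vertex c will be z'; as it is not a midpoint, neither is any C z'. *)
Lemma mid_basepoints (x0 : T) : exists p q, [/\ good_basepoints X Y p q, mid p, mid q &
  exists2 c, in_open_path p (act X p) c & ~~ mid c].
Proof.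
have [dis|[u [v [e lt]]]] := red.2.2.
  have [p' [q' br]] := bridge_exists X Y x0; have [Xp Yq _] := br.
  have mp := bridge_end tX dis br.
  have mq : ~~ mid q'.
    by apply: (bridge_end tY _ (bridge_sym treeT br)); rewrite setIC.
  (* For disjoint axes the segment to be enclosed is the single point p', of length 0 < l(X). *)
  have [p [gp mp' hp]] := mid_basepoint tX Xp Xp mp mp (eq_ind_r (fun n => n < _) (tX.1) (distxx p')).
  have [q [gq mq' hq]] := mid_basepoint tY Yq Yq mq mq (eq_ind_r (fun n => n < _) (tY.1) (distxx q')).
  have ip := hp p' (geod_left _ _); have iq := hq q' (geod_left _ _).
  exists p, q; split=> //; last by exists p'.
  split=> // [_ p1 q1 br1|x Xx Yx].
    by have [-> ->] := bridge_unique treeT tX tY dis br br1.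
  by suff: (axis T X `&` axis T Y) x by rewrite dis.
move: lt; rewrite leq_min => /andP[ltX ltY].
have [Xu Yu] : (axis T X `&` axis T Y) u by rewrite e; apply: geod_left.
have [Xv Yv] : (axis T X `&` axis T Y) v by rewrite e; apply: geod_right.
have mu := overlap_end e.
have mv : ~~ mid v.
  apply: (@overlap_end v u); rewrite e; apply/seteqP.
  by split=> x; apply: (geod_sym symT connT).
have [p [gp mp hp]] := mid_basepoint tX Xu Xv mu mv ltX.
have [q [gq mq hq]] := mid_basepoint tY Yu Yv mu mv ltY.
exists p, q; split=> //; last by exists u => //; apply/hp/geod_left.
split=> // [dis|x Xx Yx].
  by have : (axis T X `&` axis T Y) u by []; rewrite dis.
have gx : geod u v x by rewrite -e.
by split; [apply: hp|apply: hq].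
Qed.

Section Construction.
Variables p q : T.
Hypothesis gb : good_basepoints X Y p q.
Hypotheses (mp : mid p) (mq : mid q).
Local Notation ev := (letter_eval X Y).
Local Notation tip := (tip X Y p q).
Local Notation half_at := (half_at X Y p q).
Local Notation core := (core X Y p q).
Local Notation inner := (inner X Y p q).

Definition mid_data : domain_data T := DomainData p q setT
  (half_at (false, false)) (half_at (false, true))
  (half_at (true, false)) (half_at (true, true)).

Lemma mid_tip l : mid (tip l).
Proof. by case: l => -[] []; rewrite /tip /= ?mid_act. Qed.

Lemma tip_neighbour l : exists n, [/\ gadj (tip l) n, inner n &
  d n (tip (letterV l)) < d (tip l) (tip (letterV l))].
Proof.
have L2 : 2 <= d (tip l) (tip (letterV l)).
  rewrite -tip_actV (act_distV treeT).
  exact: leq_trans (tlen_ge2 (letter_translates treeT tX tY l)) (tlen_le _ _).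
have [n en] : exists n, d (tip l) (tip (letterV l)) = n.+1.
  by exists (d (tip l) (tip (letterV l))).-1; lia.
have [w tw dw] := dist_step connT en; exists w; split=> //; last by lia.
have /(dist_adj treeT) e1 := tw.
have gw : geod (tip l) (tip (letterV l)) w by rewrite /geod /=; lia.
have n1 : w <> tip l by move=> e; move: e1; rewrite e distxx.
have n2 : w <> tip (letterV l) by move=> e; move: dw; rewrite e distxx; lia.
apply: (path_inner treeT tX tY gb (i := l.1)).
  by case: (l) gw => i [] //= /(geod_sym symT connT).
by move=> e; case: (l) n1 n2 => i e' /=; case: e; case: e'.
Qed.

Lemma mid_half l : dhalf mid_data l = dS mid_data `&` half_at l.
Proof. by rewrite /= setTI; case: l => -[] []. Qed.

Section TipNeighbours.
Variable tip_inn : letter -> T.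
Hypothesis tip_innP : forall l, [/\ gadj (tip l) (tip_inn l), inner (tip_inn l) &
  d (tip_inn l) (tip (letterV l)) < d (tip l) (tip (letterV l))].

(** The midpoint [tip l] has one neighbour inside the domain and one across; the path to x cannot
    start with the former, so it starts with the latter. *)
Lemma tip_no_branch l x : half_at l x -> x <> tip l ->
  d x (tip l) = (d x (act (ev l) (tip_inn (letterV l)))).+1.
Proof.
move=> hx nx; have [ti ii li] := tip_innP l.
have [ti' ii' _] := tip_innP (letterV l).
set a := act _ _.
have ta : gadj (tip l) a by rewrite -[tip l]tip_act; apply: act_adj.
have ha : half_at l a by apply: half_at_act => // /ii'.
have [n en] : exists n, d (tip l) x = n.+1.
  case E : (d (tip l) x) => [|n]; last by exists n.
  by case: nx; rewrite (dist0_eq connT E).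
have [c tc dc] := dist_step connT en.
have nc : tip_inn l <> c.
  move=> e; move: hx; rewrite half_atE /=.
  have := tri (tip_inn l) x (tip (letterV l)); move: li; rewrite e.
  move: (S x c) (S x (tip l)); lia.
have na : a <> tip_inn l by move=> e; apply: (ii l); rewrite -e.
have [//|//|e] := mid_deg (mid_tip l) ta ti tc.
by rewrite e S en (S x) dc.
Qed.

Lemma mid_fundamental : is_fundamental_domain (gen2 X Y) (realise setT)
  (domain R mid_data).
Proof.
apply: (domain_fundamental (dd := mid_data) treeT tX tY gb mid_half) => // f rf.
have [x [y [_ _ xy sf]]] := realise_supp rf.
have [|s [x' [y' [cx cy ex ey]]]] := cover treeT tX tY gb _ tip_no_branch xy.
  by move=> l; case: (tip_innP l) => _ /inner_core.
pose g := seq_eval X Y s; pose f' := pact g^-1%g f.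
have rf' : realise setT f' by apply: (realise_sub _ (realise_pact g^-1%g rf)).
have ef : f = pact g f' by rewrite /f' -pact_mul mulgV pact1.
have sf' : supp f' `<=` core.
  rewrite /f' supp_pact sf ex ey => _ [z [->|->] <-]; by rewrite actK.
exists g, f'; split=> //; first exact: seq_eval_gen2.
have [Df|nDf] := pselect (domain R mid_data f'); first exact: subset_closure.
(* A point of the core outside the domain has its whole support in one half tree, so it is a tip,
   the limit of points of D along the edge to [tip_inn l]. *)
have [l hl] : exists l, supp f' `<=` half_at l.
  apply: contrapT => none; apply: nDf; apply/(domainP mid_half); split=> // l hl.
  by apply: none; exists l.
have -> : f' = vpt R (tip l).
  by apply: realise_supp1 => // z fz; apply: sf' => //; apply: hl.
have [ti ii _] := tip_innP l.
apply: (@closure_seg _ _ _ _ _ (tip_inn l)) => t t01; apply/(domainP mid_half).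
split=> [|l']; last by rewrite supp_seg // => /(_ _ (or_intror erefl)) /ii.
by apply: realise_seg => //; [right|case/andP: t01 => h1 h2; rewrite !Order.POrderTheory.ltW].
Qed.

(** A translate of the core covers z, and z is not a translate of a tip because these are all
    midpoints. *)
Lemma mid_cover z : ~~ mid z -> exists g k,
  [/\ gen2 X Y g, in_domain R mid_data k & z = act g k].
Proof.
move=> mz; have [|s [k [_ [ck _ ez _]]]] := cover treeT tX tY gb _ tip_no_branch (or_introl (erefl z)).
  by move=> l; case: (tip_innP l) => _ /inner_core.
exists (seq_eval X Y s), k; split=> //; first exact: seq_eval_gen2.
apply/(in_domainP R mid_half); split=> //.
have [//|[l e]] := core_dichotomy ck.
by move: mz; rewrite ez mid_act e mid_tip.
Qed.

End TipNeighbours.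

Lemma mid_valid : valid_domain R (gen2 X Y) X Y mid_data.
Proof.
have [Xp Yq _ _] := gb.
have K g r : translates T g -> axis T g r -> is_half_tree setT g r (half g r).
  by move=> tg ar; rewrite -[half g r]setTI; apply: half_is_half_tree.
split=> //.
- split; first by apply: K => //; apply: axis_act.
  by apply: K; [apply: translatesV|rewrite axisV].
- split; first by apply: K => //; apply: axis_act.
  by apply: K; [apply: translatesV|rewrite axisV].
- by left; split=> //; have [inn innP] := choice tip_neighbour; apply: mid_fundamental innP.
Qed.

End Construction.

Lemma mid_domain (x0 : T) : exists dd : domain_data T,
  valid_domain R (gen2 X Y) X Y dd /\
  exists z', [/\ in_domain R dd z', ~~ mid z' &
    forall z, ~~ mid z -> exists g k,
      [/\ gen2 X Y g, in_domain R dd k & z = act g k]].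
Proof.
have [p [q [gb mp mq [c ic mc]]]] := mid_basepoints x0.
exists (mid_data p q); split; first exact: mid_valid.
have [inn innP] := choice (tip_neighbour gb mp mq).
exists c; split=> //; last by move=> z; apply: (mid_cover gb mp mq innP).
apply/(in_domainP R (mid_half p q)); split=> //.
exact: (open_path_inner_l treeT tX tY gb ic).
Qed.

End Pair.

End Midpoints.

(** * Subdivision *)

Definition acts_freely (H : groupType) (T : gtree H) (G : set H) : Prop :=
  forall g (x : T), G g -> act g x = x -> g = 1%g.

Lemma set2_eq (V : Type) (x y u v : V) : [set x; y] = [set u; v] ->
  (x = u /\ y = v) \/ (x = v /\ y = u).
Proof.
move=> e; have : [set u; v] x by rewrite -e; left.
have : [set u; v] y by rewrite -e; right.
have : [set x; y] u by rewrite e; left.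
have : [set x; y] v by rewrite e; right.
by move=> [?|?] [?|?] [?|?] [?|?]; subst; auto.
Qed.

(** A zero translation length would give a fixed vertex of g, and an inverted edge a fixed vertex of
    g^2; both are excluded for nontrivial g. *)
Lemma free_translates (H : groupType) (T : gtree H) (G : set H) (x0 : T) g :
  is_tree T -> is_subgroup G -> acts_freely T G ->
  (forall h, G h -> (h * h = 1)%g -> h = 1%g) -> G g -> g <> 1%g -> translates T g.
Proof.
move=> treeT sG free tf Gg g1; apply: (hyperbolic_translates treeT).
  rewrite /hyperbolic lt0n; apply/eqP => e; have [x] := tlen_attained g x0.
  rewrite /axis /= e => /(dist0_eq (tree_conn treeT)) /esym /(free _ _ Gg) //.
by move=> x; rewrite -act_mul => /(free _ _ (subgroupM sG Gg Gg)) /(tf _ Gg).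
Qed.

Section SubdivisionTree.
Variables (H : groupType) (T : gtree H).
Hypothesis treeT : is_tree T.
Implicit Types (x y z r u v : T).
Local Notation d := (@dist T).
Local Notation W := (subdiv T).
Implicit Types (s t : W).
Let symT := tree_sym treeT.
Let connT := tree_conn treeT.
Let S := dist_sym symT connT.

Lemma simplex_pt x : simplex [set x : T].
Proof. by exists x, x; split; [left|rewrite setUid]. Qed.

Definition pt x : W := exist _ [set x] (simplex_pt x).

Lemma simplex_edge x y : gadj x y -> simplex [set x; y].
Proof. by move=> xy; exists x, y; split; [right|]. Qed.

Definition edge x y (xy : gadj x y) : W := exist _ [set x; y] (simplex_edge xy).

Lemma subdiv_eq s t : sval s = sval t -> s = t.
Proof. by move: s t => [s hs] [t ht] /= e; apply: eq_exist. Qed.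

Lemma gadj_neq x y : gadj x y -> x <> y.
Proof. by move=> xy e; apply: (tree_irr treeT (x := x)); rewrite {2}e. Qed.

Lemma subdiv_symP s t : gadj s t -> gadj t s.
Proof. by case; [right|left]. Qed.

Lemma face_proper s t : sval s `<` sval t ->
  exists x y, [/\ gadj x y, sval s = [set x] & sval t = [set x; y]].
Proof.
move: s t => [s [a [b [_ es]]]] [t [u [v [uv et]]]] /= [st nts]; rewrite es et in st nts *.
have [sa sb] : [set u; v] a /\ [set u; v] b by split; apply: st; [left|right].
have ab : a = b.
  apply: contrapT => ne; apply: nts; move: sa sb ne => [->|->] [->|->] // _ z [] ->; by [left|right].
subst b; rewrite setUid in nts *.
case: uv => [e|uv]; first by subst v; case: nts; rewrite setUid; case: sa => ->.
case: sa => ->; first by exists u, v.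
by exists v, u; split=> //; [apply: symT|rewrite setUC].
Qed.

Lemma subdiv_adjP s t : gadj s t -> exists x y, gadj x y /\
  (sval s = [set x] /\ sval t = [set x; y] \/ sval t = [set x] /\ sval s = [set x; y]).
Proof.
by case=> /face_proper [x [y [xy es et]]]; exists x, y; split=> //; [left|right].
Qed.

Lemma pt_edge_adj x y (xy : gadj x y) : gadj (pt x) (edge xy).
Proof.
left; split; first by move=> _ ->; left.
by move=> /(_ y (or_intror erefl)) e; apply: (gadj_neq xy).
Qed.

Section Height.
Variable r : T.

(** A vertex counts as a degenerate edge, so heights are even at vertices and odd at midpoints. The
    height turns out to be the distance from [pt r] in the subdivision. *)
Definition height s : nat :=
  xget 0 [set n | exists x y, sval s = [set x; y] /\ n = d r x + d r y].

Lemma heightE s x y : sval s = [set x; y] -> height s = d r x + d r y.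
Proof.
move=> e; rewrite /height; case: xgetP => [n _ [u [v [e' ->]]]|none].
  by case: (set2_eq (etrans (esym e') e)) => -[-> ->] //; rewrite addnC.
by case: (none (d r x + d r y)); exists x, y.
Qed.

Lemma height1 s x : sval s = [set x] -> height s = (d r x).*2.
Proof. by move=> e; rewrite (@heightE s x x) ?setUid // addnn. Qed.

Lemma height_root s : height s = 0 <-> s = pt r.
Proof.
split=> [|->]; last by rewrite (@height1 _ r) // distxx.
have [x [y [_ e]]] := svalP s; rewrite (heightE e) => h.
apply: subdiv_eq; rewrite e /=; have -> : x = r by apply/esym/(dist0_eq connT); lia.
have -> : y = r by apply/esym/(dist0_eq connT); lia.
exact: setUid.
Qed.

Lemma height_adj s t : gadj s t -> height s = (height t).+1 \/ height t = (height s).+1.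
Proof.
move=> /subdiv_adjP [x [y [xy [[e1 e2]|[e1 e2]]]]];
  rewrite (height1 e1) (heightE e2); have := dist_adj_cases treeT r xy; lia.
Qed.

Lemma height_down s : 0 < height s -> exists2 t, gadj s t & height t < height s.
Proof.
have [x [y [xy e]]] := svalP s; rewrite (heightE e) => h.
case: xy => [exy|xy].
  subst y; rewrite setUid in e.
  have [n en] : exists n, d x r = n.+1 by exists (d x r).-1; rewrite S; lia.
  have [z xz dz] := dist_step connT en; exists (edge xz).
    have -> : s = pt x by apply: subdiv_eq.
    exact: pt_edge_adj.
  rewrite (@heightE _ x z) //; move: (S x r) (S z r); lia.
have ex : s = edge xy by apply: subdiv_eq.
have ey : s = edge (symT xy) by apply: subdiv_eq; rewrite e /= setUC.
case: (dist_adj_cases treeT r xy) => lt.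
  exists (pt y); first by rewrite ey; apply/subdiv_symP/pt_edge_adj.
  rewrite (@height1 _ y) //; lia.
exists (pt x); first by rewrite ex; apply/subdiv_symP/pt_edge_adj.
rewrite (@height1 _ x) //; lia.
Qed.

Lemma height_uniq s t t' : gadj s t -> gadj s t' ->
  height t < height s -> height t' < height s -> t = t'.
Proof.
have nse (a b c : T) : gadj a b -> [set a; b] = [set c] -> False.
  move=> ab; have ne := @gadj_neq a b ab; rewrite -(setUid [set c]).
  by move=> h; case: (set2_eq h) => -[ea eb]; apply: ne; congruence.
move=> /subdiv_adjP [x [y [xy h]]] /subdiv_adjP [u [v [uv h']]].
case: h h' => [[e1 e2]|[e1 e2]] [[e3 e4]|[e3 e4]].
- have ux : u = x by move: e3; rewrite e1 => /seteqP [/(_ x erefl)].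
  subst u; rewrite (heightE e2) (height1 e1) (heightE e4) => l1 l2.
  apply: subdiv_eq; rewrite e2 e4; congr [set _; _].
  by apply: (descent_unique treeT (r := r) xy uv); lia.
- by move: e4; rewrite e1 => /esym /(nse _ _ _ uv).
- by move: e2; rewrite e3 => /esym /(nse _ _ _ xy).
- rewrite (height1 e1) (height1 e3) (heightE e2) => l1 l2; apply: subdiv_eq; rewrite e1 e3.
  move: e4 l1 l2; rewrite e2 => /(@set2_eq _ _ _ _ _) [[-> _] //|[-> <-]].
  have := dist_adj_cases treeT r xy; lia.
Qed.

Lemma subdiv_dist s x y : sval s = [set x; y] -> dist (pt r) s = d r x + d r y.
Proof.
move=> e; rewrite -(heightE e).
exact: (rooted_dist subdiv_symP height_root height_adj height_down).
Qed.

Lemma subdiv_tree_at : is_tree W.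
Proof.
exact: (rooted_tree subdiv_symP height_root height_adj height_down height_uniq).
Qed.

End Height.

Lemma subdiv_tree : is_tree W.
Proof.
have [[r _]|none] := pselect (exists x : T, True); first exact: (subdiv_tree_at r).
have nW s : False by have [x _] := svalP s; apply: none; exists x.
by split=> [x|x|x|[n [c _]]]; case: (nW _); [exact: x|exact: x|exact: x|exact: (c 0)].
Qed.

Definition mid s : bool := `[< ~ exists x, sval s = [set x] >].

Lemma mid_edge s x y : gadj x y -> sval s = [set x; y] -> mid s.
Proof.
move=> xy e; apply/asboolP => -[z]; rewrite e -(setUid [set z]) => /(@set2_eq _ _ _ _ _) h.
by apply: (gadj_neq xy); case: h => -[-> ->].
Qed.

Lemma mid_pt s x : sval s = [set x] -> ~~ mid s.
Proof. by move=> e; apply/asboolPn => h; apply: h; exists x. Qed.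

Lemma mid_adj s t : gadj s t -> mid t = ~~ mid s.
Proof.
move=> /subdiv_adjP [x [y [xy [[e1 e2]|[e1 e2]]]]].
  by rewrite (mid_edge xy e2) (mid_pt e1).
by rewrite (mid_edge xy e2) (negbTE (mid_pt e1)).
Qed.

Lemma mid_act g s : mid (act g s) = mid s.
Proof.
apply: asbool_equiv_eq; apply: not_iff_compat; split=> -[x e]; last first.
  by exists (act g x); rewrite /= e image_set1.
exists (act g^-1%g x).
have -> : sval s = act g^-1%g @` sval (act g s).
  by rewrite /= image_comp (_ : _ \o _ = id) ?image_id //; apply/funext => z /=; rewrite actK.
by rewrite e image_set1.
Qed.

Lemma mid_deg s a b c : mid s -> gadj s a -> gadj s b -> gadj s c ->
  [\/ a = b, b = c | a = c].
Proof.
have [x [y [_ e]]] := svalP s => ms.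
have K t : gadj s t -> t = pt x \/ t = pt y.
  move=> /subdiv_adjP [u [v [uv [[e1 _]|[e1 e2]]]]]; first by move: (mid_pt e1); rewrite ms.
  by move: e2; rewrite e => /(@set2_eq _ _ _ _ _) [[eu _]|[_ eu]]; [left|right]; apply: subdiv_eq; rewrite e1 eu.
move=> /K [->|->] /K [->|->] /K [->|->]; by [constructor 1|constructor 2|constructor 3].
Qed.

(** An element fixing a midpoint fixes the two ends of the edge or exchanges them; in the latter
    case its square fixes a vertex, so it is an involution. *)
Lemma subdiv_free (G : set H) : is_subgroup G -> acts_freely T G ->
  (forall h, G h -> (h * h = 1)%g -> h = 1%g) -> acts_freely W G.
Proof.
move=> sG free tf g s Gg e; have [x [y [_ es]]] := svalP s.
have : sval (act g s) = sval s by rewrite e.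
rewrite /= es image_setU !image_set1 => /(@set2_eq _ _ _ _ _) [[/free h _]|[h1 h2]]; first exact: h.
apply: tf => //; apply: (free _ x); first exact: subgroupM.
by rewrite act_mul h1.
Qed.

(** The point to check is that midpoints do not do better. From the midpoint of uv, the path to its
    image starts at an end, say u, and then has length d(u, gu) + d(u, gv), where the two terms are
    at least l(g) and l(g) - 1. *)
Lemma subdiv_tlen g (x0 : T) : (forall x, act g (act g x) <> x) ->
  tlen W g = 2 * tlen T g.
Proof.
move=> ninv; have [x ax] := tlen_attained g x0.
have treeW := subdiv_tree; have connW := tree_conn treeW.
apply: least_eq.
  exists (pt x); rewrite (@subdiv_dist x _ (act g x) (act g x)) ?ax; first by lia.
  by rewrite /= image_set1 setUid.
move=> _ [s ->]; have [u [v [uv es]]] := svalP s.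
have egs : sval (act g s) = [set act g u; act g v] by rewrite /= es image_setU !image_set1.
case: uv => [e|uv].
  subst v; rewrite setUid in es egs; have -> : s = pt u by apply: subdiv_eq.
  rewrite (@subdiv_dist u _ (act g u) (act g u)); first by have := tlen_le g u; lia.
  by rewrite /= image_set1 setUid.
case E: (dist s (act g s)) => [|n].
  have := dist0_eq connW E => e; move: egs; rewrite -e es => /(@set2_eq _ _ _ _ _) [[h _]|[h1 h2]].
    by case: (ninv u); rewrite -!h.
  by case: (ninv u); rewrite -h2 -h1.
have [t st dt] := dist_step connW E.
have [a [at_ ta]] : exists a, (a = u \/ a = v) /\ t = pt a.
  have := subdiv_adjP st => -[a [b [ab [[e1 _]|[e1 e2]]]]].
    by have := mid_pt e1; rewrite (mid_edge uv es).
  exists a; split; last exact: subdiv_eq.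
  by move: e2; rewrite es => /(@set2_eq _ _ _ _ _) [[-> _]|[_ ->]]; [left|right].
rewrite ta (@subdiv_dist a _ _ _ egs) in dt.
have guv : gadj (act g u) (act g v) by apply: act_adj.
have := tlen_le g u; have := tlen_le g v.
have := dist_adj_cases treeT a guv.
case: at_ => ?; subst a; lia.
Qed.

End SubdivisionTree.

(** * Lattices and the Bruhat-Tits tree *)

Section Matrices2.
Local Open Scope ring_scope.
Variable K : fieldType.

Definition mx2 (a b c d : K) : 'M[K]_2 :=
  \matrix_(i, j) if i == 0 then (if j == 0 then a else b) else (if j == 0 then c else d).

Lemma I2P (P : 'I_2 -> Prop) : P 0 -> P 1 -> forall i, P i.
Proof. by move=> P0 P1 [[|[|i]] hi] //; [rewrite (_ : Ordinal hi = 0)|rewrite (_ : Ordinal hi = 1)] => //; apply: val_inj. Qed.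

Lemma mx2P (M : 'M[K]_2) : exists a b c d, M = mx2 a b c d.
Proof.
exists (M 0 0), (M 0 1), (M 1 0), (M 1 1); apply/matrixP => i j; rewrite mxE.
by elim/I2P: i; elim/I2P: j.
Qed.

Lemma mx2_mul a b c d a' b' c' d' : mx2 a b c d *m mx2 a' b' c' d' =
  mx2 (a * a' + b * c') (a * b' + b * d') (c * a' + d * c') (c * b' + d * d').
Proof.
apply/matrixP => i j; rewrite !mxE !big_ord_recl big_ord0 !mxE /= addr0.
by elim/I2P: i; elim/I2P: j.
Qed.

Lemma mx2_scale k a b c d : k *: mx2 a b c d = mx2 (k * a) (k * b) (k * c) (k * d).
Proof.
by apply/matrixP => i j; rewrite !mxE; elim/I2P: i; elim/I2P: j.
Qed.

Lemma mx2_1 : 1%:M = mx2 1 0 0 1.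
Proof. by apply/matrixP => i j; rewrite !mxE; elim/I2P: i; elim/I2P: j. Qed.

Lemma mx2_det a b c d : \det (mx2 a b c d) = a * d - b * c.
Proof.
rewrite (expand_det_row _ 0) !big_ord_recl big_ord0 /cofactor /= !det_mx11 !mxE /=.
by rewrite expr0 expr1; ring.
Qed.

Lemma invmx_mul (M N : 'M[K]_2) : M \in unitmx -> N \in unitmx ->
  invmx (M *m N) = invmx N *m invmx M.
Proof.
move=> uM uN; have uMN : M *m N \in unitmx by rewrite unitmx_mul uM.
by rewrite -[RHS](mulKmx uMN) !mulmxA !mulmxK.
Qed.

Definition cv2 (x y : K) : 'cV[K]_2 := \col_i if i == 0 then x else y.

Lemma cv2P (u : 'cV[K]_2) : exists x y, u = cv2 x y.
Proof.
exists (u 0 0), (u 1 0); apply/matrixP => i j; rewrite mxE (ord1 j).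
by elim/I2P: i.
Qed.

Lemma mx2_cv2 a b c d x y : mx2 a b c d *m cv2 x y = cv2 (a * x + b * y) (c * x + d * y).
Proof.
apply/matrixP => i j; rewrite !mxE !big_ord_recl big_ord0 !mxE /= addr0.
by elim/I2P: i.
Qed.

Lemma cv2_scale k x y : k *: cv2 x y = cv2 (k * x) (k * y).
Proof. by apply/matrixP => i j; rewrite !mxE; elim/I2P: i. Qed.

Lemma cv2_add x y x' y' : cv2 x y + cv2 x' y' = cv2 (x + x') (y + y').
Proof. by apply/matrixP => i j; rewrite !mxE; elim/I2P: i. Qed.

End Matrices2.

Section Valuation.
Local Open Scope ring_scope.
Variables (K : fieldType) (v : K -> int).
Hypothesis lf : is_local_field v.
Implicit Types (x y a b c d : K) (n m : int).
Local Notation "x \in_ n" := (vge v n x) (at level 70).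

Lemma val1 : v 1 = 0.
Proof.
suff: v 1 = v 1 + v 1 by lia.
by rewrite -{1}(mulr1 1) (lf_mul lf) ?oner_neq0.
Qed.

Lemma valV x : x != 0 -> v x^-1 = - v x.
Proof.
move=> x0; have V0 : x^-1 != 0 by rewrite invr_eq0.
by have := lf_mul lf x0 V0; rewrite divff // val1; lia.
Qed.

Lemma valN x : v (- x) = v x.
Proof.
have [->|x0] := eqVneq x 0; first by rewrite oppr0.
have m1 : (-1 : K) != 0 by rewrite oppr_eq0 oner_neq0.
have h : v (-1) = 0.
  suff: v 1 = v (-1) + v (-1) by rewrite val1; lia.
  by rewrite -(lf_mul lf) // mulrNN mulr1.
by rewrite -mulN1r (lf_mul lf) // h add0r.
Qed.

Lemma vge0 n : vge v n 0. Proof. by left. Qed.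

Lemma vge1 : vge v 0 1. Proof. by right; rewrite val1. Qed.

Lemma vgeW n m x : m <= n -> vge v n x -> vge v m x.
Proof. by move=> le [->|h]; [left|right; lia]. Qed.

Lemma vgeN n x : vge v n x -> vge v n (- x).
Proof. by case=> [->|h]; [left; rewrite oppr0|right; rewrite valN]. Qed.

Lemma vgeD n x y : vge v n x -> vge v n y -> vge v n (x + y).
Proof.
case=> [->|hx]; first by rewrite add0r.
case=> [->|hy]; first by rewrite addr0; right.
have [->|x0] := eqVneq x 0; first by rewrite add0r; right.
have [->|y0] := eqVneq y 0; first by rewrite addr0; right.
have [->|s0] := eqVneq (x + y) 0; first by left.
right; apply: le_trans (lf_add lf x0 y0 s0).
by rewrite le_min hx hy.
Qed.

Lemma vgeB n x y : vge v n x -> vge v n y -> vge v n (x - y).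
Proof. by move=> hx hy; apply: vgeD => //; apply: vgeN. Qed.

Lemma vgeM n m x y : vge v n x -> vge v m y -> vge v (n + m) (x * y).
Proof.
case=> [->|hx]; first by rewrite mul0r; left.
case=> [->|hy]; first by rewrite mulr0; left.
have [->|x0] := eqVneq x 0; first by rewrite mul0r; left.
have [->|y0] := eqVneq y 0; first by rewrite mulr0; left.
by right; rewrite (lf_mul lf) //; lia.
Qed.

Lemma vgeM0 x y : vge v 0 x -> vge v 0 y -> vge v 0 (x * y).
Proof. exact: (@vgeM 0 0). Qed.

Lemma vgeM1 x y : vge v 1 x -> vge v 0 y -> vge v 1 (x * y).
Proof. exact: (@vgeM 1 0). Qed.

Lemma vge_unit_inv x : x != 0 -> v x = 0 -> vge v 0 x^-1.
Proof. by move=> x0 e; right; rewrite valV // e. Qed.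

Definition intmx (M : 'M[K]_2) := forall i j, vge v 0 (M i j).

Lemma intmx2 a b c d : intmx (mx2 a b c d) <->
  [/\ vge v 0 a, vge v 0 b, vge v 0 c & vge v 0 d].
Proof.
split=> [h|[ha hb hc hd] i j].
  by split; [have := h 0 0|have := h 0 1|have := h 1 0|have := h 1 1]; rewrite mxE.
by rewrite mxE; elim/I2P: i; elim/I2P: j.
Qed.

Lemma intmxM M N : intmx M -> intmx N -> intmx (M *m N).
Proof.
have [a [b [c [d ->]]]] := mx2P M; have [a' [b' [c' [d' ->]]]] := mx2P N.
rewrite mx2_mul => /intmx2 [? ? ? ?] /intmx2 [? ? ? ?]; apply/intmx2.
by split; apply: vgeD; apply: vgeM0.
Qed.

Lemma intmx1 : intmx 1%:M.
Proof. by rewrite mx2_1; apply/intmx2; split; (exact: vge1 || exact: vge0). Qed.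

(* GL_2 of the valuation ring. *)
Definition GLO (M : 'M[K]_2) := [/\ intmx M, \det M != 0 & v (\det M) = 0].

Lemma GLO_unit M : GLO M -> M \in unitmx.
Proof. by case=> _ d0 _; rewrite unitmxE unitfE. Qed.

Lemma GLOM M N : GLO M -> GLO N -> GLO (M *m N).
Proof.
move=> [iM M0 vM] [iN N0 vN]; split; first exact: intmxM.
  by rewrite det_mulmx mulf_neq0.
by rewrite det_mulmx (lf_mul lf) // vM vN.
Qed.

Lemma GLO1 : GLO 1%:M.
Proof. by split; [exact: intmx1|rewrite det1 oner_neq0|rewrite det1 val1]. Qed.

Lemma mx2_inv a b c d : let D := a * d - b * c in D != 0 ->
  invmx (mx2 a b c d) = mx2 (d / D) (- b / D) (- c / D) (a / D).
Proof.
move=> D D0; set N := mx2 (d / D) _ _ _.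
have e : mx2 a b c d *m N = 1%:M.
  by rewrite mx2_mul mx2_1; congr mx2; rewrite /D; field; exact: D0.
have u : mx2 a b c d \in unitmx by rewrite unitmxE unitfE mx2_det.
by rewrite -[LHS]mulmx1 -e mulKmx.
Qed.

Lemma GLOV M : GLO M -> GLO (invmx M).
Proof.
move=> gM; have [iM M0 vM] := gM; split.
- move: iM M0 vM {gM}; have [a [b [c [d ->]]]] := mx2P M.
  move=> /intmx2 [ha hb hc hd]; rewrite mx2_det => D0 vD; rewrite mx2_inv //.
  have iD := vge_unit_inv D0 vD.
  by apply/intmx2; split; apply: vgeM0 => //; apply: vgeN.
- by rewrite det_inv invr_eq0.
- by rewrite det_inv valV // vM.
Qed.

Lemma GLO_intmx M : M \in unitmx -> intmx M -> intmx (invmx M) -> GLO M.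
Proof.
have det_int N : intmx N -> vge v 0 (\det N).
  have [a [b [c [d ->]]]] := mx2P N; rewrite mx2_det => /intmx2 [? ? ? ?].
  by apply: vgeB; apply: vgeM0.
move=> uM iM iV; have M0 : \det M != 0 by rewrite -unitfE -unitmxE.
split=> //; have := det_int _ iM; have := det_int _ iV; rewrite det_inv.
case=> [/eqP|h1]; first by rewrite invr_eq0 (negbTE M0).
case=> [/eqP|h2]; first by rewrite (negbTE M0).
by rewrite valV // oppr_ge0 in h1; apply/eqP; rewrite eq_le h1.
Qed.

Definition lat (M : 'M[K]_2) : set 'cV[K]_2 :=
  [set M *m x | x in [set x : 'cV[K]_2 | forall i, vge v 0 (x i ord0)]].

Lemma intmx_col M (x : 'cV[K]_2) : intmx M -> (forall i, vge v 0 (x i ord0)) ->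
  forall i, vge v 0 ((M *m x) i ord0).
Proof.
move=> iM ix i; rewrite mxE !big_ord_recl big_ord0 addr0.
by apply: vgeD; apply: vgeM0.
Qed.

Definition intcv (x : 'cV[K]_2) := forall i, vge v 0 (x i ord0).

Lemma intcv2 x y : intcv (cv2 x y) <-> vge v 0 x /\ vge v 0 y.
Proof.
split=> [h|[hx hy] i]; first by split; [have := h 0|have := h 1]; rewrite mxE.
by rewrite mxE; elim/I2P: i.
Qed.

Lemma latP M (x : 'cV[K]_2) : lat M x <-> exists2 z, intcv z & x = M *m z.
Proof. by split=> -[z iz e]; exists z. Qed.

Lemma latD M (x y : 'cV[K]_2) : lat M x -> lat M y -> lat M (x + y).
Proof.
move=> [x' ix <-] [y' iy <-]; exists (x' + y'); last by rewrite mulmxDr.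
by move=> i; rewrite mxE; apply: vgeD.
Qed.

Lemma latZ M a (x : 'cV[K]_2) : vge v 0 a -> lat M x -> lat M (a *: x).
Proof.
move=> ia [x' ix <-]; exists (a *: x'); last by rewrite scalemxAr.
by move=> i; rewrite mxE; apply: vgeM0.
Qed.

Lemma latN M (x : 'cV[K]_2) : lat M x -> lat M (- x).
Proof.
move=> [x' ix <-]; exists (- x'); last by rewrite mulmxN.
by move=> i; rewrite mxE; apply: vgeN.
Qed.

Lemma lat_sub M N : N \in unitmx -> lat M `<=` lat N <-> intmx (invmx N *m M).
Proof.
move=> uN; split=> [sub i j|iNM _ [x ix <-]].
  have e : forall k, vge v 0 ((delta_mx j (@ord0 0) : 'cV[K]_2) k ord0).
    by move=> k; rewrite mxE andbT; case: (_ == _); [exact: vge1|exact: vge0].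
  have [y iy ey] := sub _ (ex_intro2 _ _ _ e erefl).
  have -> : (invmx N *m M) i j = y i ord0; last exact: iy.
  have -> : y = invmx N *m M *m delta_mx j ord0 by rewrite -mulmxA -ey mulKmx.
  by rewrite -colE [RHS]mxE.
by exists (invmx N *m M *m x); [apply: intmx_col|rewrite -mulmxA mulKVmx].
Qed.

Lemma lat_eq M N : M \in unitmx -> N \in unitmx ->
  lat M = lat N <-> exists2 U, GLO U & M = N *m U.
Proof.
move=> uM uN; split=> [/seteqP [/lat_sub h1 /lat_sub h2]|[U gU ->]].
  exists (invmx N *m M); last by rewrite mulKVmx.
  apply: GLO_intmx; rewrite ?unitmx_mul ?unitmx_inv ?uN //; first exact: h1.
  by rewrite invmx_mul ?unitmx_inv // invmxK; apply: h2.
have [iV _ _] := GLOV gU; have [iU _ _] := gU; have uU := GLO_unit gU.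
apply/seteqP; split; apply/lat_sub; rewrite ?unitmx_mul ?uN //.
  by rewrite mulKmx.
by rewrite invmx_mul // -mulmxA mulVmx // mulmx1.
Qed.


(* The homothety classes of the lattices of M and N coincide. *)
Definition simmx (M N : 'M[K]_2) : Prop :=
  exists c U, [/\ c != 0, GLO U & M = c *: (N *m U)].

Lemma simmx_refl M : simmx M M.
Proof. by exists 1, 1%:M; rewrite mulmx1 scale1r oner_neq0; split=> //; apply: GLO1. Qed.

Lemma simmx_sym M N : simmx M N -> simmx N M.
Proof.
move=> [c [U [c0 gU ->]]]; exists c^-1, (invmx U); rewrite invr_eq0; split=> //.
  exact: GLOV.
by rewrite -scalemxAl scalerA mulVf // scale1r mulmxK // GLO_unit.
Qed.

Lemma simmx_trans N M P : simmx M N -> simmx N P -> simmx M P.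
Proof.
move=> [c [U [c0 gU ->]]] [c' [U' [c0' gU' ->]]]; exists (c * c'), (U' *m U).
split; [by rewrite mulf_neq0|exact: GLOM|].
by rewrite -scalemxAl scalerA mulmxA.
Qed.

Lemma simmx_mulr M U : GLO U -> simmx (M *m U) M.
Proof. by move=> gU; exists 1, U; rewrite scale1r oner_neq0. Qed.

Lemma simmx_mull P M N : simmx M N -> simmx (P *m M) (P *m N).
Proof. by move=> [c [U [c0 gU ->]]]; exists c, U; rewrite -scalemxAr mulmxA. Qed.

Lemma simmx_scale c M : c != 0 -> simmx (c *: M) M.
Proof. by move=> c0; exists c, 1%:M; rewrite mulmx1 c0; split=> //; apply: GLO1. Qed.

Definition vtx M (uM : M \in unitmx) : bt_graph v :=
  exist _ (homothety_class (lat M)) (ex_intro2 _ _ (lat M) (ex_intro2 _ _ M uM erefl) erefl).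

Lemma lat_scale c M : [set c *: x | x in lat M] = lat (c *: M).
Proof.
rewrite /lat image_comp; apply: eq_imagel => x _ /=.
by rewrite scalemxAl.
Qed.

Lemma vtx_mem M (uM : M \in unitmx) N : N \in unitmx ->
  sval (vtx uM) (lat N) <-> simmx N M.
Proof.
move=> uN; split=> [[c c0]|[c [U [c0 gU ->]]]] /=.
  rewrite lat_scale => /(@lat_eq _ _ uN) [|U gU ->].
    by rewrite unitmxZ ?unitfE.
  by exists c, U; rewrite -scalemxAl.
exists c => //; rewrite lat_scale; apply/lat_eq.
- by rewrite unitmxZ ?unitfE // unitmx_mul uM GLO_unit.
- by rewrite unitmxZ ?unitfE.
- by exists U; rewrite // scalemxAl.
Qed.

Lemma vtx_eq M N (uM : M \in unitmx) (uN : N \in unitmx) :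
  vtx uM = vtx uN <-> simmx M N.
Proof.
split=> [e|h].
  by apply/(vtx_mem uN uM); rewrite -e; apply/(vtx_mem uM uM)/simmx_refl.
apply: eq_exist => /=; have sub A B (uA : A \in unitmx) (uB : B \in unitmx) : simmx A B ->
   homothety_class (lat A) `<=` homothety_class (lat B).
  move=> h' _ [c c0 ->]; rewrite lat_scale; apply/(vtx_mem uB).
    by rewrite unitmxZ ?unitfE.
  exact: simmx_trans (simmx_scale _ c0) h'.
by apply/seteqP; split; apply: sub => //; apply: simmx_sym.
Qed.

Lemma vtxP (x : bt_graph v) : exists M (uM : M \in unitmx), x = vtx uM.
Proof.
case: x => C hC; have [L [M uM LM] CL] := hC.
by exists M, uM; apply: eq_exist; rewrite CL LM.
Qed.

Lemma vtx_elem M (uM : M \in unitmx) L : sval (vtx uM) L ->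
  exists N, [/\ N \in unitmx, L = lat N & simmx N M].
Proof.
move=> [c c0 ->]; exists (c *: M); rewrite lat_scale unitmxZ ?unitfE //.
by split=> //; apply: simmx_scale.
Qed.

Variable w : K.
Hypotheses (w0 : w != 0) (vw : v w = 1).

Lemma val_pow (n : nat) : v (w ^+ n) = n%:Z.
Proof.
elim: n => [|n IH]; first by rewrite expr0 val1.
by rewrite exprS (lf_mul lf) ?expf_neq0 // vw IH; lia.
Qed.

Lemma vge_div x : vge v 1 x -> vge v 0 (x / w).
Proof.
move=> hx; have [->|x0] := eqVneq x 0; first by rewrite mul0r; left.
case: hx => [/eqP|hx]; first by rewrite (negbTE x0).
by right; rewrite (lf_mul lf) ?invr_eq0 // valV // vw; lia.
Qed.

(* With the vertex of O^2 as root, the vertices at distance n are the classes *)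
(* of N diag(1, w^n) for N in GL_2(O).                                        *)
Definition dmx (n : nat) : 'M[K]_2 := mx2 1 0 0 (w ^+ n).

Lemma dmx_unit (n : nat) : dmx n \in unitmx.
Proof. by rewrite unitmxE unitfE mx2_det mul1r mulr0 subr0 expf_neq0. Qed.

Lemma dmx0 : dmx 0%N = 1%:M.
Proof. by rewrite /dmx mx2_1. Qed.

Lemma dmxM (n : nat) : dmx n *m dmx 1%N = dmx n.+1.
Proof. by rewrite /dmx mx2_mul [in RHS]exprSr expr1; congr mx2; ring. Qed.

Lemma dmxE : dmx 1%N = mx2 1 0 0 w.
Proof. by rewrite /dmx expr1. Qed.

(* The kernel of a surjection (x, y) |-> a x + b y onto the residue field has *)
(* a basis obtained from a basis of O^2 by multiplying its second vector by w. *)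
Lemma kernel_basis a b x0 y0 : vge v 0 a -> vge v 0 b -> vge v 0 x0 -> vge v 0 y0 ->
  vge v 1 (1 - (a * x0 + b * y0)) -> exists2 U, GLO U & forall x y,
  (intcv (cv2 x y) /\ vge v 1 (a * x + b * y) <->
   exists2 z, intcv z & cv2 x y = U *m dmx 1%N *m z).
Proof.
move=> ia ib ix iy h1.
have iw : vge v 0 w by right; rewrite vw.
have vw1 : vge v 1 w by right; rewrite vw.
have n1 : ~ vge v 1 1 by case=> [/eqP|]; [rewrite oner_eq0|rewrite val1].
have unit_or t : vge v 0 t -> vge v 1 t \/ t != 0 /\ v t = 0.
  case=> [->|h]; first by left; left.
  have [->|t0] := eqVneq t 0; first by left; left.
  by have [e|n] := eqVneq (v t) 0; [right|left; right; lia].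
(* One of a and b is a unit, as otherwise w would divide 1 by the hypothesis on x0 and y0. If a is a
   unit, (b, -a) is in the kernel, (1, 0) is not, and together they form a basis. *)
case: (unit_or a ia) => [a1|[a0 va]]; last first.
- exists (mx2 b 1 (- a) 0) => [|x y].
    split; [by apply/intmx2; split=> //; [exact: vge1|exact: vgeN|exact: vge0]| |];
    by rewrite mx2_det mulr0 sub0r mul1r opprK.
  rewrite dmxE mx2_mul; split=> [[/intcv2 [hx hy] h]|[z]].
    exists (cv2 (- y / a) ((a * x + b * y) / w / a)).
      have iV := vge_unit_inv a0 va.
      by apply/intcv2; split; apply: vgeM0 => //; [apply: vgeN|apply: vge_div].
    by rewrite mx2_cv2; congr cv2; field; rewrite ?a0 ?w0.
  have [z1 [z2 ->]] := cv2P z; rewrite mx2_cv2 => /intcv2 [i1 i2] e.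
  have [-> ->] : x = b * z1 + w * z2 /\ y = - a * z1.
    by split; [have /matrixP /(_ 0 0) := e|have /matrixP /(_ 1 0) := e]; rewrite !mxE /= => ->; ring.
  split; first by apply/intcv2; split; [apply: vgeD|]; apply: vgeM0 => //; apply: vgeN.
  rewrite (_ : _ + _ = w * (a * z2)); last by ring.
  by apply: vgeM1 => //; apply: vgeM0.
case: (unit_or b ib) => [b1|[b0 vb]].
  case: n1; rewrite -(subrK (a * x0 + b * y0) 1); apply: vgeD => //.
  by apply: vgeD; apply: vgeM1.
exists (mx2 b 0 (- a) 1) => [|x y].
  split; [by apply/intmx2; split=> //; [exact: vge0|exact: vgeN|exact: vge1]| |];
  by rewrite mx2_det mulr1 mul0r subr0.
rewrite dmxE mx2_mul; split=> [[/intcv2 [hx hy] h]|[z]].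
  exists (cv2 (x / b) ((a * x + b * y) / w / b)).
    have iV := vge_unit_inv b0 vb.
    by apply/intcv2; split; apply: vgeM0 => //; apply: vge_div.
  by rewrite mx2_cv2; congr cv2; field; rewrite ?b0 ?w0.
have [z1 [z2 ->]] := cv2P z; rewrite mx2_cv2 => /intcv2 [i1 i2] e.
have [-> ->] : x = b * z1 /\ y = - a * z1 + w * z2.
  by split; [have /matrixP /(_ 0 0) := e|have /matrixP /(_ 1 0) := e]; rewrite !mxE /= => ->; ring.
split; first by apply/intcv2; split; [|apply: vgeD]; apply: vgeM0 => //; apply: vgeN.
rewrite (_ : _ + _ = w * (b * z2)); last by ring.
by apply: vgeM1 => //; apply: vgeM0.
Qed.

(** Let a and b be the coefficients along e, modulo the smaller lattice, of the two basis vectors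
    given by N. In these coordinates the smaller lattice is the kernel of (x, y) |-> ax + by modulo
    w, and [kernel_basis] applies. *)
Lemma lattice_step_mx M N : M \in unitmx -> N \in unitmx ->
  lattice_step v (lat M) (lat N) -> exists2 U, GLO U & simmx M (N *m U *m dmx 1%N).
Proof.
move=> uM uN [sub [e [/latP [e' ie ->] gen ann]]].
have [x0 [y0 ee]] := cv2P e'; rewrite ee in ie gen ann *.
have [ix iy] : vge v 0 x0 /\ vge v 0 y0 by apply/intcv2.
have basis z : intcv z -> exists a, vge v 0 a /\ lat M (N *m (z - a *: cv2 x0 y0)).
  move=> iz; have [a [m [ia Mm E]]] := gen (N *m z) (ex_intro2 _ _ z iz erefl).
  by exists a; rewrite mulmxBr -scalemxAr E addrC addKr.
have [a [ia Ma]] := basis (cv2 1 0) ((intcv2 _ _).2 (conj vge1 (vge0 0))).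
have [b [ib Mb]] := basis (cv2 0 1) ((intcv2 _ _).2 (conj (vge0 0) vge1)).
have lin x y : vge v 0 x -> vge v 0 y -> lat M (N *m (cv2 x y - (a * x + b * y) *: cv2 x0 y0)).
  move=> hx hy; rewrite (_ : cv2 x y - _ = x *: (cv2 1 0 - a *: cv2 x0 y0) + y *: (cv2 0 1 - b *: cv2 x0 y0)).
    by rewrite mulmxDr -!scalemxAr; apply: latD; apply: latZ.
  by rewrite -!scaleN1r !(cv2_scale, cv2_add); congr cv2; ring.
have ker x y : vge v 0 x -> vge v 0 y ->
    lat M (N *m cv2 x y) <-> vge v 1 (a * x + b * y).
  move=> hx hy; have i1 : vge v 0 (a * x + b * y) by apply: vgeD; apply: vgeM0.
  rewrite -(ann _ i1); have := lin x y hx hy.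
  rewrite mulmxBr -scalemxAr => l; split=> h.
    by have := latD h (latN l); rewrite opprB addrC subrK.
  by have := latD l h; rewrite subrK.
have h1 : vge v 1 (1 - (a * x0 + b * y0)).
  have i1 : vge v 0 (1 - (a * x0 + b * y0)).
    by apply: vgeB; [exact: vge1|apply: vgeD; apply: vgeM0].
  apply/(ann _ i1); have := lin x0 y0 ix iy.
  by rewrite scalemxAr scalerBl scale1r.
have [U gU Uker] := kernel_basis ia ib ix iy h1.
exists U => //; suff e2 : lat M = lat (N *m U *m dmx 1%N).
  have uD : N *m U *m dmx 1%N \in unitmx by rewrite !unitmx_mul uN dmx_unit GLO_unit.
  by have [V gV ->] := (lat_eq uM uD).1 e2; apply: simmx_mulr.
apply/seteqP; split=> u /latP [z iz ->].
- have : lat N (M *m z) by apply: sub; exists z.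
  move=> /latP [t]; have [x [y ->]] := cv2P t => it E.
  have [hx hy] : vge v 0 x /\ vge v 0 y by apply/intcv2.
  have /ker h : lat M (N *m cv2 x y) by rewrite -E; exists z.
  have /Uker [s is_ Es] : intcv (cv2 x y) /\ vge v 1 (a * x + b * y) by split=> //; apply: h.
  by rewrite E Es; exists s => //; rewrite !mulmxA.
- have [x [y exy]] := cv2P (U *m dmx 1%N *m z).
  have /Uker [/intcv2 [hx hy] h] : exists2 z, intcv z & cv2 x y = U *m dmx 1%N *m z by exists z.
  by rewrite -!mulmxA [U *m _]mulmxA exy; apply/ker.
Qed.

Lemma lattice_step_dmx M : M \in unitmx -> lattice_step v (lat (M *m dmx 1%N)) (lat M).
Proof.
move=> uM; have iw : vge v 0 w by right; rewrite vw.
have iD : intmx (dmx 1%N) by rewrite dmxE; apply/intmx2; split=> //; (exact: vge1 || exact: vge0).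
split; first by apply/lat_sub; rewrite // mulKmx.
exists (M *m cv2 0 1); split.
- by exists (cv2 0 1) => //; apply/intcv2; split; [exact: vge0|exact: vge1].
- move=> u /latP [z]; have [x [y ->]] := cv2P z => /intcv2 [hx hy] ->.
  exists y, (M *m cv2 x 0); split=> //.
    exists (cv2 x 0); first by apply/intcv2; split=> //; apply: vge0.
    by rewrite -mulmxA dmxE mx2_cv2; congr (_ *m cv2 _ _); ring.
  by rewrite scalemxAr -mulmxDr cv2_scale cv2_add; congr (_ *m cv2 _ _); ring.
- move=> a ia; split=> [/latP [z]|ha].
    have [x [y ->]] := cv2P z => /intcv2 [hx hy].
    rewrite scalemxAr -mulmxA => /(can_inj (mulKmx uM)).
    rewrite dmxE mx2_cv2 cv2_scale => /matrixP /(_ 1 0); rewrite !mxE /= mulr1 mul0r add0r => ->.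
    by apply: vgeM1 => //; right; rewrite vw.
  exists (cv2 0 (a / w)); first by apply/intcv2; split; [exact: vge0|apply: vge_div].
  rewrite scalemxAr -mulmxA dmxE mx2_cv2 cv2_scale; congr (_ *m cv2 _ _); first by ring.
  by field; rewrite ?w0.
Qed.

Definition swap2 : 'M[K]_2 := mx2 0 1 1 0.

Lemma swap2_GLO : GLO swap2.
Proof.
have e : \det swap2 = -1 by rewrite mx2_det mulr0 mul1r sub0r.
split; first by apply/intmx2; split; (exact: vge1 || exact: vge0).
  by rewrite e oppr_eq0 oner_neq0.
by rewrite e valN val1.
Qed.

Lemma swap2K (M : 'M[K]_2) : swap2 *m (swap2 *m M) = M.
Proof.
by rewrite mulmxA mx2_mul (_ : mx2 _ _ _ _ = 1%:M) ?mul1mx // mx2_1; congr mx2; ring.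
Qed.

Lemma bt_adj_mx M N (uM : M \in unitmx) (uN : N \in unitmx) :
  gadj (vtx uM) (vtx uN) -> exists2 U, GLO U & simmx N (M *m U *m dmx 1%N).
Proof.
have step M0 N0 M' N' : M0 \in unitmx -> N0 \in unitmx -> simmx M0 M' -> simmx N0 N' ->
    lattice_step v (lat M0) (lat N0) -> exists2 U, GLO U & simmx M' (N' *m U *m dmx 1%N).
  move=> u1 u2 s1 [c [V [c0 gV eN]]] /(lattice_step_mx u1 u2) [U gU sU].
  exists (V *m U); first exact: GLOM.
  apply: simmx_trans (simmx_sym s1) (simmx_trans sU _).
  by rewrite eN -!scalemxAl !mulmxA; apply: simmx_scale.
move=> [L0 [L [st [[xL yL]|[xL yL]]]]]; have [M0 [u1 e1 s1]] := vtx_elem xL;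
  have [N0 [u2 e2 s2]] := vtx_elem yL; subst L0 L; last exact: step st.
have [V gV [c [V2 [c0 gV2 eM]]]] := step _ _ _ _ u1 u2 s1 s2 st.
exists (invmx V2 *m swap2); first by apply: GLOM; [exact: GLOV|exact: swap2_GLO].
(* Up to the scalar w, the inverse of diag(1, w) is diag(w, 1), its conjugate by the swap; so a
   superlattice is homothetic to a sublattice of the same kind. *)
have e : dmx 1%N *m swap2 *m dmx 1%N = w *: swap2.
  by rewrite dmxE !mx2_mul mx2_scale; congr mx2; ring.
apply: simmx_sym; rewrite eM -!scalemxAl !mulmxA mulmxK ?GLO_unit //.
rewrite -!mulmxA [dmx 1%N *m _]mulmxA e -!scalemxAr scalerA !mulmxA.
apply: simmx_trans (simmx_scale _ _) _; first by rewrite mulf_neq0.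
by apply: simmx_trans (simmx_mulr _ _) (simmx_mulr _ gV); apply: swap2_GLO.
Qed.

Lemma bt_adj_sym (x y : bt_graph v) : gadj x y -> gadj y x.
Proof.
move=> [L0 [L [st h]]]; exists L0, L; split=> //.
by case: h => -[? ?]; [right|left].
Qed.

Lemma bt_adj_dmx M (uM : M \in unitmx) (uD : M *m dmx 1%N \in unitmx) :
  gadj (vtx uM) (vtx uD).
Proof.
exists (lat (M *m dmx 1%N)), (lat M); split; first exact: lattice_step_dmx.
by right; split; apply/vtx_mem => //; apply: simmx_refl.
Qed.

Lemma GLO_mx2 a b c d : vge v 0 a -> vge v 0 b -> vge v 0 c -> vge v 0 d ->
  a * d - b * c != 0 -> v (a * d - b * c) = 0 -> GLO (mx2 a b c d).
Proof. by move=> *; split; rewrite ?mx2_det //; apply/intmx2. Qed.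

Lemma elementary_GLO t : vge v 0 t -> GLO (mx2 1 0 t 1).
Proof.
move=> it; apply: GLO_mx2 => //; rewrite ?mul1r ?mul0r ?subr0 ?oner_neq0 ?val1 //;
  (exact: vge1 || exact: vge0).
Qed.

(** The first column (a, c) of U decides. If a is a unit, or if n = 0, elimination leads to level n
    + 1. Otherwise c is a unit and a scalar w splits off, leaving level n - 1 with the same N: the
    parent does not depend on U, which gives unique descent. *)
Lemma neighbour_mx N U (n : nat) : GLO N -> GLO U ->
  (exists2 N', GLO N' & simmx (N *m dmx n *m U *m dmx 1%N) (N' *m dmx n.+1)) \/
  (exists2 n', n = n'.+1 & simmx (N *m dmx n *m U *m dmx 1%N) (N *m dmx n')).
Proof.
have iw : vge v 0 w by right; rewrite vw.
have ipow k : vge v 0 (w ^+ k) by right; rewrite val_pow.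
have [a [b [c [d ->]]]] := mx2P U => gN [/intmx2 [ia ib ic id]]; rewrite mx2_det => D0 vD.
have [[a0 va]|a1] : (a != 0 /\ v a = 0) \/ vge v 1 a.
  have [->|a0] := eqVneq a 0; first by right; left.
  case: ia => [/eqP|ia]; first by rewrite (negbTE a0).
  by have [e|ne] := eqVneq (v a) 0; [left|right; right; lia].
- left; have iV := vge_unit_inv a0 va; have it : vge v 0 (c / a) by apply: vgeM0.
  exists (N *m mx2 1 0 (w ^+ n * (c / a)) 1).
    by apply: GLOM => //; apply: elementary_GLO; apply: vgeM0.
  have gV : GLO (mx2 a (b * w) 0 (d - c / a * b)).
    have e : a * (d - c / a * b) - b * w * 0 = a * d - b * c by field; rewrite a0.
    by apply: GLO_mx2; rewrite ?e //; [apply: vgeM0|exact: vge0|apply: vgeB => //; apply: vgeM0].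
  rewrite -!mulmxA; apply: simmx_mull.
  rewrite (_ : dmx n *m _ = mx2 1 0 (w ^+ n * (c / a)) 1 *m dmx n.+1 *m mx2 a (b * w) 0 (d - c / a * b)).
    exact: simmx_mulr.
  by rewrite dmxE /dmx !mx2_mul exprS; congr mx2; field; rewrite ?a0.
have [c0 vc] : c != 0 /\ v c = 0.
  have h : vge v 1 c -> False.
    move=> c1; have : vge v 1 (a * d - b * c).
      by apply: vgeB; [apply: vgeM1|rewrite mulrC; apply: vgeM1].
    by case=> [/eqP|]; [rewrite (negbTE D0)|rewrite vD].
  have c0 : c != 0 by apply/eqP => e; apply: h; left.
  split=> //; case: ic => [/eqP|ic]; first by rewrite (negbTE c0).
  by have [//|ne] := eqVneq (v c) 0; case: h; right; lia.
case: n => [|n].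
- left; have iV := vge_unit_inv c0 vc.
  have it : vge v 0 (a / c) by apply: vgeM0 => //; apply: vgeW a1.
  exists (N *m mx2 (a / c) 1 1 0).
    apply: GLOM => //; apply: GLO_mx2; rewrite ?mulr0 ?mulr1 ?sub0r ?oppr_eq0 ?oner_neq0 ?valN ?val1 //;
    (exact: vge1 || exact: vge0).
  have gV : GLO (mx2 c (d * w) 0 (b - a / c * d)).
    have e : c * (b - a / c * d) - d * w * 0 = - (a * d - b * c) by field; rewrite c0.
    by apply: GLO_mx2; rewrite ?e ?oppr_eq0 ?valN //; [apply: vgeM0|exact: vge0|apply: vgeB => //; apply: vgeM0].
  rewrite -!mulmxA; apply: simmx_mull.
  rewrite (_ : dmx 0%N *m _ = mx2 (a / c) 1 1 0 *m dmx 1%N *m mx2 c (d * w) 0 (b - a / c * d)).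
    exact: simmx_mulr.
  by rewrite dmx0 mul1mx dmxE !mx2_mul; congr mx2; field; rewrite ?c0.
right; exists n => //.
have gV : GLO (mx2 (a / w) b c (d * w)).
  have e : a / w * (d * w) - b * c = a * d - b * c by field; rewrite w0.
  by apply: GLO_mx2; rewrite ?e //; [apply: vge_div|apply: vgeM0].
rewrite -!mulmxA; apply: simmx_mull; exists w, (mx2 (a / w) b c (d * w)); split=> //.
by rewrite dmxE /dmx !mx2_mul mx2_scale exprS; congr mx2; field; rewrite ?w0.
Qed.

Lemma dmx_scalar_le N N' U (n n' : nat) c : GLO N -> GLO N' -> GLO U -> c != 0 ->
  N *m dmx n = c *: (N' *m dmx n' *m U) -> v c <= 0.
Proof.
move=> gN gN' gU c0 e; have idmx k : intmx (dmx k).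
  by apply/intmx2; split; (exact: vge1 || exact: vge0 || by right; rewrite val_pow).
have : dmx n = c *: (invmx N *m N' *m dmx n' *m U).
  by rewrite -[LHS](mulKmx (GLO_unit gN)) e -scalemxAr !mulmxA.
have : intmx (invmx N *m N' *m dmx n' *m U).
  have [iV _ _] := GLOV gN; have [iN' _ _] := gN'; have [iU _ _] := gU.
  by do !apply: intmxM => //.
set P := _ *m U => iP /matrixP /(_ 0 0); rewrite [RHS]mxE [LHS]mxE /= => h.
have hc : P 0 0 = c^-1 by apply: (mulfI c0); rewrite -h divff.
by have := iP 0 0; rewrite hc => -[/eqP|]; [rewrite invr_eq0 (negbTE c0)|rewrite valV // oppr_ge0].
Qed.

(** Uniqueness of elementary divisors: the corner entry 1 of [dmx], compared in both directions,
    forces the scalar to be a unit, and then the determinants determine n. *)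
Lemma dmx_unique N N' (n n' : nat) : GLO N -> GLO N' ->
  simmx (N *m dmx n) (N' *m dmx n') -> n = n'.
Proof.
move=> gN gN' [c [U [c0 gU e]]].
have h1 := dmx_scalar_le gN gN' gU c0 e.
have h2 : v c^-1 <= 0.
  apply: (@dmx_scalar_le N' N (invmx U) n' n) => //; [exact: GLOV|by rewrite invr_eq0|].
  by rewrite e -scalemxAl scalerA mulVf // scale1r mulmxK // GLO_unit.
have vc : v c = 0 by rewrite valV // oppr_le0 in h2; apply/eqP; rewrite eq_le h1.
have [_ dN vN] := gN; have [_ dN' vN'] := gN'; have [_ dU vU] := gU.
have := congr1 (fun M => v (\det M)) e; rewrite detZ !det_mulmx.
have dE k : \det (dmx k) = w ^+ k by rewrite mx2_det mul1r mulr0 subr0.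
rewrite !dE !(lf_mul lf) ?mulf_neq0 ?expf_neq0 // !val_pow vN vN' vU vc; lia.
Qed.

(** Existence of elementary divisors: an entry of least valuation is brought to the corner by
    swapping rows and columns and serves as pivot. The remaining entry, divided by the pivot, is a
    unit times a power of w. *)
Lemma dmx_exists M : M \in unitmx -> exists N (n : nat), GLO N /\ simmx M (N *m dmx n).
Proof.
pose Q M := exists N (n : nat), GLO N /\ simmx M (N *m dmx n).
have Ql A : Q (swap2 *m A) -> Q A.
  move=> [N [n [gN h]]]; exists (swap2 *m N), n; split; first by apply: GLOM => //; apply: swap2_GLO.
  by rewrite -[A]swap2K -mulmxA; apply: simmx_mull.
have Qr A : Q (A *m swap2) -> Q A.
  move=> [N [n [gN h]]]; exists N, n; split=> //.
  by apply: simmx_trans h; apply/simmx_sym/simmx_mulr/swap2_GLO.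
have main a b c d : a != 0 -> vge v (v a) b -> vge v (v a) c -> vge v (v a) d ->
    a * d - b * c != 0 -> Q (mx2 a b c d).
  move=> a0 hb hc hd D0.
  have dv x : vge v (v a) x -> vge v 0 (x / a).
    move=> hx; rewrite -(subrr (v a)); apply: vgeM => //; right; by rewrite valV.
  pose e := d / a - c / a * (b / a).
  have ie : vge v 0 e by apply: vgeB; [|apply: vgeM0]; apply: dv.
  have e0 : e != 0.
    rewrite (_ : e = (a * d - b * c) / (a * a)); last by rewrite /e; field; rewrite a0.
    by rewrite mulf_neq0 // invr_eq0 mulf_neq0.
  case: ie => [/eqP|ie]; first by rewrite (negbTE e0).
  have [n vn] : exists n : nat, v e = n%:Z by exists `|v e|%N; lia.
  have wn0 : w ^+ n != 0 by rewrite expf_neq0.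
  exists (mx2 1 0 (c / a) 1), n; split; first by apply: elementary_GLO; apply: dv.
  exists a, (mx2 1 (b / a) 0 (e / w ^+ n)); split=> //.
    have de : 1 * (e / w ^+ n) - b / a * 0 = e / w ^+ n by rewrite mul1r mulr0 subr0.
    have ve : v (e / w ^+ n) = 0 by rewrite (lf_mul lf) ?invr_eq0 // valV // val_pow vn subrr.
    apply: GLO_mx2; rewrite ?de ?ve ?mulf_neq0 ?invr_eq0 //; [exact: vge1|exact: dv|exact: vge0|].
    by right; rewrite ve.
  by rewrite /dmx !mx2_mul mx2_scale /e; congr mx2; field; rewrite ?a0 ?wn0.
move=> uM; have D0 : \det M != 0 by rewrite -unitfE -unitmxE.
have [a [b [c [d eM]]]] := mx2P M; rewrite eM mx2_det in D0 *; rewrite -/(Q _) {eM uM M}.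
pose le x y := y = 0 \/ x != 0 /\ v x <= v y.
have tot x y : le x y \/ le y x.
  have [->|x0] := eqVneq x 0; first by right; left.
  have [->|y0] := eqVneq y 0; first by left; left.
  have [h|h] := lerP (v x) (v y); first by left; right.
  by right; right; split=> //; apply: ltW.
have tr x y z : le x y -> le y z -> le x z.
  move=> h [->|[y0 h2]]; first by left.
  case: h => [e|[x0 h]]; first by rewrite e eqxx in y0.
  by right; split=> //; apply: le_trans h2.
have lev x y : x != 0 -> le x y -> vge v (v x) y by move=> x0 [->|[_ h]]; [left|right].
have main' x y z t : le x y -> le x z -> le x t -> x * t - y * z != 0 -> Q (mx2 x y z t).
  move=> hy hz ht D; have x0 : x != 0.
    apply/eqP => e; move: hy hz ht D; rewrite e.
    case=> [->|[]]; last by rewrite eqxx.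
    by rewrite mul0r mul0r subrr eqxx.
  by apply: main => //; apply: lev.
have D1 : - (a * d - b * c) != 0 by rewrite oppr_eq0.
have [ab|ba] := tot a b; have [cd|dc] := tot c d.
- have [ac|ca] := tot a c; first by apply: main' => //; apply: tr cd.
  apply: Ql; rewrite mx2_mul !mul0r !mul1r !add0r !addr0; apply: main' => //.
    by apply: tr ab.
  by rewrite (_ : _ - _ = - (a * d - b * c)) //; ring.
- have [ad|da] := tot a d; first by apply: main' => //; apply: tr dc.
  apply: Ql; apply: Qr; rewrite !mx2_mul !(mul0r, mul1r, mulr0, mulr1, add0r, addr0); apply: main' => //.
    by apply: tr ab.
  by rewrite (_ : _ - _ = a * d - b * c) //; ring.
- have [bc|cb] := tot b c.
    apply: Qr; rewrite !mx2_mul !(mul0r, mul1r, mulr0, mulr1, add0r, addr0); apply: main' => //.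
      by apply: tr cd.
    by rewrite (_ : _ - _ = - (a * d - b * c)) //; ring.
  apply: Ql; rewrite !mx2_mul !(mul0r, mul1r, mulr0, mulr1, add0r, addr0); apply: main' => //.
    by apply: tr ba.
  by rewrite (_ : _ - _ = - (a * d - b * c)) //; ring.
- have [bd|db] := tot b d.
    apply: Qr; rewrite !mx2_mul !(mul0r, mul1r, mulr0, mulr1, add0r, addr0); apply: main' => //.
      by apply: tr dc.
    by rewrite (_ : _ - _ = - (a * d - b * c)) //; ring.
  apply: Ql; apply: Qr; rewrite !mx2_mul !(mul0r, mul1r, mulr0, mulr1, add0r, addr0); apply: main' => //.
    by apply: tr ba.
  by rewrite (_ : _ - _ = a * d - b * c) //; ring.
Qed.

End Valuation.

Section BruhatTitsTree.
Local Open Scope ring_scope.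
Variables (K : fieldType) (v : K -> int).
Hypothesis lf : is_local_field v.
Variable w : K.
Hypotheses (w0 : w != 0) (vw : v w = 1).
Implicit Types (x y z : bt_graph v) (n : nat) (M N U : 'M[K]_2).
Local Notation E := (dmx w).

Lemma rep_unit N n : GLO v N -> N *m E n \in unitmx.
Proof. by move=> gN; rewrite unitmx_mul (GLO_unit gN) dmx_unit. Qed.

Lemma bt_rep x : exists n N (gN : GLO v N), x = vtx v (rep_unit n gN).
Proof.
have [M [uM ->]] := vtxP x; have [N [n [gN h]]] := dmx_exists lf w0 vw uM.
by exists n, N, gN; apply/(vtx_eq lf).
Qed.

Lemma bt_neighbour n N (gN : GLO v N) y : gadj (vtx v (rep_unit n gN)) y ->
  (exists N' (gN' : GLO v N'), y = vtx v (rep_unit n.+1 gN')) \/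
  (exists2 n', n = n'.+1 & y = vtx v (rep_unit n' gN)).
Proof.
have [M [uM ->]] := vtxP y => /(bt_adj_mx lf w0 vw) [U gU h].
have [[N' gN' h']|[n' en h']] := neighbour_mx lf w0 vw n gN gU.
  by left; exists N', gN'; apply/(vtx_eq lf); apply: (simmx_trans lf h).
by right; exists n' => //; apply/(vtx_eq lf); apply: (simmx_trans lf h).
Qed.

Definition bt_height x : nat :=
  xget 0%N [set n | exists N (gN : GLO v N), x = vtx v (rep_unit n gN)].

Lemma bt_heightE n N (gN : GLO v N) : bt_height (vtx v (rep_unit n gN)) = n.
Proof.
rewrite /bt_height; case: xgetP => [m _ [N' [gN' /(vtx_eq lf) h]]|/(_ n) []].
  exact/esym/(dmx_unique lf w0 vw gN gN').
by exists N, gN.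
Qed.

Lemma bt_tree : is_tree (bt_graph v).
Proof.
have g1 := GLO1 lf.
apply: (@rooted_tree _ (vtx v (rep_unit 0 g1)) bt_height (@bt_adj_sym _ v)).
- move=> x; split=> [|->]; last exact: bt_heightE.
  have [n [N [gN ->]]] := bt_rep x; rewrite bt_heightE => e; subst n.
  apply/(vtx_eq lf); rewrite dmx0 !mulmx1.
  by rewrite -[N in simmx _ N _]mul1mx; apply: simmx_mulr.
- move=> x y; have [n [N [gN ->]]] := bt_rep x => /bt_neighbour [[N' [gN' ->]]|[n' -> ->]];
  rewrite !bt_heightE; by [left|right].
- move=> x; have [[|n] [N [gN ->]]] := bt_rep x; rewrite bt_heightE // => _.
  exists (vtx v (rep_unit n gN)); last by rewrite bt_heightE.
  apply: bt_adj_sym; have uD : N *m E n *m E 1 \in unitmx by rewrite -mulmxA dmxM rep_unit.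
  suff -> : vtx v (rep_unit n.+1 gN) = vtx v uD by apply: bt_adj_dmx.
  by apply/(vtx_eq lf); rewrite -mulmxA dmxM; apply: simmx_refl.
- move=> x y z; have [n [N [gN ->]]] := bt_rep x.
  move=> /bt_neighbour [[N1 [g1' ->]]|[n1 e1 ->]] /bt_neighbour [[N2 [g2' ->]]|[n2 e2 ->]];
  rewrite ?bt_heightE => h1 h2; try lia.
  by have -> : n1 = n2 by lia.
Qed.

End BruhatTitsTree.

(** * Discreteness and torsion-freeness make the action free *)

Section Pigeonhole.
Local Open Scope ring_scope.

Lemma pigeonhole (F : finType) (f : nat -> F) : exists i j : nat, (i < j)%N /\ f i = f j.
Proof.
have /injectivePn [i [j ne e]] : ~~ injectiveb [ffun i : 'I_#|F|.+1 => f i].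
  apply/negP => /injectiveP inj; have := leq_card _ inj.
  by rewrite card_ord ltnn.
rewrite !ffunE in e; have [lt|gt|/val_inj eq] := ltngtP i j.
- by exists i, j.
- by exists j, i.
- by rewrite eq eqxx in ne.
Qed.

End Pigeonhole.

Section Residues.
Local Open Scope ring_scope.
Variables (K : fieldType) (v : K -> int).
Hypothesis lf : is_local_field v.

(** Expansion in powers of w: representatives modulo w^n are refined by adding w^n times residue
    representatives. *)
Lemma residues (n : nat) : exists s : seq K, forall x, vge v 0 x ->
  exists2 y, y \in s & vge v n%:Z (x - y).
Proof.
have [w w0 vw] := lf_unif lf.
elim: n => [|n [s IH]].
  by exists [:: 0] => x ix; exists 0; rewrite ?inE // subr0.
have [t ht] := lf_residue lf.
exists [seq y + w ^+ n * z | y <- s, z <- t] => x /IH [y ys h].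
have iq : vge v 0 ((x - y) / w ^+ n).
  have [->|d0] := eqVneq (x - y) 0; first by rewrite mul0r; left.
  case: h => [/eqP|h]; first by rewrite (negbTE d0).
  right; rewrite (lf_mul lf) ?invr_eq0 ?expf_neq0 // (valV lf) ?expf_neq0 //.
  by rewrite (val_pow lf) // subr_ge0.
have [z [zt _ hz]] := ht _ iq.
exists (y + w ^+ n * z); first by apply/allpairsP; exists (y, z).
have -> : x - (y + w ^+ n * z) = w ^+ n * ((x - y) / w ^+ n - z).
  by rewrite mulrBr mulrCA mulfV ?expf_neq0 // mulr1 opprD addrA.
rewrite -addn1 PoszD; apply: (vgeM lf) => //; right.
by rewrite (val_pow lf).
Qed.

Lemma power_near_one (P : 'M[K]_2) (n : nat) : GLO v P ->
  exists2 k : nat, (0 < k)%N & forall i j, vge v n%:Z ((P ^+ k - 1) i j).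
Proof.
move=> gP; have [s hs] := residues n.
have gX k : GLO v (P ^+ k).
  elim: k => [|k IH]; first by rewrite expr0; apply: GLO1.
  by rewrite exprS; apply: (GLOM lf).
have ch x : exists y, vge v 0 x -> y \in s /\ vge v n%:Z (x - y).
  have [ix|nx] := pselect (vge v 0 x); last by exists x.
  by have [y] := hs x ix; exists y.
have [r rP] := choice ch.
pose f k : 'M['I_(size s).+1]_2 := map_mx (fun x => inord (index (r x) s)) (P ^+ k).
have [i [j [ij eij]]] := pigeonhole f.
have dif a b : vge v n%:Z ((P ^+ j - P ^+ i) a b).
  have := congr1 (fun M : 'M_2 => val (M a b)) eij; rewrite !mxE.
  have [iX _ _] := gX i; have [jX _ _] := gX j.
  have [mi hi] := rP _ (iX a b); have [mj hj] := rP _ (jX a b).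
  rewrite /= !inordK ?ltnS ?index_size // => e.
  have er : r ((P ^+ i) a b) = r ((P ^+ j) a b).
    by rewrite -(nth_index 0 mi) e nth_index.
  rewrite -(subrK (r ((P ^+ j) a b)) ((P ^+ j) a b)) -addrA.
  by apply: (vgeD lf) => //; rewrite -er -opprB; apply: (vgeN lf).
exists (j - i)%N; first by rewrite subn_gt0.
have uP : P ^+ i \in unitmx := GLO_unit (gX i).
(* The inverse of P^i is integral, so no precision is lost by dividing. *)
have -> : P ^+ (j - i) - 1 = invmx (P ^+ i) *m (P ^+ j - P ^+ i).
  rewrite mulmxBr mulVmx //; congr (_ - _).
  by rewrite -{2}(subnKC (ltnW ij)) exprD -[_ * _]/(_ *m _) mulKmx.
move=> a b; rewrite mxE; have [iV _ _] := GLOV lf (gX i).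
rewrite !big_ord_recl big_ord0 addr0; rewrite -[n%:Z]add0r.
by apply: (vgeD lf); apply: (vgeM lf).
Qed.

End Residues.

Section Discreteness.
Local Open Scope ring_scope.

Definition torsion_free (H : groupType) (G : set H) : Prop :=
  forall g n, (0 < n)%N -> G g -> (g ^+ n = 1)%g -> (g = 1)%g.

Lemma subgroupX (H : groupType) (G : set H) g n : is_subgroup G -> G g -> G (g ^+ n)%g.
Proof.
move=> sG Gg; elim: n => [|n IH]; first by rewrite expg0; case: sG.
by rewrite expgS; apply: subgroupM.
Qed.

Variables (K : fieldType) (v : K -> int).
Hypothesis lf : is_local_field v.

Lemma entry_bound (M : 'M[K]_2) : exists m : nat, forall i j, vge v (- m%:Z) (M i j).
Proof.
have [a [b [c [d ->]]]] := mx2P M; exists (`|v a| + `|v b| + `|v c| + `|v d|)%N => i j.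
by rewrite mxE; elim/I2P: i; elim/I2P: j; right; rewrite /=; lia.
Qed.

Lemma sl2_free (G : set (SL2 K)) : is_discrete (sl2_open v) G -> is_subgroup G ->
  torsion_free G -> acts_freely (bt_gtree v) G.
Proof.
move=> disc sG tf g x Gg; have [M [uM ->]] := vtxP x => e.
have [c [U [c0 gU eg]]] : simmx v (sl2_mx g *m M) M.
  have ug := sl2_unit g; apply/(vtx_mem lf uM); first by rewrite unitmx_mul ug.
  rewrite -e /=; exists (lat v M); first by apply/(vtx_mem lf uM) => //; apply: simmx_refl.
  by rewrite /mx_image /lat image_comp; apply: eq_imagel => z _ /=; rewrite mulmxA.
have [iU dU vU] := gU; have M0 : \det M != 0 by rewrite -unitfE -unitmxE.
(* As det g = 1, the scalar is a unit, and M^-1 g M lies in GL_2 of the valuation ring. *)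
have vc : v c = 0.
  have := congr1 (fun A => v (\det A)) eg.
  by rewrite detZ !det_mulmx sl2_det mul1r expr2 !(lf_mul lf) ?mulf_neq0 // vU; lia.
pose P := c *: U; have gP : GLO v P.
  split; first by move=> i j; rewrite mxE; apply: (vgeM0 lf) => //; right; rewrite vc.
    by rewrite detZ mulf_neq0 ?expf_neq0.
  by rewrite detZ expr2 !(lf_mul lf) ?mulf_neq0 // vU vc.
have gM : sl2_mx g *m M = M *m P by rewrite eg -scalemxAr.
have gX k : sl2_mx (g ^+ k)%g *m M = M *m P ^+ k.
  elim: k => [|k IH]; first by rewrite expg0 expr0 [LHS]mul1mx mulmx1.
  rewrite expgSr exprSr -[P ^+ k * P]/(P ^+ k *m P) mulmxA -IH -[LHS]/(_ *m _ *m M).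
  by rewrite -mulmxA gM mulmxA.
have [V [oV VG]] := disc 1%g (subgroup1 sG).
have [V1 _] : (V `&` G) 1%g by rewrite VG.
have [N hN] := oV _ V1.
have [m1 hm1] := entry_bound M; have [m2 hm2] := entry_bound (invmx M).
(* The summands m1 and m2 make up for the denominators of M and of its inverse when conjugating
   back. *)
have [k k0 hk] := power_near_one lf (`|N| + m1 + m2)%N gP.
apply: (tf g k k0 Gg).
suff: (V `&` G) (g ^+ k)%g by rewrite VG.
split; last exact: subgroupX.
apply: hN => i j.
have -> : sl2_mx (g ^+ k)%g i j - sl2_mx (1%g : SL2 K) i j = (M *m (P ^+ k - 1) *m invmx M) i j.
  rewrite mulmxBr -gX mulmx1 mulmxBl mulmxK // mulmxV //.
  by rewrite [RHS]mxE [X in _ = _ + X]mxE.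
rewrite mxE !big_ord_recl big_ord0 addr0.
have h n a b : vge v n a -> vge v (- m2%:Z) b -> n - m2%:Z >= N -> vge v N (a * b).
  by move=> ha hb le; apply: vgeW le _; apply: (vgeM lf).
have h' a b : vge v (- m1%:Z + (`|N| + m1 + m2)%N%:Z) ((M *m (P ^+ k - 1)) a b).
  rewrite mxE !big_ord_recl big_ord0 addr0.
  by apply: (vgeD lf); apply: (vgeM lf).
by apply: (vgeD lf); apply: (h _ _ _ (h' _ _) (hm2 _ _)); lia.
Qed.

End Discreteness.

Section LocallyFinite.
Local Open Scope ring_scope.
Variable T : lf_tree.

Lemma finite_ball (x : T) (n : nat) : finite_set [set y : T | (dist x y <= n)%N].
Proof.
have treeT := lft_tree T; elim: n => [|n IH].
  apply: (sub_finite_set (B := [set x])); last exact: finite_set1.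
  by move=> y /=; rewrite leqn0 => /eqP /(dist0_eq (tree_conn treeT)).
apply: (sub_finite_set (B := [set x] `|` \bigcup_(z in [set z : T | (dist x z <= n)%N]) [set y | gadj z y])).
  move=> y /= le; have [e|ne] := eqVneq (dist y x) 0%N.
    by left; rewrite (dist0_eq (tree_conn treeT) e).
  have S := dist_sym (tree_sym treeT) (tree_conn treeT).
  have [k ek] : exists k, dist y x = k.+1 by exists (dist y x).-1; lia.
  have [z yz dz] := dist_step (tree_conn treeT) ek.
  by right; exists z; [rewrite /= S dz; move: (S x y); lia|apply: (tree_sym treeT)].
rewrite finite_setU; split; first exact: finite_set1.
by apply: bigcup_finite => // z _; apply: lft_fin.
Qed.

Lemma finite_orbit (A : set T) (f : nat -> T) : finite_set A -> (forall k, A (f k)) ->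
  exists i j : nat, (i < j)%N /\ f i = f j.
Proof.
move=> /(@finite_seqP {classic T}) [s ->] fA.
have [i [j [ij e]]] := pigeonhole (fun k => inord (index (f k : {classic T}) s) : 'I_(size s).+1).
exists i, j; split=> //; have := congr1 val e.
rewrite /= !inordK ?ltnS ?index_size // => e'.
by rewrite -(nth_index (f 0%N : {classic T}) (fA i)) e' nth_index //; apply: fA.
Qed.

(** Every vertex has a period, since its orbit stays in a ball about x; a product of periods serves
    for all of s. *)
Lemma isom_power_fixes (g : isom T) (x : T) (s : set T) : g x = x -> finite_set s ->
  exists2 k : nat, (0 < k)%N & forall y, s y -> (g ^+ k)%g y = y.
Proof.
move=> gx; have treeT := lft_tree T.
have gX k y : (g ^+ k)%g y = iter k g y by exact: (@actX _ (isom_gtree T) k g y).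
have one y : exists2 k : nat, (0 < k)%N & iter k g y = y.
  have gk k z : dist x (iter k g z) = dist x z.
    by elim: k => //= k IH; rewrite -{1}gx idist.
  have [i [j [ij e]]] := finite_orbit (finite_ball x (dist x y)) (fun k => eq_leq (gk k y) : [set z : T | (dist x z <= dist x y)%N] (iter k g y)).
  exists (j - i)%N; first by rewrite subn_gt0.
  have inj : injective (iter i g).
    by elim: (i) => // m IH a b /= /(can_inj (ifunK g)) /IH.
  by apply: inj; rewrite -iterD subnKC ?(ltnW ij) // e.
move=> /(@finite_seqP {classic T}) [l ->].
elim: l => [|y l [k k0 IH]]; first by exists 1%N.
have [m m0 hm] := one y; exists (k * m)%N; first by rewrite muln_gt0 k0.
move=> z; rewrite gX /= inE => /orP[/eqP ->|zl].
  by rewrite mulnC; elim: (k) => [|n IHn]; rewrite ?muln0 // mulnS iterD IHn.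
have hz : iter k g z = z by rewrite -gX; apply: IH.
by elim: (m) => [|n IHn]; rewrite ?muln0 // mulnS iterD IHn.
Qed.

Lemma isom_free (G : set (isom T)) : is_discrete (@isom_open T) G -> is_subgroup G ->
  torsion_free G -> acts_freely (isom_gtree T) G.
Proof.
move=> disc sG tf g x Gg gx.
have [V [oV VG]] := disc 1%g (subgroup1 sG).
have [V1 _] : (V `&` G) 1%g by rewrite VG.
have [s fs hs] := oV _ V1; have [k k0 hk] := isom_power_fixes gx fs.
apply: (tf g k k0 Gg); suff: (V `&` G) (g ^+ k)%g by rewrite VG.
by split; [apply: hs|apply: subgroupX].
Qed.

End LocallyFinite.

(** * Runs of the algorithm *)

Section LoopCorrect.
Variables (R : realType) (H : groupType) (W : gtree H) (A B : H) (wX wY : free2).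
Local Notation X := (word_eval A B wX).
Local Notation Y := (word_eval A B wY).
Hypothesis treeW : is_tree W.
Hypotheses (tX : translates W X) (tY : translates W Y).
Hypothesis genXY : gen2 X Y = gen2 A B.
Variable dd : domain_data W.
Hypothesis valid : valid_domain R (gen2 A B) X Y dd.

Let valid' : valid_domain R (gen2 X Y) X Y dd.
Proof. by rewrite genXY. Qed.

(** On exit w(X, Y) z = C z' with z and z' both in D. If C is in G, then w(X, Y)^-1 C moves z' to z
    inside D, so it is 1, and both tests of step (5) succeed. *)
Lemma loop_correct z' C s : in_domain R dd z' ->
  reaches (loop_step R X Y dd) (1%g : free2, act C z') s ->
  final (loop_step R X Y dd) s -> correct_answer A B C (answer A B wX wY C z' s).
Proof.
case: s => w z Dz' reach fin; have Dz := loop_final fin.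
have := loop_invariant reach; rewrite /= word_eval1 act_one => e.
split=> [GC|nGC]; last first.
  rewrite /answer; case: asboolP => // -[/= ew _]; case: nGC.
  by rewrite -genXY -ew; apply/gen2P; exists w.
have Gw : gen2 X Y (word_eval X Y w) by apply/gen2P; exists w.
have h1 : ((word_eval X Y w)^-1 * C)%g = 1%g.
  apply: (in_domain_unique (R := R) (x := z') treeW tX tY (valid_basepoints valid') (valid_half treeW tX tY valid')) => //.
    apply: (subgroupM (gen2_subgroup X Y)); last by rewrite genXY.
    exact: (subgroupV (gen2_subgroup X Y)).
  by rewrite act_mul -e actK.
have ew : word_eval X Y w = C by rewrite -[C]mul1g -(mulgV (word_eval X Y w)) -mulgA h1 mulg1.
exists (word_eval wX wY w); last by rewrite -word_eval_comp.
rewrite /answer asboolT //=; split=> //.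
by rewrite -(actK (word_eval X Y w) z) e -ew actK.
Qed.

Lemma loop_terminates_orbit z k g (w : free2) : gen2 A B g -> in_domain R dd k -> z = act g k ->
  terminates (loop_step R X Y dd) (w, z).
Proof.
move=> Gg Dk ->; rewrite -genXY in Gg.
apply: (loop_terminates (R := R) treeW tX tY (valid_basepoints valid')
  (valid_half treeW tX tY valid')) => // h x.
exact: (valid_invariant valid').
Qed.

End LoopCorrect.

Section Generators.
Variable H : groupType.
Implicit Types X Y : H.

Lemma gen2_swap X Y : gen2 Y X = gen2 X Y.
Proof. exact: gen2_eq. Qed.

Lemma gen2_nielsen X Y : gen2 X (X * Y)%g = gen2 X Y.
Proof.
apply: gen2_eq => //; first exact: (subgroupM (gen2_subgroup X Y)).
have sG := gen2_subgroup X (X * Y)%g.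
suff: gen2 X (X * Y)%g (X^-1 * (X * Y))%g by rewrite mulKg.
by apply: (subgroupM sG) => //; apply: (subgroupV sG).
Qed.

Lemma gen2_nielsenV X Y : gen2 X (X^-1 * Y)%g = gen2 X Y.
Proof.
have sG := gen2_subgroup X Y; apply: gen2_eq => //.
  by apply: (subgroupM sG) => //; apply: (subgroupV sG).
have sG' := gen2_subgroup X (X^-1 * Y)%g.
suff: gen2 X (X^-1 * Y)%g (X * (X^-1 * Y))%g by rewrite mulVKg.
exact: (subgroupM sG').
Qed.

End Generators.

Section ReductionRuns.
Variables (H : groupType) (T : gtree H) (A B : H).
Hypothesis tlen_gt0 : forall X Y : H, gen2 X Y = gen2 A B ->
  [/\ 0 < tlen T X, 0 < tlen T Y, 0 < tlen T (X * Y)%g & 0 < tlen T (X^-1 * Y)%g].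
Local Notation ev := (word_eval A B).
Local Notation l := (fun w : free2 => tlen T (ev w)).
Local Notation step := (red_step T A B).

Lemma red_start_inv x y t : step (RedStart x y) t ->
  (t = RedReturn None /\ (l x = 0 \/ l y = 0)) \/ t = RedLoop x y.
Proof. by move=> st; inversion st; subst; [left|right]. Qed.

Lemma red_loop_inv x0 y0 t : step (RedLoop x0 y0) t -> exists x y,
  [/\ (x, y) = (if l y0 < l x0 then (y0, x0) else (x0, y0)) &
      red_body T A B x y (minn (l (x * y)%g) (l (x^-1 * y)%g)) t].
Proof. by move=> st; inversion st; subst; exists x, y. Qed.

Lemma red_body_inv x y m t : red_body T A B x y m t ->
  [\/ m = 0 /\ t = RedReturn None,
      exists z, [/\ m <= l y - l x, z = (x * y)%g \/ z = (x^-1 * y)%g, l z = m & t = RedLoop x z] |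
      ~ (m <= l y - l x) /\ t = RedReturn (Some (x, y))].
Proof.
by move=> st; inversion st; subst; [constructor 1|constructor 2; exists z|constructor 3].
Qed.

Definition basis x y := gen2 (ev x) (ev y) = gen2 A B.

Lemma basis_sorted x0 y0 x y : basis x0 y0 ->
  (x, y) = (if l y0 < l x0 then (y0, x0) else (x0, y0)) ->
  [/\ basis x y, l x <= l y & l x + l y = l x0 + l y0].
Proof.
rewrite /basis => b; case: ltnP => le [-> ->]; split=> //; last 1 first.
- by rewrite addnC.
- by rewrite gen2_swap.
- exact: ltnW.
Qed.

Lemma basis_step x y z : basis x y -> z = (x * y)%g \/ z = (x^-1 * y)%g -> basis x z.
Proof.
by rewrite /basis => <- [->|->]; rewrite !word_evalM ?word_evalV ?gen2_nielsen ?gen2_nielsenV.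
Qed.

Lemma red_terminates_loop x0 y0 : basis x0 y0 -> terminates step (RedLoop x0 y0).
Proof.
have [n lt] : exists n, l x0 + l y0 < n by exists (l x0 + l y0).+1.
elim: n x0 y0 lt => [|n IH] x0 y0 lt b; first by rewrite ltn0 in lt.
constructor=> t /red_loop_inv [x [y [e]]]; have [b' le es] := basis_sorted b e.
case/red_body_inv => [[_ ->]|[z [h hz lz ->]]|[_ ->]].
- by constructor=> t' st; inversion st.
- have [l1 l2 _ _] := tlen_gt0 b'.
  by apply: IH; [move: lt; rewrite -es lz ltnS; lia|apply: basis_step hz].
- by constructor=> t' st; inversion st.
Qed.

Lemma red_terminates : terminates step (RedStart free2_a free2_b).
Proof.
constructor=> t /red_start_inv [[-> _]|->]; first by constructor=> t' st'; inversion st'.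
by apply: red_terminates_loop; rewrite /basis word_eval_a word_eval_b.
Qed.

(** The answer false is impossible: by [tlen_gt0] no generator and neither of the two products ever
    has translation length 0. *)
Definition red_inv st : Prop :=
  match st with
  | RedStart x y => x = free2_a /\ y = free2_b
  | RedLoop x y => basis x y
  | RedReturn None => False
  | RedReturn (Some (x, y)) => [/\ basis x y, l x <= l y &
      ~ (minn (l (x * y)%g) (l (x^-1 * y)%g) <= l y - l x)]
  end.

Lemma red_inv_step s t : step s t -> red_inv s -> red_inv t.
Proof.
case: s => [x y|x0 y0|o] st; last by inversion st.
  have [l1 l2 _ _] := tlen_gt0 (erefl (gen2 A B)).
  move=> /= [ex ey]; subst x y; case: (red_start_inv st) => [[_]|->].
    by rewrite word_eval_a word_eval_b => -[e|e]; [move: l1|move: l2]; rewrite e.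
  by rewrite /= /basis word_eval_a word_eval_b.
move=> b; have [x [y [e st']]] := red_loop_inv st; have [b' le es] := basis_sorted b e.
case: (red_body_inv st') => [[m0 _]|[z [_ hz _ ->]]|[n ->]] //; last exact: basis_step hz.
have [_ _ l1 l2] := tlen_gt0 b'.
have : 0 < l (x * y)%g by rewrite /= word_evalM.
have : 0 < l (x^-1 * y)%g by rewrite /= word_evalM word_evalV.
by move: m0 => /=; lia.
Qed.

Lemma red_inv_reaches s t : reaches step s t -> red_inv s -> red_inv t.
Proof. by elim=> {s t} [s t /red_inv_step|//|s t u _ IH1 _ IH2 /IH1 /IH2]. Qed.

Lemma red_loop_step x0 y0 : exists t, step (RedLoop x0 y0) t.
Proof.
case E : (if l y0 < l x0 then (y0, x0) else (x0, y0)) => [x y].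
pose m := minn (l (x * y)%g) (l (x^-1 * y)%g).
have [m0|m0] := eqVneq m 0; first by exists (RedReturn None); apply: red_loop (esym E) erefl (red_d _ _ _ _ _ m0).
have [le|gt] := leqP m (l y - l x); last first.
  exists (RedReturn (Some (x, y))); apply: red_loop (esym E) erefl _.
  by apply: red_f; [apply/eqP|apply/negP; rewrite -ltnNge].
have [z [hz lz]] : exists z, (z = (x * y)%g \/ z = (x^-1 * y)%g) /\ l z = m.
  rewrite /m /minn; case: ifP => _; first by exists (x * y)%g; split=> //; left.
  by exists (x^-1 * y)%g; split=> //; right.
exists (RedLoop x z); apply: red_loop (esym E) erefl _.
by apply: red_e => //; apply/eqP.
Qed.

Lemma red_final st : reaches step (RedStart free2_a free2_b) st -> final step st ->
  exists x y, [/\ st = RedReturn (Some (x, y)), basis x y, l x <= l y &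
    ~ (minn (l (x * y)%g) (l (x^-1 * y)%g) <= l y - l x)].
Proof.
move=> reach fin; have := red_inv_reaches reach (conj erefl erefl).
case: st reach fin => [x y|x y|[[x y]|]] //= reach fin.
- case: (pselect (l x = 0 \/ l y = 0)) => h _.
    by case: (fin (RedReturn None)); apply: red_a_false.
  case: (fin (RedLoop x y)); apply: red_a => e; apply: h; [by left|by right].
- by have [t /fin] := red_loop_step x y.
- by move=> [b le n]; exists x, y.
Qed.

End ReductionRuns.

Lemma torsion_free_sq (H : groupType) (G : set H) : torsion_free G ->
  forall h, G h -> (h * h = 1)%g -> h = 1%g.
Proof. by move=> tf h Gh e; apply: (tf h 2) => //; rewrite expgS expg1. Qed.

Lemma ambient_free_action (H : groupType) (op : set (set H)) (T : gtree H) (G : set H) :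
  ambient op T -> is_discrete op G -> is_subgroup G -> torsion_free G ->
  ~ (forall g h, G g -> G h -> (g * h = h * g)%g) ->
  [/\ is_tree T, acts_freely T G & exists x : T, True].
Proof.
move=> amb; case: amb G => {H op T}.
- move=> K v lf G disc sG tf _; have [w w0 vw] := lf_unif lf; split.
  + exact: bt_tree lf _ w0 vw.
  + exact: sl2_free.
  + by exists (vtx v (GLO_unit (GLO1 lf))).
- move=> T _ G disc sG tf nab; split; [exact: lft_tree|exact: isom_free|].
  (* Over an empty tree any two isometries agree, which would make G commutative. *)
  apply: contrapT => none; apply: nab => g h _ _; apply: isom_eq => x.
  by case: none; exists x.
- move=> T G disc sG tf nab; split.
  + exact: (@subdiv_tree _ (isom_gtree T) (lft_tree T)).
  + exact: (subdiv_free sG (isom_free disc sG tf) (torsion_free_sq tf)).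
  + apply: contrapT => none; apply: nab => g h _ _; apply: isom_eq => x.
    by case: none; exists (@pt _ (isom_gtree T) x).
Qed.

(** Correctness of the answer is asserted for all choices in step (2), and termination for them
    whenever C z' is in the G-orbit of the vertices of D, in particular for C in G. The last clause
    provides a choice for which every C leads to termination. *)
Theorem theorem5p5 (R : realType) (H : groupType) (op : set (set H))
    (T : gtree H) (A B : H) :
  ambient op T -> is_discrete op (gen2 A B) -> free_of_rank2 (gen2 A B) ->
  let start := RedStart free2_a free2_b in
  (* step (1) terminates *)
  terminates (red_step T A B) start /\
  forall st, reaches (red_step T A B) start st -> final (red_step T A B) st ->
  exists wX wY : free2,
    let X := word_eval A B wX in
    let Y := word_eval A B wY in
    (* the output of step (1) *)
    [/\ st = RedReturn (Some (wX, wY)),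
        gen2 X Y = gen2 A B,
        reduced_pair T X Y,
        (* every choice in step (2), T being subdivided or not *)
        forall W : gtree H, W = T \/ W = subdiv T ->
        forall d : domain_data W, valid_domain R (gen2 A B) X Y d ->
          [/\ is_fundamental_domain (gen2 A B) (realise (dS d)) (domain R d),
              exists z', in_domain R d z' &
              forall z', in_domain R d z' -> forall C : H,
              let init := (1%g : free2, act C z') in
              [/\ gen2 A B C -> terminates (loop_step R X Y d) init,
                  (exists2 g, gen2 A B g & in_domain R d (act (g * C)%g z')) ->
                    terminates (loop_step R X Y d) init &
                  forall s, reaches (loop_step R X Y d) init s ->
                    final (loop_step R X Y d) s ->
                    correct_answer A B C (answer A B wX wY C z' s)]] &
        (* a choice in step (2) with which the algorithm always terminates *)
        exists W : gtree H, (W = T \/ W = subdiv T) /\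
        exists d : domain_data W, valid_domain R (gen2 A B) X Y d /\
        exists z', in_domain R d z' /\
        forall C : H,
          terminates (loop_step R X Y d) (1%g : free2, act C z') /\
          forall s, reaches (loop_step R X Y d) (1%g : free2, act C z') s ->
            final (loop_step R X Y d) s ->
            correct_answer A B C (answer A B wX wY C z' s)].
Proof.
move=> amb disc fr2 start; have sG := gen2_subgroup A B.
have tf : torsion_free (gen2 A B) by exact: free_of_rank2_torsion_free.
have nab := free_of_rank2_nonabelian fr2; have sq := torsion_free_sq tf.
have [treeT freeT [x0 _]] := ambient_free_action amb disc sG tf nab.
have noncomm X Y : gen2 X Y = gen2 A B -> (X * Y)%g <> (Y * X)%g.
  by move=> e c; apply: nab; rewrite -e; apply: gen2_abelian.
have treeW := subdiv_tree treeT; have freeW := subdiv_free sG freeT sq.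
(* If X, Y, XY or X^-1 Y were trivial, then X and Y would commute, and with them all of G. *)
have trans (W : gtree H) (w0 : W) : is_tree W -> acts_freely W (gen2 A B) ->
    forall X Y, gen2 X Y = gen2 A B -> [/\ translates W X, translates W Y,
      translates W (X * Y)%g & translates W (X^-1 * Y)%g].
  move=> tW fW X Y e; have n := noncomm X Y e.
  have tr g : gen2 X Y g -> g <> 1%g -> translates W g.
    by rewrite e; apply: (free_translates w0 tW sG fW sq).
  have sG' := gen2_subgroup X Y.
  split; apply: tr => //.
  - by move=> E; apply: n; rewrite E mul1g mulg1.
  - by move=> E; apply: n; rewrite E mul1g mulg1.
  - exact: (subgroupM sG').
  - move=> E; apply: n; have -> : Y = X^-1%g by rewrite -(mulKg X Y) E mulg1.
    by rewrite mulgV mulVg.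
  - by apply: (subgroupM sG') => //; apply: (subgroupV sG').
  - by move=> E; apply: n; have -> : Y = X by rewrite -(mulVKg X Y) E mulg1.
have pos X Y : gen2 X Y = gen2 A B ->
    [/\ 0 < tlen T X, 0 < tlen T Y, 0 < tlen T (X * Y)%g & 0 < tlen T (X^-1 * Y)%g].
  by move=> /(trans _ x0 treeT freeT) [[? _] [? _] [? _] [? _]].
split; first exact: red_terminates pos.
move=> st reach fin; have [wX [wY [est bas le crit]]] := red_final pos reach fin.
exists wX, wY => X Y; rewrite /basis -/X -/Y in bas.
rewrite !word_evalM word_evalV -/X -/Y in le crit.
have [tX tY tXY tVY] := trans _ x0 treeT freeT X Y bas.
have double g : gen2 A B g -> tlen (subdiv T) g = 2 * tlen T g.
  move=> Gg; have [->|/eqP g1] := eqVneq g 1%g.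
    have z (V : gtree H) (v : V) : is_tree V -> tlen V 1%g = 0.
      move=> tV; apply/eqP; rewrite -leqn0.
      by have := tlen_le 1%g v; rewrite act_one distxx.
    by rewrite (z _ (pt x0) treeW) (z _ x0 treeT).
  apply: (subdiv_tlen treeT x0) => x.
  by rewrite -act_mul => /(freeT _ _ (subgroupM sG Gg Gg)) /(sq _ Gg).
have [sX sY sXY sVY] := trans _ (pt x0) treeW freeW X Y bas.
have [GX GY] : gen2 A B X /\ gen2 A B Y by rewrite -bas; split.
(* The exit test involves translation lengths only, homogeneously, so it survives their doubling. *)
have redW : reduced_pair (subdiv T) X Y.
  apply: (reduced_criterion treeW sX sY).
    by rewrite !double // leq_mul2l le.
  rewrite !double //; [by rewrite -minnMr -mulnBr leq_mul2l|exact: (subgroupM sG (subgroupV sG GX) GY)|exact: (subgroupM sG GX GY)].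
have cor (W : gtree H) : W = T \/ W = subdiv T ->
    [/\ is_tree W, translates W X & translates W Y].
  by case=> ->.
split; [exact: est|exact: bas|exact: reduced_criterion| |].
- move=> W hW d valid; have [tW wX' wY'] := cor W hW.
  have valid' : valid_domain R (gen2 X Y) X Y d by rewrite bas.
  split.
  + by rewrite -bas; apply: valid_fundamental.
  + exact: valid_domain_vertex valid'.
  + move=> z' Dz' C init; split.
    * by move=> GC; apply: (loop_terminates_orbit tW wX' wY' bas valid _ GC Dz').
    * move=> [g Gg Dg]; apply: (loop_terminates_orbit tW wX' wY' bas valid _ (subgroupV sG Gg) Dg).
      by rewrite act_mul actK.
    * by move=> s; apply: loop_correct.
exists (subdiv T); split; first by right.
have [d [valid [z' [Dz mz cover]]]] := mid_domain R treeW (mid_adj treeT) (@mid_act _ T)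
  (@mid_deg _ T treeT) redW sX sY (pt x0).
rewrite bas in valid cover.
exists d; split; first exact: valid.
exists z'; split; first exact: Dz.
move=> C; split; last by move=> s; apply: loop_correct.
(* All of H, not only G, preserves the set of midpoints, so C z' is an original vertex and lies in a
   translate of D. *)
have [|g [k [Gg Dk e]]] := cover (act C z'); first by rewrite mid_act.
exact: (loop_terminates_orbit treeW sX sY bas valid _ Gg Dk e).
Qed.
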